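(* Let $(a,b)\in\mathbb{R}/\mathbb{Z}\times[0,1]$ be a parameter in a tongue of the complexified Double Standard Map family, i.e. $g_{a,b}$ has an attracting cycle on $\mathbb{S}^1$. Then the following statements are true. (1) $C_{a,b}$ is a hyperbolic set for $g_{a,b}$. The one-dimensional Lebesgue measure of $C_{a,b}$ is zero, and hence $C_{a,b}$ is nowhere dense in $\mathbb{S}^1$. (2) If $g_{a,b}$ is Devaney chaotic on some closed, forward invariant subset $X$ of $\mathbb{S}^1$, then $X$ is contained in the complement of the entire basin of attraction, i.e. $X\subset C_{a,b}$. In particular, $X$ has one-dimensional Lebesgue measure $0$.
   Context: For $(a,b)\in\mathbb{R}/\mathbb{Z}\times[0,1]$, $g_{a,b}:\mathbb{C}^*\to\mathbb{C}^*$ is $g_{a,b}(z)=e^{2\pi i a}z^2\exp(bz-b/z)$, where $\mathbb{C}^*=\mathbb{C}\setminus\{0\}$; it preserves the unit circle $\mathbb{S}^1$. A parameter $(a,b)$ lies in a tongue iff $g_{a,b}$ has an attracting cycle on $\mathbb{S}^1$; this attracting cycle is then unique. Let $B_0$ be the immediate basin of attraction of this cycle, $\mathcal{B}_\infty=\left(\bigcup_{j\ge 0}g_{a,b}^{-j}(B_0)\right)\cap\mathbb{S}^1$ (the total basin of attraction in $\mathbb{S}^1$) and $C_{a,b}=\mathbb{S}^1\setminus\mathcal{B}_\infty$. A compact forward invariant set $K\subset\mathbb{S}^1$ is a hyperbolic set for $g_{a,b}$ if there exist $C>0$ and $\lambda>1$ such that $|(g_{a,b}^{\circ n})'(z)|\ge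 C\lambda^n$ for all $z\in K$ and $n\in\mathbb{N}$. A continuous map $f:X\to X$ is Devaney chaotic if (1) it is topologically transitive: for any two non-empty open sets $U,V$ of $X$ there is $n\in\mathbb{N}$ with $f^{\circ n}(U)\cap V\neq\emptyset$; and (2) the set of all periodic points of $f$ is dense in $X$. Saying that $g_{a,b}$ is Devaney chaotic on $X$ means that the restriction $g_{a,b}|_X:X\to X$ is Devaney chaotic.
   Formalization: In (2) the inclusion X ⊂ C_{a,b} is claimed only for X different from the attracting cycle itself: that cycle is closed, forward invariant and Devaney chaotic as defined, but lies in the basin. The measure-zero claim is kept for every X. *)

(* Defs.v *)
From HB Require Import structures.
From mathcomp Require Import all_boot all_order all_algebra.
From mathcomp Require Import all_classical all_reals all_analysis.
From mathcomp.real_closed Require Import complex.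

Set Implicit Arguments.
Unset Strict Implicit.
Unset Printing Implicit Defensive.

Import Order.TTheory GRing.Theory Num.Theory.
Import numFieldNormedType.Exports.

Local Open Scope classical_set_scope.
Local Open Scope ring_scope.
Local Open Scope complex_scope.

(* The iterates are indexed by all n >= 0.  For devaney_chaotic, allowing n = 0
   here changes nothing: a periodic point of U `&` V returns to V in positive
   time.  Sensitive dependence is not required, so a single cycle is Devaney
   chaotic on itself. *)
Definition topologically_transitive (T : topologicalType) (f : T -> T) : Prop :=
  forall U V : set T, open U -> open V -> U !=set0 -> V !=set0 ->
    exists n, (iter n f @` U) `&` V !=set0.

Definition periodic_points (T : Type) (f : T -> T) : set T :=
  [set x | exists2 n, (0 < n)%N & iter n f x = x].

Definition devaney_chaotic (T : topologicalType) (f : T -> T) : Prop :=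
  [/\ continuous f, topologically_transitive f & dense (periodic_points f)].

Definition forward_invariant (T : Type) (f : T -> T) (X : set T) : Prop :=
  forall x, X x -> X (f x).

Definition restriction (T : Type) (f : T -> T) (X : set T)
    (fX : forward_invariant f X) : set_type X -> set_type X :=
  fun x => SigSub (mem_set (fX (\val x) (set_mem (valP x)))).

Definition nowhere_dense (T : topologicalType) (A : set T) : Prop :=
  interior (closure A) = set0.

(* For a finite set O (a cycle), convergence to the neighbourhood filter of O
   says that the distance from the k-th iterate to O tends to 0. *)
Definition basin (T : topologicalType) (f : T -> T) (O : set T) : set T :=
  [set x | (fun k => iter k f x) @ \oo `=>` set_nbhs O].

Definition immediate_basin (T : topologicalType) (f : T -> T) (O : set T)
  : set T := \bigcup_(p in O) connected_component (basin f O) p.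

(* MathComp-Analysis attaches the norm topology of a numFieldType K to the
   alias K^o. *)
Definition CC (R : realType) : normedModType R[i] := (R[i])^o.

Definition cis (R : realType) (t : R) : CC R := cos t +i* sin t.

Definition cexp (R : realType) (z : R[i]) : R[i] :=
  (expR (complex.Re z))%:C * cis (complex.Im z).

(* The map on the punctured plane, extended by the junk value 0 at 0 (0^-1 = 0).
   As 0 is then a fixed point whose only preimage is 0, it belongs neither to
   the basin of a cycle on the unit circle nor to any preimage of that basin.
   The parameter a is a real representative of a class in R/Z. *)
Definition dsm (R : realType) (a b : R) : CC R -> CC R :=
  fun z : R[i] =>
    cis (2 * pi * a) * z ^+ 2 * cexp (b%:C * z - b%:C / z).

Definition circle (R : realType) : set (CC R) := [set z | `|z| = 1].
Arguments circle R : clear implicits.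

(* Arc length. *)
Definition circle_measure (R : realType) (A : set (CC R)) : \bar R :=
  lebesgue_measure [set t : R | 0 <= t < 2 * pi /\ A (cis t)].

(* Derivatives below are complex derivatives. *)
Definition attracting_cycle (R : realType) (f : CC R -> CC R)
    (O : set (CC R)) : Prop :=
  exists p n,
    [/\ (0 < n)%N, iter n f p = p,
        forall m, (0 < m < n)%N -> iter m f p <> p,
        O = [set iter k f p | k in [set: nat]]
      & `|derive1 (iter n f) p| < 1].

Definition hyperbolic_set (R : realType) (f : CC R -> CC R)
    (K : set (CC R)) : Prop :=
  [/\ compact K, K `<=` circle R, forward_invariant f K &
      exists c lam : R, [/\ 0 < c, 1 < lam &
        forall z n, K z ->
          (c * lam ^+ n)%:C <= `|derive1 (iter n f) z|]].

Definition total_basin (R : realType) (f : CC R -> CC R) (O : set (CC R))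
  : set (CC R) :=
  (\bigcup_j (iter j f @^-1` immediate_basin f O)) `&` circle R.

(* The set C_{a,b}, for f = dsm a b and O its attracting cycle. *)
Definition basin_complement (R : realType) (f : CC R -> CC R) (O : set (CC R))
  : set (CC R) := circle R `\` total_basin f O.

(* Main.v *)
Require Import Defs.
From HB Require Import structures.
From mathcomp Require Import all_boot all_order all_algebra.
From mathcomp Require Import all_classical all_reals all_analysis.
From mathcomp.real_closed Require Import complex.
From mathcomp Require Import ring lra.

Set Implicit Arguments.
Unset Strict Implicit.
Unset Printing Implicit Defensive.

Import Order.TTheory GRing.Theory Num.Theory.
Import numFieldNormedType.Exports.

Local Open Scope classical_set_scope.
Local Open Scope ring_scope.
Local Open Scope complex_scope.

(** Write [f] for the map. In the coordinate [s] with [z = exp s] it becomes the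
    entire map [L s = 2 pi i a + 2 s + b (e^s - e^-s)], the circle becomes the
    imaginary axis, and the reflection in the circle becomes [sigma], which
    commutes with [L]. The derivative [L' = 2 + b (z + 1/z)] is also the
    logarithmic derivative of [f], so on the circle the iterates of [L] and of
    [f] have derivatives of the same modulus.

    Everything rests on lifting discs. A holomorphic disc [phi] such that
    [exp phi] avoids the critical values of [f] lifts through [L]
    ([lift_exists], [disc_lift]): off the critical values [L] has local inverses
    on balls of uniform size ([Lp_lower], [Lm_near_linear]), and the lift is
    built by finitely many radial steps. Discs that avoid a fixed ball, or that
    omit both ends of the vertical line through their centre, have bounded
    derivative at the centre
    ([avoid_disc_bound], [slit_bound]); both bounds come from Cauchy's estimate,
    which is proved here with integral means over circles.

    Hyperbolicity. If no critical orbit came near the attracting cycle, a fixed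
    disc at a point of the cycle could be lifted for ever backwards along the
    cycle. The lifts are symmetric under [sigma], so they meet the imaginary
    axis only within a period of their centre, and [slit_bound] bounds their
    derivatives, while the multiplier forces these to tend to infinity. Hence
    some critical point is attracted, and by symmetry all of them are
    ([fatou]). Growing a neighbourhood of the cycle backwards along the
    critical orbits gives a trapping set [W] that contains all critical values
    and no point of the circle outside the basin ([crit_trap]). Discs off [W] then lift to discs off [W],
    and the lift can be enlarged by a definite factor; as all of them avoid a
    fixed ball, the derivatives of the iterates at points of the circle outside
    the basin grow exponentially ([trap_expansion], [basin_expansion]).

    Measure. Let [K] be the closed set of angles outside the basin. An interval
    in [K] would be expanded to a full turn, so [K] has empty interior and, by
    periodicity, its complement has an interval of definite length in every
    interval of a given length ([uniform_gap]). By expansion and bounded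
    distortion these gaps are visible at all small scales around each point of
    [K], which therefore has no density points and is null by Lebesgue's density
    theorem ([expanding_null]).

    Chaos. Periodic points in the basin lie on the cycle [O]. If they are dense in
    [X] and [X] meets the basin, then [X] contains [O] and coincides with it inside
    the basin, so [O] is relatively open in [X], and transitivity forces [X = O]
    ([devaney_in_basin]). *)

(** * The modulus and continuity *)

Section Modulus.
Variable R : realType.
Local Notation C := (CC R).
Implicit Types z w : C.

(** The modulus as a real number: the norm of [R[i]] takes its values in [R[i]]. *)
Definition nc z : R := Normc.normc (z : R[i]).
Arguments nc : simpl never.

Lemma normE z : `|z| = (nc z)%:C. Proof. by []. Qed.
Lemma nc_ge0 z : 0 <= nc z. Proof. by case: z => x y; exact: sqrtr_ge0. Qed.
Lemma nc0 : nc 0 = 0. Proof. exact: Normc.normc0. Qed.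
Lemma nc1 : nc 1 = 1. Proof. exact: Normc.normc1. Qed.
Lemma ncM z w : nc (z * w) = nc z * nc w. Proof. exact: Normc.normcM. Qed.
Lemma ncV z : nc z^-1 = (nc z)^-1. Proof. exact: Normc.normcV. Qed.
Lemma ncX z n : nc (z ^+ n) = nc z ^+ n.
Proof. by elim: n => [|n IH]; rewrite ?expr0 ?nc1// !exprS ncM IH. Qed.
Lemma ncN z : nc (- z) = nc z.
Proof. by case: z => x y; rewrite /nc /= !sqrrN. Qed.
Lemma ncB z w : nc (z - w) = nc (w - z). Proof. by rewrite -ncN opprB. Qed.
Lemma ncD z w : nc (z + w) <= nc z + nc w.
Proof. by have := ler_normD (z : R[i]) w; rewrite !normE -rmorphD lecR. Qed.
Lemma ncDl z w : nc z - nc w <= nc (z + w).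
Proof. by rewrite lerBlDr -{1}(addrK w z) (le_trans (ncD _ _))// ncN. Qed.
Lemma ncBl z w : nc z - nc w <= nc (z - w).
Proof. by rewrite -(ncN w) ncDl. Qed.
Lemma nc_eq0 z : (nc z == 0) = (z == 0).
Proof.
by apply/eqP/eqP => [|->]; [exact: Normc.eq0_normc | exact: nc0].
Qed.
Lemma nc_gt0 z : (0 < nc z) = (z != 0).
Proof. by rewrite lt_def nc_ge0 andbT nc_eq0. Qed.
Lemma nc_real (x : R) : nc (x%:C : R[i]) = `|x|.
Proof. by rewrite /nc /= expr0n addr0 sqrtr_sqr. Qed.
Lemma nc_imag (x : R) : nc ((0 +i* x) : R[i]) = `|x|.
Proof. by rewrite /nc /= expr0n add0r sqrtr_sqr. Qed.
Lemma nc_conj z : nc (conjc (z : R[i])) = nc z.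
Proof. by case: z => x y; rewrite /nc /= sqrrN. Qed.
Lemma nc_sqr z : nc z ^+ 2 = complex.Re (z : R[i]) ^+ 2 + complex.Im (z : R[i]) ^+ 2.
Proof. by case: z => x y; rewrite /nc /= sqr_sqrtr// addr_ge0// sqr_ge0. Qed.
Lemma nc_Re z : `|complex.Re (z : R[i])| <= nc z.
Proof. by rewrite -sqrtr_sqr; case: z => x y; rewrite ler_wsqrtr//= lerDl sqr_ge0. Qed.
Lemma nc_Im z : `|complex.Im (z : R[i])| <= nc z.
Proof. by rewrite -sqrtr_sqr; case: z => x y; rewrite ler_wsqrtr//= lerDr sqr_ge0. Qed.
Lemma nc_le z : nc z <= `|complex.Re (z : R[i])| + `|complex.Im (z : R[i])|.
Proof.
rewrite -(ler_sqr (nc_ge0 z)) ?nnegrE ?addr_ge0//.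
by rewrite nc_sqr sqrrD !real_normK ?num_real// lerD2r lerDl mulrn_wge0// mulr_ge0.
Qed.
Lemma nc_nat n : nc (n%:R : R[i]) = n%:R.
Proof. by rewrite -(rmorph_nat (real_complex R)) nc_real normr_nat. Qed.

Lemma nbhs_ncP z (A : set C) :
  nbhs z A <-> exists2 e : R, 0 < e & forall w, nc (w - z) < e -> A w.
Proof.
split=> [/nbhs_ballP[e /= e0 eA]|[e e0 eA]].
  have eR := RRe_real (gtr0_real e0).
  exists (complex.Re e) => [|w wz]; first by rewrite -ltcR eR.
  by apply: eA; rewrite /ball /= -eR distrC normE ltcR.
apply/nbhs_ballP; exists e%:C => /=; first by rewrite ltcR.
by move=> w; rewrite /ball /= distrC normE ltcR => /eA.
Qed.

Lemma cvg_ncP (T : Type) (F : set_system T) {FF : Filter F} (f : T -> C) z :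
  f @ F --> z <-> forall e : R, 0 < e -> \forall x \near F, nc (f x - z) < e.
Proof.
split=> [fz e e0|H A /nbhs_ncP[e e0 eA]].
  by apply: (fz [set w | nc (w - z) < e]); apply/nbhs_ncP; exists e.
by apply: filterS (H e e0) => x /eA.
Qed.

Lemma cont_ncP (f : C -> C) z : {for z, continuous f} <->
  forall e : R, 0 < e -> exists2 d : R, 0 < d &
    forall w, nc (w - z) < d -> nc (f w - f z) < e.
Proof.
split=> [fz e e0|H].
  exact/nbhs_ncP/((@cvg_ncP _ (nbhs z) (nbhs_filter z) f (f z)).1 fz).
by apply: (@cvg_ncP _ (nbhs z) (nbhs_filter z) f (f z)).2 => e /H/nbhs_ncP.
Qed.

Lemma cont_nc (T : topologicalType) (f : T -> C) x :
  {for x, continuous f} -> {for x, continuous (nc \o f)}.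
Proof.
move=> fx; apply/cvgrPdist_lt => e e0.
have H := (@cvg_ncP _ (nbhs x) (nbhs_filter x) f (f x)).1 fx e e0; apply: filterS H => y ye /=.
apply: le_lt_trans ye; rewrite ler_norml lerNl opprB !lerBlDr.
have := ncD (f y - f x) (f x); have := ncD (f x - f y) (f y).
by rewrite !subrK (ncB (f x)) => -> ->.
Qed.

Section Cont.
Variable T : topologicalType.
Implicit Types (f g : T -> C) (x : T).
Lemma contK (c : C) x : {for x, continuous (fun _ : T => c)}.
Proof. exact: cvg_cst. Qed.
Lemma contD f g x : {for x, continuous f} -> {for x, continuous g} ->
  {for x, continuous (fun y => f y + g y : C)}.
Proof. by move=> fx gx; exact: (continuousD fx gx). Qed.
Lemma contN f x : {for x, continuous f} -> {for x, continuous (fun y => - f y : C)}.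
Proof. by move=> fx; exact: (continuousN fx). Qed.
Lemma contB f g x : {for x, continuous f} -> {for x, continuous g} ->
  {for x, continuous (fun y => f y - g y : C)}.
Proof. by move=> fx gx; exact: (contD fx (contN gx)). Qed.
Lemma contM f g x : {for x, continuous f} -> {for x, continuous g} ->
  {for x, continuous (fun y => f y * g y : C)}.
Proof. by move=> fx gx; exact: (continuousM fx gx). Qed.
Lemma contV f x : {for x, continuous f} -> f x != 0 ->
  {for x, continuous (fun y => (f y)^-1 : C)}.
Proof. by move=> fx f0; exact: (@continuousV R[i] T f x f0 fx). Qed.
End Cont.

Lemma contI z : {for z, continuous (fun w : C => w)}.
Proof. exact: cvg_id. Qed.

(** * Compactness of closed discs *)

Lemma cont_Complex (T : topologicalType) (u v : T -> R) t :
  {for t, continuous u} -> {for t, continuous v} ->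
  {for t, continuous (fun x => (u x +i* v x : C))}.
Proof.
move=> ut vt; apply/(cvg_ncP (F := nbhs t)) => e e0.
have e2 : 0 < e / 2 by rewrite divr_gt0.
have /cvgrPdist_lt/(_ _ e2) Hu := ut; have /cvgrPdist_lt/(_ _ e2) Hv := vt.
near=> x.
apply: (le_lt_trans (nc_le _)) => /=; rewrite [ltRHS]splitr distrC ltrD//.
  by near: x.
by rewrite distrC; near: x.
Unshelve. all: by end_near. Qed.

Lemma cont_Re z : {for z, continuous (fun z : C => complex.Re (z : R[i]))}.
Proof.
apply/(cvgrPdist_lt (F := nbhs z)) => e e0; apply/nbhs_ncP; exists e => // w wz.
by rewrite -raddfB (le_lt_trans (nc_Re _))// ncB.
Qed.

Lemma cont_Im z : {for z, continuous (fun z : C => complex.Im (z : R[i]))}.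
Proof.
apply/(cvgrPdist_lt (F := nbhs z)) => e e0; apply/nbhs_ncP; exists e => // w wz.
by rewrite -raddfB (le_lt_trans (nc_Im _))// ncB.
Qed.

Lemma closed_ncle (f : C -> C) (r : R) : continuous f ->
  closed [set z : C | nc (f z) <= r].
Proof.
move=> cf; apply: (@closed_comp _ _ (nc \o f) [set x | x <= r]).
  by move=> z _; apply: cont_nc; exact: cf.
exact: closed_le.
Qed.

Lemma compact_cball z0 (r : R) : compact [set z : C | nc (z - z0) <= r].
Proof.
pose A := `[complex.Re (z0 : R[i]) - r, complex.Re (z0 : R[i]) + r]%classic
  `*` `[complex.Im (z0 : R[i]) - r, complex.Im (z0 : R[i]) + r]%classic.
have cA : compact A by apply: compact_setX; exact: segment_compact.
have cB : compact [set (x.1 +i* x.2 : C) | x in A].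
  apply: continuous_compact cA; apply: continuous_subspaceT => x.
  apply: cont_Complex; [exact: cvg_fst | exact: cvg_snd].
apply: subclosed_compact cB _.
  by apply: closed_ncle => z; apply: contB; [exact: contI|exact: contK].
move=> z /= zr; exists (complex.Re (z : R[i]), complex.Im (z : R[i])); last by case: z {zr}.
have := le_trans (nc_Re _) zr; have := le_trans (nc_Im _) zr.
by rewrite !raddfB !ler_distl /A /= !in_itv /= => -> ->.
Qed.

End Modulus.
Arguments nc {R} z : simpl never.

(** * Complex derivatives *)

Section Cdiff.
Variable R : realType.
Local Notation C := (CC R).
Implicit Types (z w d : C).

(** Complex derivatives in Caratheodory's form, in which the chain rule and the
    inverse rule are compositions of continuous functions. *)
Definition cdiff (f : C -> C) z d := exists q : C -> C,
  [/\ {for z, continuous q}, q z = d & \forall w \near z, f w - f z = q w * (w - z)].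

Lemma cdiff_cont f z d : cdiff f z d -> {for z, continuous f}.
Proof.
move=> [q [cq qd H]].
have cg : {for z, continuous (fun w => f z + q w * (w - z) : C)}.
  apply: contD; first exact: contK.
  apply: contM; first exact: cq.
  by apply: contB; [exact: contI|exact: contK].
have E : {near nbhs z, (fun w => f z + q w * (w - z)) =1 f}.
  by near=> w; rewrite -(near H w)// addrC subrK.
move: cg; rewrite /prop_for /continuous_at subrr mulr0 addr0.
exact: (cvg_trans (near_eq_cvg E)).
Unshelve. all: by end_near. Qed.

Lemma cdiffK (c : C) z : cdiff (fun=> c) z 0.
Proof.
by exists (fun=> 0); split=> //; [exact: contK|near=> w; rewrite subrr mul0r].
Unshelve. all: by end_near. Qed.

Lemma cdiffI z : cdiff (fun w => w) z 1.
Proof.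
by exists (fun=> 1); split=> //; [exact: contK|near=> w; rewrite mul1r].
Unshelve. all: by end_near. Qed.

Lemma cdiffD f g z d e : cdiff f z d -> cdiff g z e -> cdiff (fun w => f w + g w) z (d + e).
Proof.
move=> [p [cp pd Hp]] [q [cq qe Hq]].
exists (fun w => p w + q w); split; [exact: (contD cp cq)|by rewrite pd qe|].
near=> w; rewrite opprD addrACA (near Hp w)// (near Hq w)// mulrDl//.
Unshelve. all: by end_near. Qed.

Lemma cdiffM f g z d e : cdiff f z d -> cdiff g z e ->
  cdiff (fun w => f w * g w) z (d * g z + f z * e).
Proof.
move=> Hf; have cf := cdiff_cont Hf; case: Hf => [p [cp pd Hp]] [q [cq qe Hq]].
exists (fun w => p w * g z + f w * q w); split.
- apply: contD; last exact: (contM cf cq).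
  by apply: contM; [exact: cp|exact: contK].
- by rewrite pd qe.
near=> w.
rewrite mulrDl mulrAC -(near Hp w)// -mulrA -(near Hq w)//; ring.
Unshelve. all: by end_near. Qed.

Lemma cdiffN f z d : cdiff f z d -> cdiff (fun w => - f w) z (- d).
Proof.
move=> [p [cp pd Hp]]; exists (fun w => - p w); split; [exact: (contN cp)|by rewrite pd|].
by near=> w; rewrite mulNr -(near Hp w)// opprD.
Unshelve. all: by end_near. Qed.

Lemma cdiffB f g z d e : cdiff f z d -> cdiff g z e -> cdiff (fun w => f w - g w) z (d - e).
Proof. by move=> fd ge; exact: (cdiffD fd (cdiffN ge)). Qed.

Lemma cdiffV f z d : cdiff f z d -> f z != 0 -> cdiff (fun w => (f w)^-1) z (- d / f z ^+ 2).
Proof.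
move=> Hf f0; have cf := cdiff_cont Hf; case: Hf => [p [cp pd Hp]].
exists (fun w => - p w * ((f w)^-1 * (f z)^-1)); split.
- apply: contM; first exact: (contN cp).
  by apply: contM; [exact: (contV cf f0)|exact: contK].
- by rewrite pd expr2 invfM.
have N0 : \forall w \near z, f w != 0.
  have fz0 : 0 < nc (f z) by rewrite nc_gt0.
  have := (cont_ncP f z).1 cf _ fz0; move=> /nbhs_ncP; apply: filterS => w.
  by apply: contraTneq => ->; rewrite sub0r ncN ltxx.
near=> w.
have w0 : f w != 0 by near: w.
rewrite mulrAC mulNr -(near Hp w)//; field.
by rewrite w0 f0.
Unshelve. all: by end_near. Qed.

Lemma cdiff_comp f g z d e : cdiff g z d -> cdiff f (g z) e -> cdiff (fun w => f (g w)) z (e * d).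
Proof.
move=> Hg; have cg := cdiff_cont Hg; case: Hg => [p [cp pd Hp]] [q [cq qe Hq]].
exists (fun w => q (g w) * p w); split.
- exact: (contM (continuous_comp cg cq) cp).
- by rewrite pd qe.
have Hq' : \forall w \near z, f (g w) - f (g z) = q (g w) * (g w - g z).
  exact: (cg _ Hq).
by near=> w; rewrite (near Hq' w)// (near Hp w)// mulrA.
Unshelve. all: by end_near. Qed.

(** A continuous local right inverse of a function with non-zero derivative is
    differentiable; this is how lifts inherit holomorphy. *)
Lemma cdiff_lift f g h z d e : {for z, continuous g} -> cdiff f (g z) e -> e != 0 ->
  cdiff h z d -> (\forall w \near z, f (g w) = h w) -> cdiff g z (d / e).
Proof.
move=> cg [q [cq qe Hq]] e0 [p [cp pd Hp]] H.
have cqg : {for z, continuous (fun w => q (g w))} by exact: (continuous_comp cg cq).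
exists (fun w => p w / q (g w)); split.
- by apply: (contM cp (contV cqg _)); rewrite qe.
- by rewrite pd qe.
have Hq' : \forall w \near z, f (g w) - f (g z) = q (g w) * (g w - g z).
  exact: (cg _ Hq).
have N0 : \forall w \near z, q (g w) != 0.
  have fz0 : 0 < nc e by rewrite nc_gt0.
  have := (cont_ncP _ z).1 cqg _ fz0; move=> /nbhs_ncP; apply: filterS => w /=.
  by apply: contraTneq => ->; rewrite qe sub0r ncN ltxx.
have Hz := nbhs_singleton H.
near=> w.
have w0 : q (g w) != 0 by near: w.
by rewrite mulrAC -(near Hp w)// -(near H w)// -Hz (near Hq' w)// mulrAC mulfV// mul1r.
Unshelve. all: by end_near. Qed.

(** The derivatives in the theorem are those of [derive1]; this is the only passage
    to them. *)
Lemma cdiff_derive1 (f : C -> C) z d : cdiff f z d -> derive1 f z = d.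
Proof.
move=> [q [cq qd Hq]]; rewrite /derive1.
apply: cvg_lim; first exact: norm_hausdorff.
have cqz : (fun h : C => q (h + z)) @ 0^' --> d.
  rewrite -qd.
  have : {for 0 : C, continuous (fun h : C => q (h + z))}.
    apply: (continuous_comp (f := fun h : C => h + z) (g := q)).
      by apply: contD; [exact: contI|exact: contK].
    by rewrite add0r.
  rewrite /prop_for /continuous_at add0r => H.
  exact: cvg_within_filter H.
apply: cvg_trans cqz; apply: near_eq_cvg.
have Hz : \forall h \near (0 : C), f (h + z) - f z = q (h + z) * (h + z - z).
  have cz : {for 0 : C, continuous (fun h : C => h + z)}.
    by apply: contD; [exact: contI|exact: contK].
  have H0 : nbhs (0 + z) [set w | f w - f z = q w * (w - z)] by rewrite add0r.
  exact: (cz _ H0).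
near=> h.
have h0 : h != 0 by near: h; exact: nbhs_dnbhs_neq.
rewrite (near (nbhs_dnbhs Hz) h)// addrK.
by rewrite /GRing.scale /= mulrC mulfK.
Unshelve. all: by end_near. Qed.

End Cdiff.

(** * Derivatives of paths *)

Section Rdiff.
Variable R : realType.
Local Notation C := (CC R).
Implicit Types (z w : C) (t x : R).

(** With [carath_is_derive], lets real derivatives be obtained by the product and
    chain rules for paths, applied to real and imaginary parts. *)
Lemma is_derive_carath (f : R -> R) t (d : R) : is_derive t 1 f d ->
  exists k : R -> R, [/\ {for t, continuous k}, k t = d &
    forall x, f x - f t = k x * (x - t)].
Proof.
move=> [df fd].
exists (fun x => if x == t then d else (f x - f t) / (x - t)); split.
- rewrite /prop_for /continuous_at eqxx.
  apply/cvgrPdist_lt => e e0.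
  have : h^-1 *: ((f \o shift t) (h *: 1) - f t) @[h --> 0^'] --> d.
    by rewrite -fd; exact: df.
  move/cvgrPdist_lt => /(_ e e0)/nbhs_ballP[r /= r0 H].
  apply/nbhs_ballP; exists r => // x /= xt.
  case: eqVneq => [_|xt0]; first by rewrite subrr normr0.
  have := H (x - t); rewrite /ball /= sub0r normrN distrC subr_eq0 => /(_ xt xt0).
  by rewrite /GRing.scale /= mulr1 subrK mulrC.
- by rewrite eqxx.
move=> x; case: eqVneq => [->|xt]; first by rewrite !subrr mulr0.
by rewrite divfK// subr_eq0.
Qed.

Lemma carath_is_derive (f k : R -> R) t (d : R) : {for t, continuous k} -> k t = d ->
  (\forall x \near t, f x - f t = k x * (x - t)) -> is_derive t 1 f d.
Proof.
move=> ck kd H.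
have L : h^-1 *: ((f \o shift t) (h *: 1) - f t) @[h --> 0^'] --> d.
  have ckt : (fun h => k (h + t)) @ (0 : R)^' --> d.
    rewrite -kd.
    have : {for 0 : R, continuous (fun h : R => k (h + t))}.
      apply: (continuous_comp (f := fun h : R => h + t) (g := k)).
        by apply: continuousD; [exact: cvg_id|exact: cvg_cst].
      by rewrite add0r.
    rewrite /prop_for /continuous_at add0r => H'.
    exact: cvg_within_filter H'.
  apply: cvg_trans ckt; apply: near_eq_cvg.
  have Hz : \forall h \near (0 : R), f (h + t) - f t = k (h + t) * (h + t - t).
    have cz : {for 0 : R, continuous (fun h : R => h + t)}.
      by apply: continuousD; [exact: cvg_id|exact: cvg_cst].
    have H0 : nbhs (0 + t) [set w | f w - f t = k w * (w - t)] by rewrite add0r.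
    exact: (cz _ H0).
  near=> h.
  have h0 : h != 0 by near: h; exact: nbhs_dnbhs_neq.
  rewrite /= /GRing.scale /= mulr1 (near (nbhs_dnbhs Hz) h)// addrK.
  by rewrite mulrC mulfK.
apply: DeriveDef; first by apply/cvg_ex; exists d.
by rewrite /derive; apply/cvg_lim.
Unshelve. all: by end_near. Qed.

(** Caratheodory's form again, so that a path composed with a [cdiff] function needs
    no new limit argument. *)
Definition rdiff (g : R -> C) t (d : C) := exists k : R -> C,
  [/\ {for t, continuous k}, k t = d & \forall x \near t, g x - g t = k x * (x - t)%:C].

Lemma rdiff_Complex (u v : R -> R) t (du dv : R) : is_derive t 1 u du -> is_derive t 1 v dv ->
  rdiff (fun x => u x +i* v x) t (du +i* dv).
Proof.
move=> /is_derive_carath[p [cp pd Hp]] /is_derive_carath[q [cq qd Hq]].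
exists (fun x => p x +i* q x); split; [exact: cont_Complex|by rewrite pd qd|].
near=> x; apply/eqP; rewrite eq_complex /= Hp Hq.
by rewrite !mulr0 subr0 add0r !eqxx.
Unshelve. all: by end_near. Qed.

Lemma rdiff_is_derive (g : R -> C) t (d : C) : rdiff g t d ->
  is_derive t 1 (fun x => complex.Re (g x : R[i])) (complex.Re (d : R[i])) /\
  is_derive t 1 (fun x => complex.Im (g x : R[i])) (complex.Im (d : R[i])).
Proof.
move=> [k [ck kd H]]; split.
- apply: (@carath_is_derive _ (fun x => complex.Re (k x : R[i]))); last 2 first.
  + by rewrite kd.
  + near=> x; have := near H x; rewrite -raddfB => ->//.
    by case: (k x) => a b /=; rewrite mulr0 subr0.
  exact: (continuous_comp ck (@cont_Re _ _)).
- apply: (@carath_is_derive _ (fun x => complex.Im (k x : R[i]))); last 2 first.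
  + by rewrite kd.
  + near=> x; have := near H x; rewrite -raddfB => ->//.
    by case: (k x) => a b /=; rewrite mulr0 add0r.
  exact: (continuous_comp ck (@cont_Im _ _)).
Unshelve. all: by end_near. Qed.

Lemma rdiff_cont g t d : rdiff g t d -> {for t, continuous g}.
Proof.
move=> [k [ck kd H]].
have cr : {for t, continuous (fun x => ((x - t)%:C : C))}.
  apply: (cont_Complex (u := fun x => x - t) (v := fun=> 0)); last exact: cvg_cst.
  by apply: continuousB; [exact: cvg_id|exact: cvg_cst].
have cg : {for t, continuous (fun x => g t + k x * (x - t)%:C : C)}.
  apply: contD; first exact: contK.
  by apply: contM; [exact: ck|exact: cr].
have E : {near nbhs t, (fun x => g t + k x * (x - t)%:C) =1 g}.
  by near=> x; rewrite -(near H x)// addrC subrK.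
move: cg; rewrite /prop_for /continuous_at subrr mulr0 addr0.
exact: (cvg_trans (near_eq_cvg E)).
Unshelve. all: by end_near. Qed.

Lemma rdiffK (c : C) t : rdiff (fun=> c) t 0.
Proof.
by exists (fun=> 0); split=> //; [exact: contK|near=> x; rewrite subrr mul0r].
Unshelve. all: by end_near. Qed.

Lemma rdiffM f g t d e : rdiff f t d -> rdiff g t e ->
  rdiff (fun x => f x * g x) t (d * g t + f t * e).
Proof.
move=> Hf; have cf := rdiff_cont Hf; case: Hf => [p [cp pd Hp]] [q [cq qe Hq]].
exists (fun x => p x * g t + f x * q x); split.
- apply: contD; last exact: (contM cf cq).
  by apply: contM; [exact: cp|exact: contK].
- by rewrite pd qe.
near=> x.
rewrite mulrDl mulrAC -(near Hp x)// -mulrA -(near Hq x)//; ring.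
Unshelve. all: by end_near. Qed.

Lemma rdiff_comp (f : C -> C) g t d e : rdiff g t d -> cdiff f (g t) e ->
  rdiff (fun x => f (g x)) t (e * d).
Proof.
move=> Hg; have cg := rdiff_cont Hg; case: Hg => [p [cp pd Hp]] [q [cq qe Hq]].
exists (fun x => q (g x) * p x); split.
- exact: (contM (continuous_comp cg cq) cp).
- by rewrite pd qe.
have Hq' : \forall x \near t, f (g x) - f (g t) = q (g x) * (g x - g t).
  exact: (cg _ Hq).
by near=> x; rewrite (near Hq' x)// (near Hp x)// mulrA.
Unshelve. all: by end_near. Qed.

End Rdiff.

(** * The unit circle as a path *)

Section Cis.
Variable R : realType.
Local Notation C := (CC R).
Implicit Types (t : R).

Lemma nc_cis t : nc (cis t) = 1.
Proof. by rewrite /nc /= cos2Dsin2 sqrtr1. Qed.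

Lemma rdiff_real t : rdiff (fun x : R => (x%:C : C)) t 1.
Proof.
by apply: (rdiff_Complex (u := fun x : R => x) (v := fun=> 0)); exact: is_derive_cst.
Qed.

Lemma rdiff_cis t : rdiff (@cis R) t (('i)%C * cis t).
Proof.
have -> : (('i)%C * cis t : C) = - sin t +i* cos t.
  by apply/eqP; rewrite eq_complex /= !mul0r !mul1r sub0r add0r !eqxx.
exact: rdiff_Complex.
Qed.

Lemma rdiff_cisN t : rdiff (fun x => conjc (cis x : R[i]) : C) t (- ('i)%C * conjc (cis t : R[i])).
Proof.
have -> : (- ('i)%C * conjc (cis t : R[i]) : C) = - sin t +i* - cos t.
  by apply/eqP; rewrite eq_complex /= !oppr0 !mul0r !mulN1r opprK sub0r add0r !eqxx.
apply: rdiff_Complex; exact: is_deriveN.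
Qed.

Lemma cisK t : cis t * conjc (cis t : R[i]) = 1 :> C.
Proof.
apply/eqP; rewrite eq_complex /=.
by rewrite mulrN opprK -!expr2 cos2Dsin2 mulrN mulrC addNr !eqxx.
Qed.

End Cis.

Section Rcont.
Variables (R : realType) (T : topologicalType).
Implicit Types (f g : T -> R) (x : T).
Lemma rcontD f g x : {for x, continuous f} -> {for x, continuous g} ->
  {for x, continuous (fun y => f y + g y : R)}.
Proof. by move=> fx gx; exact: (continuousD fx gx). Qed.
Lemma rcontB f g x : {for x, continuous f} -> {for x, continuous g} ->
  {for x, continuous (fun y => f y - g y : R)}.
Proof. by move=> fx gx; exact: (continuousB fx gx). Qed.
Lemma rcontM f g x : {for x, continuous f} -> {for x, continuous g} ->
  {for x, continuous (fun y => f y * g y : R)}.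
Proof. by move=> fx gx; exact: (continuousM fx gx). Qed.
End Rcont.

(** * Cauchy's estimate at the centre of a disc *)

Section Cauchy.
Variable R : realType.
Local Notation C := (CC R).
Local Notation mu := (@lebesgue_measure R).
Variables (h h1 : C -> C) (rho : R).
Hypothesis rho1 : 1 < rho.
Hypothesis hd : forall z, nc z < rho -> cdiff h z (h1 z).
Hypothesis hc : forall z, nc z < rho -> {for z, continuous h1}.

Let I := `[0, pi *+ 2 : R]%classic.
Let g (s t : R) : C := h (s%:C * cis t) * conjc (cis t : R[i]).
Let u (s t : R) : R := complex.Re (g s t : R[i]).
Let v (s t : R) : R := complex.Re (h1 (s%:C * cis t) : R[i]).
Let J (s : R) : R := \int[mu]_(t in I) u s t.

Let nc_polar (s t : R) : nc (s%:C * cis t) = `|s|.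
Proof. by rewrite ncM nc_cis mulr1 nc_real. Qed.

Let pi2 : 0 < (pi *+ 2 : R). Proof. by rewrite mulrn_wgt0// pi_gt0. Qed.

Let rdiff_polar_s (s t : R) : rdiff (fun x : R => x%:C * cis t : C) s (cis t).
Proof.
by have := rdiffM (rdiff_real s) (rdiffK (cis t) s); rewrite mul1r mulr0 addr0.
Qed.

Let rdiff_polar_t (s t : R) : rdiff (fun x : R => s%:C * cis x : C) t (('i)%C * (s%:C * cis t)).
Proof.
have := rdiffM (rdiffK (s%:C : C) t) (rdiff_cis t).
by rewrite mul0r add0r mulrCA.
Qed.

Let u_s (s t : R) : `|s| < rho -> is_derive s 1 (u^~ t) (v s t).
Proof.
move=> sr; have H := hd (z := s%:C * cis t); rewrite nc_polar in H.
have := rdiffM (rdiff_comp (rdiff_polar_s s t) (H sr)) (rdiffK (conjc (cis t : R[i]) : C) s).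
by rewrite mulr0 addr0 -mulrA cisK mulr1 => /rdiff_is_derive[].
Qed.

Let w_t (s t : R) : `|s| < rho ->
  is_derive t 1 (fun x => complex.Im (g s x : R[i])) (s * v s t - u s t).
Proof.
move=> sr; have H := hd (z := s%:C * cis t); rewrite nc_polar in H.
have := rdiffM (rdiff_comp (rdiff_polar_t s t) (H sr)) (rdiff_cisN t).
set P : C := s%:C * cis t; set c : C := conjc _.
have Pc : P * c = s%:C by rewrite /P /c -mulrA cisK mulr1.
have -> : h1 P * (('i)%C * P) * c + h P * (- ('i)%C * c) =
    ('i)%C * (h1 P * (P * c) - h P * c) by ring.
rewrite Pc => /rdiff_is_derive[_]; congr is_derive.
rewrite -[h P * c]/(g s t) /v /u -/P.
case: (h1 P) => a b; case: (g s t) => d e /=.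
by rewrite !mul0r !mul1r !mulr0 !add0r !subr0 mulrC.
Qed.

Let cu (s : R) : `|s| < rho -> continuous (u s).
Proof.
move=> sr t; have H := hd (z := s%:C * cis t); rewrite nc_polar in H.
have := rdiffM (rdiff_comp (rdiff_polar_t s t) (H sr)) (rdiff_cisN t).
by move/rdiff_cont => cg; exact: (continuous_comp cg (@cont_Re _ _)).
Qed.

Let cw (s : R) : `|s| < rho -> continuous (fun x => complex.Im (g s x : R[i])).
Proof.
move=> sr t; have H := hd (z := s%:C * cis t); rewrite nc_polar in H.
have := rdiffM (rdiff_comp (rdiff_polar_t s t) (H sr)) (rdiff_cisN t).
by move/rdiff_cont => cg; exact: (continuous_comp cg (@cont_Im _ _)).
Qed.

Let cv (s : R) : `|s| < rho -> continuous (v s).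
Proof.
move=> sr t; have H := hc (z := s%:C * cis t); rewrite nc_polar in H.
have c1 := continuous_comp (rdiff_cont (rdiff_polar_t s t)) (H sr).
exact: (continuous_comp c1 (@cont_Re _ _)).
Qed.

Let int_cont (f : R -> R) : continuous f -> mu.-integrable I (EFin \o f).
Proof.
move=> cf; apply: continuous_compact_integrable; first exact: segment_compact.
exact: continuous_subspaceT.
Qed.

(** [s * v - u] is the derivative of a [2 pi]-periodic function of [t], by the
    chain rule for [h (s e^(it)) e^(-it)]; so its integral vanishes. *)
Let Jv (s : R) : `|s| < rho -> J s = s * \int[mu]_(t in I) v s t.
Proof.
move=> sr; apply/esym/eqP; rewrite -subr_eq0; apply/eqP.
have csv : continuous (fun t : R => s * v s t).
  by move=> t; apply: rcontM; [exact: cvg_cst|exact: cv].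
have csu : continuous (fun t : R => s * v s t - u s t).
  by move=> t; exact: (rcontB (csv t) (@cu s sr t)).
rewrite -RintegralZl; [|exact: measurable_itv|exact/int_cont/cv].
rewrite -RintegralB; [|exact: measurable_itv| |]; last 2 first.
- exact: int_cont.
- exact/int_cont/cu.
rewrite /Rintegral (continuous_FTC2 (F := fun x => complex.Im (g s x : R[i])))//.
- rewrite /g -[pi *+ 2]add0r.
  have -> : cis (0 + pi *+ 2) = cis 0 :> C by rewrite /cis cosD2pi sinD2pi.
  by rewrite -EFinB subrr.
- exact: continuous_subspaceT.
- split.
  + by move=> t _; have := w_t t sr; case.
  + exact/cvg_at_right_filter/cw.
  + exact/cvg_at_left_filter/cw.
- by move=> t _; rewrite derive1E; have [_ ->] := w_t t sr.
Qed.

Let J0 : J 0 = 0. Proof. by rewrite Jv ?mul0r// normr0 (lt_trans ltr01). Qed.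

(** Differentiation under the integral sign; [h1] is bounded on a compact disc. *)
Let J_derive (s : R) : `|s| <= 1 -> is_derive s 1 J (\int[mu]_(t in I) v s t).
Proof.
move=> s1; pose r := (1 + rho) / 2.
have [r1 rr] : 1 < r /\ r < rho by rewrite /r !midf_lt.
have [M HM] : exists M, forall z, nc z <= r -> nc (h1 z) <= M.
  have r0 : 0 <= r by rewrite ltW// (lt_trans ltr01).
  have [||z _ H] := @compact_EVT_max _ _ (@nc R \o h1) [set z : C | nc (z - 0) <= r] _ (@compact_cball _ 0 r).
  - by exists 0; rewrite /= [X in X <= _](_ : _ = 0)// subrr; exact: nc0.
  - apply: continuous_in_subspaceT => z; rewrite inE /= subr0 => zr.
    by apply: cont_nc; apply: hc; exact: le_lt_trans rr.
  by exists (nc (h1 z)) => w wr; apply: H; rewrite inE /= subr0.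
have lr x : `]-r, r[%classic x -> `|x| <= r /\ `|x| < rho.
  rewrite /= in_itv /= -ltr_norml => H; split; first exact: ltW.
  exact: lt_trans rr.
have Ia : `]-r, r[%classic s by rewrite /= in_itv /= -ltr_norml (le_lt_trans s1).
have intu x : `]-r, r[%classic x -> mu.-integrable I (EFin \o u x).
  by move=> /lr[_ xr]; exact/int_cont/cu.
have du x t : `]-r, r[%classic x -> I t -> derivable (u^~ t) x 1.
  by move=> /lr[_ xr] _; have [] := u_s t xr.
have d1u x t : `]-r, r[%classic x -> partial1of2 u x t = v x t.
  by move=> /lr[_ xr]; rewrite partial1of2E; have [_ ->] := u_s t xr.
have M0 : 0 <= M by rewrite (le_trans _ (HM 0 _)) ?nc_ge0// nc0 ltW// (lt_trans ltr01).
have intM : mu.-integrable I (EFin \o (fun=> M)) by apply: int_cont => t; exact: cvg_cst.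
have bd x t : `]-r, r[%classic x -> I t -> `|partial1of2 u x t| <= M.
  move=> xr _; rewrite d1u// (le_trans (nc_Re _))// HM// nc_polar.
  by have [] := lr _ xr.
apply: DeriveDef.
  apply: (@derivable_under_integral R _ _ mu u I _ s (- r) r Ia intu du (fun=> M)).
  - exact: measurable_itv.
  - by move=> _; exact: M0.
  - exact: intM.
  - exact: bd.
have <- : J^`()%classic s = 'D_1 J s by rewrite derive1E.
rewrite (@differentiation_under_integral R _ _ mu u I _ s (- r) r Ia intu du (fun=> M)).
- by apply: eq_Rintegral => t _; exact: d1u.
- exact: measurable_itv.
- by move=> _; exact: M0.
- exact: intM.
- exact: bd.
Qed.

(** By [J_derive] and [Jv] the quotient [J s / s] has derivative zero, so it does
    not depend on the radius. *)
Let Jlin (s : R) : 0 < s <= 1 -> J s = s * J 1.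
Proof.
move=> /andP[s0]; rewrite le_eqVlt => /predU1P[->|s1]; first by rewrite mul1r.
pose k x := J x / x.
have dk x : x \in `[s, 1] -> is_derive x 1 k 0.
  rewrite in_itv /= => /andP[sx x1].
  have x0 : 0 < x by exact: lt_le_trans sx.
  have xn : `|x| <= 1 by rewrite gtr0_norm.
  have dJ := J_derive xn.
  have dV : is_derive x 1 (fun y : R => y^-1) (- x ^- 2 *: 1).
    by apply: is_deriveV; rewrite gt_eqF.
  have := is_deriveM dJ dV; congr is_derive.
  rewrite /GRing.scale /= Jv ?(le_lt_trans xn)//.
  by field; rewrite gt_eqF.
have dk' x : x \in `]s, 1[ -> is_derive x 1 k 0.
  by move=> H; apply: dk; exact: subset_itv_oo_cc H.
have ck : {within `[s, 1], continuous k}.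
  apply: derivable_within_continuous => x xI.
  by have [] := dk x xI.
have [x _] := MVT s1 dk' ck.
rewrite mul0r /k divr1 => /eqP; rewrite subr_eq0 => /eqP ->.
by rewrite mulrC divfK// gt_eqF.
Qed.

(** [J 1] is at most [2 pi] by the bound on the circle, and [J 1 = J s / s] tends to
    [2 pi] times the real part of [h1 0] as [s] tends to [0]. *)
Lemma cauchy_re : (forall z, nc z = 1 -> nc (h z) <= 1) -> complex.Re (h1 0 : R[i]) <= 1.
Proof.
move=> hb.
have muI : mu I = (pi *+ 2)%:E by rewrite lebesgue_measure_itv /= lte_fin pi2 oppr0 adde0.
have Ic (c : R) : \int[mu]_(t in I) (fun=> c) t = c * (pi *+ 2).
  rewrite Rintegral_cst; last exact: measurable_itv.
  by rewrite -[pi *+ 2 in RHS]/(fine (pi *+ 2)%:E); congr (_ * fine _); exact: muI.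
have Jd : is_derive (0 : R) (1 : R) J (complex.Re (h1 0 : R[i]) * (pi *+ 2)).
  have := J_derive (s := 0); rewrite normr0 ler01 => /(_ isT); congr is_derive.
  rewrite -Ic; by apply: eq_Rintegral => t _; rewrite /v mul0r.
have J1 : J 1 <= pi *+ 2.
  rewrite -[leRHS]mul1r -Ic; apply: le_Rintegral.
  - exact: measurable_itv.
  - by apply/int_cont/cu; rewrite normr1.
  - by apply: int_cont => t; exact: cvg_cst.
  move=> t _; rewrite (le_trans (ler_norm _))// (le_trans (nc_Re _))//.
  by rewrite /g ncM nc_conj nc_cis mulr1 hb// nc_polar normr1.
have J1E : J 1 = complex.Re (h1 0 : R[i]) * (pi *+ 2).
  have [k [ck kE Hk]] := is_derive_carath Jd.
  rewrite -kE; apply/eqP; rewrite -subr_eq0 -normr_le0; apply/ler_addgt0Pr => e e0.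
  rewrite add0r.
  move/cvgrPdist_le : ck => /(_ e e0)/nbhs_ballP[r /= r0 H].
  pose s := Num.min (r / 2) 1.
  have s0 : 0 < s by rewrite lt_min ltr01 andbT divr_gt0.
  have s1 : s <= 1 by rewrite ge_min lexx orbT.
  have sr : s < r by rewrite (@le_lt_trans _ _ (r / 2))// ?ge_min ?lexx//; lra.
  have := H s; rewrite /ball /= sub0r normrN gtr0_norm// => /(_ sr).
  have := Hk s; rewrite J0 !subr0 Jlin ?s0// mulrC => /mulIf -> //.
    by rewrite distrC.
  by rewrite gt_eqF.
move: J1; rewrite J1E -{2}[pi *+ 2]mul1r ler_pM2r//.
Qed.

End Cauchy.

(** Cauchy's estimate: the integral means give it for the real part, and a
    rotation makes the derivative at the centre a non-negative real. *)
Lemma cauchy_estimate (R : realType) (h h1 : CC R -> CC R) (rho : R) : 1 < rho ->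
  (forall z, nc z < rho -> cdiff h z (h1 z)) ->
  (forall z, nc z < rho -> {for z, continuous h1}) ->
  (forall z, nc z = 1 -> nc (h z) <= 1) -> nc (h1 0) <= 1.
Proof.
move=> rho1 hd hc hb; have [->|h0] := eqVneq (h1 0) 0; first by rewrite nc0.
(* The rotation for which [c * h1 0] is the modulus of [h1 0]. *)
pose c : CC R := conjc (h1 0 : R[i]) / (nc (h1 0))%:C.
have n0 : nc (h1 0) != 0 by rewrite nc_eq0.
have nn : nc ((nc (h1 0))%:C : R[i]) = nc (h1 0) by rewrite nc_real ger0_norm ?nc_ge0.
have nc1' : nc c = 1 by rewrite ncM ncV nc_conj nn divff.
have := @cauchy_re R (fun z => c * h z) (fun z => c * h1 z) rho rho1.
have -> : c * h1 0 = (nc (h1 0))%:C.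
  rewrite /c mulrAC [X in X / _]mulrC -sqr_normc expr2 normE mulfK//.
  by apply: contra_neq n0 => -[].
apply.
- move=> z zr; have := cdiffM (cdiffK c z) (hd z zr).
  by rewrite mul0r add0r.
- by move=> z zr; apply: contM; [exact: contK|exact: hc].
- by move=> z /hb; rewrite ncM nc1' mul1r.
Qed.

(** * The complex exponential *)

Section Exp.
Variable R : realType.
Local Notation C := (CC R).
Implicit Types (z w s h : C).

Lemma cexpD z w : cexp (z + w) = cexp z * cexp w :> C.
Proof.
case: z w => [x y] [x' y']; rewrite /cexp /= /cis expRD sinD cosD.
by apply/eqP; rewrite eq_complex /=; apply/andP; split; apply/eqP; ring.
Qed.

Lemma cexp0 : cexp (0 : C) = 1 :> C.
Proof.
rewrite /cexp /= expR0 mul1r /cis cos0 sin0.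
by apply/eqP; rewrite eq_complex /= !eqxx.
Qed.

Lemma nc_cexp z : nc (cexp z) = expR (complex.Re (z : R[i])).
Proof. by rewrite /cexp ncM nc_cis mulr1 nc_real ger0_norm ?expR_ge0. Qed.

Lemma cexp_neq0 z : cexp z != 0 :> C.
Proof. by rewrite -nc_gt0 nc_cexp expR_gt0. Qed.

Lemma cexpN z : cexp (- z) = (cexp z)^-1 :> C.
Proof. by apply: (mulfI (cexp_neq0 z)); rewrite -cexpD subrr cexp0 mulfV// cexp_neq0. Qed.

Lemma cexp_imag (t : R) : cexp (0 +i* t : C) = cis t :> C.
Proof. by rewrite /cexp /= expR0 mul1r. Qed.

Lemma cexp_o (e : R) : 0 < e -> exists2 r : R, 0 < r &
  forall h, nc h < r -> nc (cexp h - 1 - h) <= e * nc h.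
Proof.
move=> e0; pose d := Num.min (e / 3) 1.
have d0 : 0 < d by rewrite lt_min ltr01 andbT divr_gt0.
have d1 : d <= 1 by rewrite ge_min lexx orbT.
have de : 3 * d <= e.
  by rewrite mulrC -ler_pdivlMr//; rewrite /d ge_min lexx.
have [k [ck k0 Hk]] := is_derive_carath (is_derive_expR (0 : R)).
have [q [cq q0 Hq]] := rdiff_cis (0 : R).
rewrite expR0 in k0 Hk.
have c0 : cis 0 = 1 :> C by rewrite -(cexp_imag 0) cexp0.
rewrite c0 mulr1 in q0; rewrite c0 in Hq.
move/cvgrPdist_le : ck => /(_ d d0)/nbhs_ballP[r1 /= r10 H1].
have /nbhs_ballP[r2 /= r20 H2] := (@cvg_ncP _ _ _ (nbhs_filter (0 : R)) q (q 0)).1 cq d d0.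
move/nbhs_ballP : Hq => [r3 /= r30 H3].
pose r := Num.min r1 (Num.min r2 (Num.min r3 (d / 2))).
have [lr1 lr2 lr3 lr4] : [/\ r <= r1, r <= r2, r <= r3 & r <= d / 2].
  by rewrite /r !ge_min !lexx !orbT.
exists r; first by rewrite !lt_min r10 r20 r30 divr_gt0.
move=> [x y] hr; set h : C := x +i* y.
have xh : `|x| <= nc h := nc_Re h.
have yh : `|y| <= nc h := nc_Im h.
have B1 : ball (0 : R) r1 x.
  by rewrite /ball /= sub0r normrN (lt_le_trans (le_lt_trans xh hr) lr1).
have B2 : ball (0 : R) r2 y.
  by rewrite /ball /= sub0r normrN (lt_le_trans (le_lt_trans yh hr) lr2).
have B3 : ball (0 : R) r3 y.
  by rewrite /ball /= sub0r normrN (lt_le_trans (le_lt_trans yh hr) lr3).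
have Hx : `|expR x - 1 - x| <= d * `|x|.
  have := Hk x; rewrite subr0 => ->.
  have := H1 x B1; rewrite k0 => Hd; rewrite -[X in _ - X]mul1r -mulrBl normrM distrC.
  by rewrite ler_wpM2r.
have Hy : nc (cis y - 1 - ('i)%C * y%:C : C) <= d * `|y|.
  have Ey : cis y - 1 = q y * y%:C :> C by have := H3 y B3; rewrite subr0.
  have -> : cis y - 1 - ('i)%C * y%:C = (q y - ('i)%C) * y%:C :> C by rewrite mulrBl Ey.
  by have := H2 y B2; rewrite q0 => Hd; rewrite ncM nc_real ler_wpM2r// ltW.
have ni : nc (('i)%C : C) = 1 by rewrite nc_imag normr1.
have Hy1 : nc (cis y - 1 : C) <= d.
  have := ncD (cis y - 1 - ('i)%C * y%:C : C) (('i)%C * y%:C); rewrite subrK => H.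
  rewrite (le_trans H)// ncM ni mul1r nc_real.
  have yd : `|y| <= d / 2 by rewrite (le_trans yh)// (le_trans (ltW hr)).
  rewrite [leRHS]splitr lerD// (le_trans Hy)// (le_trans _ yd)//.
  by rewrite ler_piMl.
have -> : cexp h - 1 - h = (expR x - 1 - x)%:C * cis y + x%:C * (cis y - 1)
   + (cis y - 1 - ('i)%C * y%:C) :> C.
  have -> : h = x%:C + ('i)%C * y%:C :> C.
    by apply/eqP; rewrite eq_complex /=; apply/andP; split; apply/eqP; ring.
  have -> : cexp (x%:C + ('i)%C * y%:C : C) = (expR x)%:C * cis y :> C.
    by congr ((expR _)%:C * cis _) => /=; ring.
  by rewrite !rmorphB rmorph1; ring.
rewrite (le_trans (ncD _ _))// (@le_trans _ _ (d * `|x| + d * `|x| + d * `|y|))//.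
  rewrite lerD// (le_trans (ncD _ _))// lerD// ncM ?nc_cis nc_real ?mulr1//.
  by rewrite mulrC ler_wpM2r.
rewrite (@le_trans _ _ (3 * d * nc h))//; last by rewrite ler_wpM2r// nc_ge0.
have := ler_wpM2l (ltW d0) xh; have := ler_wpM2l (ltW d0) yh; lra.
Qed.

Lemma cdiff_cexp z : cdiff (@cexp R) z (cexp z).
Proof.
pose q w : C := if w == z then cexp z else (cexp w - cexp z) / (w - z).
exists q; split; last 2 first.
- by rewrite /q eqxx.
- near=> w; rewrite /q; case: eqVneq => [->|wz]; first by rewrite !subrr mulr0.
  by rewrite divfK// subr_eq0.
apply/cont_ncP => e e0; rewrite /q eqxx.
have z0 : 0 < nc (cexp z) by rewrite nc_cexp expR_gt0.
have [r r0 Hr] := cexp_o (divr_gt0 e0 (mulr_gt0 (ltr0n R 2) z0)).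
exists r => // w wr; case: eqVneq => [_|wz]; first by rewrite subrr nc0.
have wz0 : w - z != 0 by rewrite subr_eq0.
have -> : (cexp w - cexp z) / (w - z) - cexp z =
   cexp z * ((cexp (w - z) - 1 - (w - z)) / (w - z)) :> C.
  have -> : cexp w = cexp z * cexp (w - z) :> C by rewrite -cexpD addrC subrK.
  by field.
have wz1 : 0 < nc (w - z) by rewrite nc_gt0.
rewrite ncM [X in _ * X]ncM ncV; apply: (@le_lt_trans _ _ (nc (cexp z) * (e / (2 * nc (cexp z))))).
  by rewrite ler_wpM2l ?nc_ge0// ler_pdivrMr// Hr.
rewrite (_ : _ * _ = e / 2); last by field; rewrite gt_eqF.
lra.
Unshelve. all: by end_near. Qed.

Lemma cont_cexp z : {for z, continuous (@cexp R : C -> C)}.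
Proof. exact: cdiff_cont (cdiff_cexp z). Qed.

Lemma cont_cexp_comp (T : topologicalType) (g : T -> C) x :
  {for x, continuous g} -> {for x, continuous (fun y => cexp (g y) : C)}.
Proof.
by move=> cg; exact: (@continuous_comp T C C g (@cexp R : C -> C) x cg (@cont_cexp (g x))).
Qed.

(** Factoring out [cexp k] reduces this to [cexp_o] at [h - k]. *)
Lemma cexp_approx (e : R) : 0 < e -> exists2 r : R, 0 < r &
  forall h k, nc h <= r -> nc k <= r -> nc (cexp h - cexp k - (h - k)) <= e * nc (h - k).
Proof.
move=> e0; have [d [d0 d1 de]] : exists d : R, [/\ 0 < d, d <= 1 & 6 * d <= e].
  exists (Num.min (e / 6) 1); rewrite lt_min ltr01 andbT divr_gt0// ge_min lexx orbT.
  by split=> //; rewrite mulrC -ler_pdivlMr// ge_min lexx.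
have [r r0 Hr] := cexp_o d0.
exists (Num.min (r / 3) d); first by rewrite lt_min d0 divr_gt0.
move=> h k; rewrite !le_min => /andP[hr hd] /andP[kr kd].
have hk : nc (h - k) < r.
  rewrite (le_lt_trans (ncD _ _))// ncN; lra.
have kr' : nc k < r by lra.
have -> : cexp h - cexp k - (h - k) = (cexp k - 1) * (cexp (h - k) - 1) +
   (cexp (h - k) - 1 - (h - k)) :> C.
  have -> : cexp h = cexp k * cexp (h - k) :> C by rewrite -cexpD addrC subrK.
  ring.
have H1 x : nc x < r -> nc (cexp x - 1) <= 2 * nc x.
  move=> xr; have := ncD (cexp x - 1 - x) x; rewrite subrK => H.
  have := Hr x xr; have := ler_wpM2r (nc_ge0 x) d1; rewrite mul1r; lra.
have h0 := nc_ge0 (h - k).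
rewrite (le_trans (ncD _ _))// ncM.
have A := Hr _ hk; have B := H1 _ hk; have D := H1 _ kr'.
have E : nc (cexp k - 1) * nc (cexp (h - k) - 1) <= (2 * d) * (2 * nc (h - k)).
  apply: ler_pM; [exact: nc_ge0|exact: nc_ge0| |exact: B].
  by rewrite (le_trans D)// ler_wpM2l.
have := ler_wpM2r h0 de; have := mulr_ge0 (ltW d0) h0; lra.
Qed.

(** * A quantitative inverse function theorem *)

(** A relative error of one half makes [F] injective on the disc, and makes every
    Newton step halve the distance to the target. *)
Definition near_linear (F : C -> C) (A s : C) (r : R) := forall x y,
  nc (x - s) <= r -> nc (y - s) <= r ->
  nc (F x - F y - A * (x - y)) <= nc A / 2 * nc (x - y).

Lemma near_linear_lower F A s r x y : near_linear F A s r ->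
  nc (x - s) <= r -> nc (y - s) <= r -> nc A / 2 * nc (x - y) <= nc (F x - F y).
Proof.
move=> H xr yr; have := H _ _ xr yr.
have := ncBl (A * (x - y)) (A * (x - y) - (F x - F y)).
rewrite subKr ncM [X in _ - X <= _ -> _]ncB => H1 H2.
have := nc_ge0 A; lra.
Qed.

(** The distance from [F x] to the target is minimal somewhere on the disc, and
    a Newton step decreases it unless it vanishes. *)
Lemma near_linear_onto F A s r z : near_linear F A s r -> A != 0 -> 0 < r ->
  {in [set x | nc (x - s) <= r], forall x, {for x, continuous F}} ->
  nc (z - F s) < nc A * r / 4 -> exists2 x, nc (x - s) < r & F x = z.
Proof.
move=> H A0 r0 cF zs.
have sr : nc (s - s) <= r by rewrite subrr (_ : nc _ = 0) ?ltW//; exact: nc0.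
have A1 : 0 < nc A by rewrite nc_gt0.
have [||x xr Hx] := @compact_EVT_min _ _ (fun x => nc (F x - z)) [set x : C | nc (x - s) <= r] _ (@compact_cball _ s r).
- by exists s.
- apply: continuous_in_subspaceT => x xr.
  have c1 := contB (cF x xr) (@contK R C z x).
  exact: (cont_nc c1).
rewrite inE /= in xr.
have xs : nc (F x - z) <= nc (z - F s) by rewrite (ncB z); apply: Hx; rewrite inE.
(* On the boundary of the disc [F] is too far from [F s] to be closest to [z]. *)
have xr' : nc (x - s) < r.
  rewrite lt_neqAle xr andbT; apply/negP => /eqP xE.
  have := near_linear_lower H xr sr; rewrite xE => L.
  have := ncBl (F x - F s) (z - F s); rewrite opprB addrA subrK => L2.
  have := nc_ge0 A; nra.
exists x => //; apply/eqP; rewrite -subr_eq0 -nc_eq0; apply/eqP.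
apply/eqP; rewrite eq_le nc_ge0 andbT leNgt; apply/negP => p0.
(* The Newton step [v], shortened by [t] to stay in the disc. *)
pose v : C := (z - F x) / A.
have v0 : 0 < nc v by rewrite ncM ncV divr_gt0// ncB.
pose t : R := Num.min 1 ((r - nc (x - s)) / nc v).
have t0 : 0 < t by rewrite lt_min ltr01 divr_gt0// subr_gt0.
have t1 : t <= 1 by rewrite ge_min lexx.
have ntv : nc (t%:C * v) = t * nc v by rewrite ncM nc_real gtr0_norm.
have yr : nc (x + t%:C * v - s) <= r.
  rewrite addrAC (le_trans (ncD _ _))// -lerBrDl ntv -ler_pdivlMr//.
  by rewrite /t ge_min lexx orbT.
have : nc (F x - z) <= nc (F (x + t%:C * v) - z) by apply: Hx; rewrite inE.
rewrite leNgt => /negP; apply.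
have e1 : x + t%:C * v - x = t%:C * v by rewrite addrAC subrr add0r.
have := H _ _ yr xr; rewrite e1 ntv => HN.
have Av : A * v = z - F x by rewrite /v mulrC divfK.
have E : F (x + t%:C * v) - z =
  (F (x + t%:C * v) - F x - A * (t%:C * v)) + (1 - t)%:C * (F x - z).
  by rewrite (mulrCA A) Av rmorphB rmorph1; ring.
rewrite E (le_lt_trans (ncD _ _))// ncM nc_real ger0_norm ?subr_ge0//.
have nv : nc A * nc v = nc (F x - z) by rewrite -ncM Av ncB.
have : nc A / 2 * (t * nc v) = t * nc (F x - z) / 2 by rewrite -nv; field.
move: HN => /[swap] ->; have : 0 < t * nc (F x - z) by rewrite mulr_gt0.
lra.
Qed.

(** The radius does not depend on [s], because [cexp] turns translations into
    multiplications. *)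
Lemma cexp_near_linear : exists2 r : R, 0 < r & forall s, near_linear (@cexp R) (cexp s) s r.
Proof.
have h0 : 0 < 1 / 2 :> R by lra.
have [r r0 Hr] := cexp_approx h0.
exists r => // s x y xr yr.
have E w : cexp w = cexp s * cexp (w - s) :> C by rewrite -cexpD addrC subrK.
rewrite (E x) (E y) -!mulrBr (ncM (cexp s)).
have := Hr _ _ xr yr; have -> : x - s - (y - s) = x - y by ring.
by move=> /(ler_wpM2l (nc_ge0 (cexp s))); rewrite mulrA mul1r.
Qed.

End Exp.

(** * The map in the logarithmic coordinate *)

Section Logarithmic.
Variable R : realType.
Local Notation C := (CC R).
Variables a b : R.
Hypothesis hb : 0 <= b <= 1.
Implicit Types (z w s : C).
Local Notation f := (dsm a b).

(** The map in the coordinate [s] with [z = cexp s]; the circle becomes the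
    imaginary axis. *)
Definition Lm s : C := (0 +i* (2 * pi * a)) + (s + s) + b%:C * (cexp s - cexp (- s)).

(** The logarithmic derivative [z f'(z) / f(z)]. *)
Definition ell z : C := 2 + b%:C * (z + z^-1).
Definition Lp s : C := ell (cexp s).

Lemma cexp_Lm s : cexp (Lm s) = f (cexp s).
Proof.
rewrite /Lm (cexpD (_ + (s + s))) (cexpD (0 +i* _)) (cexpD s) cexp_imag /dsm expr2.
by rewrite -[_ / cexp s]mulrC -cexpN (mulrC (cexp (- s))) mulrBr.
Qed.

Lemma dsm_iter s n : iter n f (cexp s) = cexp (iter n Lm s).
Proof. by elim: n => //= n ->; rewrite cexp_Lm. Qed.

Lemma cdiff_Lm s : cdiff Lm s (Lp s).
Proof.
have dN := cdiff_comp (cdiffN (cdiffI s)) (cdiff_cexp (- s)).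
have := cdiffM (cdiffK (b%:C : C) s) (cdiffB (cdiff_cexp s) dN).
have dK := cdiffK ((0 +i* (2 * pi * a)) : C) s.
move=> /(cdiffD (cdiffD dK (cdiffD (cdiffI s) (cdiffI s)))).
congr cdiff; rewrite /Lp /ell cexpN; ring.
Qed.

Lemma cont_Lm s : {for s, continuous (Lm : C -> C)}.
Proof. exact: cdiff_cont (cdiff_Lm s). Qed.

Lemma cdiff_dsm z : z != 0 -> cdiff f z (f z * ell z / z).
Proof.
move=> z0.
have db := cdiffK (b%:C : C) z.
have dV : cdiff (fun w : C => w^-1 : C) z (- 1 / z ^+ 2) := cdiffV (cdiffI z) z0.
have dE := cdiff_comp (cdiffB (cdiffM db (cdiffI z)) (cdiffM db dV)) (cdiff_cexp _).
have dz2 := cdiffM (cdiffK (cis (2 * pi * a) : C) z) (cdiffM (cdiffI z) (cdiffI z)).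
have := cdiffM dz2 dE; congr cdiff.
by rewrite /dsm /ell expr2; field.
Qed.

Lemma cont_dsm z : z != 0 -> {for z, continuous (f : C -> C)}.
Proof. by move=> z0; exact: cdiff_cont (cdiff_dsm z0). Qed.

(** * Uniform local inverses away from the critical points *)

(** Of two numbers with product [1], the smaller has modulus at most [1], so nothing
    but a bounded amount cancels in [cexp s + cexp (- s)]. *)
Lemma nc_cexp_sum s : b * (nc (cexp s) + nc (cexp (- s))) <= nc (Lp s) + 4.
Proof.
have /andP[b0 b1] := hb.
have E : nc (cexp s) * nc (cexp (- s)) = 1 by rewrite -ncM cexpN mulfV ?cexp_neq0 ?nc1.
have H : b * nc (cexp s + cexp (- s)) <= nc (Lp s) + 2.
  have := ncD (Lp s) (- 2 : C); rewrite ncN nc_nat.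
  have -> : Lp s - 2 = b%:C * (cexp s + cexp (- s)) :> C by rewrite /Lp /ell cexpN; ring.
  by rewrite ncM nc_real ger0_norm.
have := ncDl (cexp s) (cexp (- s)); have := ncDl (cexp (- s)) (cexp s).
rewrite (addrC (cexp (- s))) => H1 H2.
have p0 := nc_ge0 (cexp s); have q0 := nc_ge0 (cexp (- s)).
have : nc (cexp s) + nc (cexp (- s)) <= nc (cexp s + cexp (- s)) + 2.
  by case: (lerP (nc (cexp s)) 1) => h; [lra|nra].
move=> /(ler_wpM2l b0); lra.
Qed.

(** The second derivative of [Lm] is controlled by [Lp] itself ([nc_cexp_sum]), so
    the radius depends only on the lower bound [m]. *)
Lemma Lm_near_linear (m : R) : 0 < m -> exists2 r : R, 0 < r &
  forall s, m <= nc (Lp s) -> near_linear Lm (Lp s) s r.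
Proof.
move=> m0; have /andP[b0 b1] := hb.
have e0 : 0 < m / (2 * (m + 4)) by rewrite divr_gt0// mulr_gt0// addr_gt0.
have [r r0 Hr] := cexp_approx e0.
exists r => // s ms x y xr yr.
have E w : cexp w = cexp s * cexp (w - s) :> C by rewrite -cexpD addrC subrK.
have EN w : cexp (- w) = cexp (- s) * cexp (- (w - s)) :> C.
  by rewrite -cexpD; congr cexp; ring.
have -> : Lm x - Lm y - Lp s * (x - y) =
  b%:C * (cexp s * (cexp (x - s) - cexp (y - s) - (x - s - (y - s))) -
  cexp (- s) * (cexp (- (x - s)) - cexp (- (y - s)) - (- (x - s) - - (y - s)))) :> C.
  by rewrite /Lm /Lp /ell (E x) (E y) (EN x) (EN y) -cexpN; ring.
have H1 := Hr _ _ xr yr.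
have H2 := Hr (- (x - s)) (- (y - s)); rewrite !ncN in H2; have {}H2 := H2 xr yr.
have n1 : x - s - (y - s) = x - y by ring.
have n2 : - (x - s) - - (y - s) = - (x - y) by ring.
rewrite [in X in _ <= X]n2 ncN in H2; rewrite [in X in _ <= X]n1 in H1; rewrite ncM nc_real ger0_norm//.
apply: (@le_trans _ _ (b * (nc (cexp s) + nc (cexp (- s))) * (m / (2 * (m + 4)) * nc (x - y)))).
  rewrite -mulrA ler_wpM2l// (le_trans (ncD _ _))// ncN mulrDl.
  by apply: lerD; rewrite (ncM (cexp _)); apply: ler_wpM2l => //; exact: nc_ge0.
rewrite mulrA ler_wpM2r ?nc_ge0//.
apply: (@le_trans _ _ ((nc (Lp s) + 4) * (m / (2 * (m + 4))))).
  by rewrite ler_wpM2r ?nc_cexp_sum// ltW.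
have m4 : 0 < m + 4 by rewrite addr_gt0.
rewrite mulrA ler_pdivrMr ?mulr_gt0//.
have -> : nc (Lp s) / 2 * (2 * (m + 4)) = nc (Lp s) * (m + 4) by field.
by rewrite mulrDl mulrDr (mulrC 4) lerD2l ler_pM2r.
Qed.

(** Where [z] or its inverse is large, so is their sum, and [ell] is not small; for
    [b = 0] it is constant. *)
Lemma ell_annulus : exists2 M : R, 0 < M & forall z, z != 0 ->
  1 <= nc (ell z) \/ (nc z <= M /\ nc z^-1 <= M).
Proof.
have /andP[b0 b1] := hb.
move: b0; rewrite le_eqVlt => /predU1P[b0|b0].
  exists 1 => // z z0; left; rewrite /ell -b0 rmorph0 mul0r addr0 nc_nat.
  by rewrite ler1n.
exists (3 / b + 1); first by rewrite addr_gt0// divr_gt0.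
move=> z z0; case: (leP 1 (nc (ell z))) => [|H]; first by left.
right.
have bz : b * nc (z + z^-1) <= 3.
  have := ncD (ell z) (- 2 : C); rewrite ncN nc_nat.
  have -> : ell z - 2 = b%:C * (z + z^-1) :> C by rewrite /ell; ring.
  by rewrite ncM nc_real gtr0_norm//; lra.
have bz' : nc (z + z^-1) <= 3 / b by rewrite ler_pdivlMr// mulrC.
have E : nc z * nc z^-1 = 1 by rewrite -ncM mulfV ?nc1.
have := ncDl z z^-1; have := ncDl z^-1 z; rewrite (addrC z^-1) => H1 H2.
have p0 := nc_ge0 z; have q0 := nc_ge0 z^-1.
by split; case: (lerP (nc z) 1) => h; nra.
Qed.

(** If the values of [psi] on the closed disc avoid the critical values, then
    [Lp] is bounded below on their preimages; the preimages are infinitely many,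
    but [ell] is large outside a compact annulus. *)
Lemma Lp_lower (psi : C -> C) (r : R) : 0 <= r ->
  (forall x, nc x <= r -> {for x, continuous psi}) ->
  (forall x z, nc x <= r -> z != 0 -> ell z = 0 -> f z != psi x) ->
  exists2 m : R, 0 < m & forall x s, nc x <= r -> cexp (Lm s) = psi x -> m <= nc (Lp s).
Proof.
move=> r0 cpsi H; have [M M0 HM] := ell_annulus.
pose A : set C := [set z | nc (z - 0) <= M] `&` [set z | M^-1 <= nc z].
have cA : compact A.
  apply: (subclosed_compact _ (@compact_cball R 0 M)); last by move=> z [].
  apply: closedI; first by apply: compact_closed; [exact: norm_hausdorff|exact: compact_cball].
  apply: (@closed_comp _ _ (@nc R) [set x | M^-1 <= x]); last exact: closed_ge.
  by move=> z _; apply: cont_nc; exact: contI.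
have cB : compact (A `*` [set x : C | nc (x - 0) <= r]).
  by apply: compact_setX => //; exact: compact_cball.
have A0 z : A z -> z != 0.
  move=> [_ /= zM]; rewrite -nc_gt0; apply: lt_le_trans zM; by rewrite invr_gt0.
pose g (p : C * C) : R := nc (ell p.1) + nc (f p.1 - psi p.2).
have cg : {within A `*` [set x : C | nc (x - 0) <= r], continuous g}.
  apply: continuous_in_subspaceT => p; rewrite inE => -[/= Ap]; rewrite subr0 => pr.
  have c1 : {for p, continuous (fun p : C * C => p.1)} by exact: cvg_fst.
  have c2 : {for p, continuous (fun p : C * C => p.2)} by exact: cvg_snd.
  have c3 : {for p, continuous (fun p : C * C => ell p.1)}.
    apply: contD; first exact: contK.
    apply: contM; first exact: contK.
    by apply: contD; [exact: c1|exact: (contV c1 (A0 _ Ap))].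
  have c4 := continuous_comp c1 (cont_dsm (A0 _ Ap)).
  have c5 := continuous_comp c2 (cpsi _ pr).
  exact: (rcontD (cont_nc c3) (cont_nc (contB c4 c5))).
set B := A `*` _ in cB cg *.
have gm : exists2 m : R, 0 < m & forall p, B p -> m <= g p.
  have [B0|B0] := pselect (B !=set0); last by exists 1 => // p Bp; case: B0; exists p.
  have [p Bp Hp] := compact_EVT_min B0 cB cg.
  rewrite inE in Bp; case: (Bp) => /= Ap; rewrite subr0 => pr.
  exists (g p) => [|q Bq]; last by apply: Hp; rewrite inE.
  rewrite /g lt_neqAle addr_ge0 ?nc_ge0// andbT eq_sym paddr_eq0 ?nc_ge0// !nc_eq0 subr_eq0.
  by apply/andP => -[/eqP e0]; apply/negP/H => //; exact: A0.
have [m m0 Hm] := gm.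
exists (Num.min m 1); first by rewrite lt_min m0 ltr01.
move=> x s xr E; rewrite ge_min; have [->|[zM zM']] := HM _ (cexp_neq0 s); first exact: orbT.
have Bp : B (cexp s, x).
  split; last by rewrite /= subr0.
  split; first by rewrite /= subr0.
  by rewrite /= -[leRHS]invrK -ncV lef_pV2 ?posrE// nc_gt0 invr_eq0 cexp_neq0.
have := Hm _ Bp; rewrite /g /= -cexp_Lm E subrr [X in _ + X](_ : _ = 0) ?addr0 => [->//|].
exact: nc0.
Qed.

End Logarithmic.

(** * Mean value inequalities and holomorphic discs *)

Section Lipschitz.
Variable R : realType.
Local Notation C := (CC R).

Lemma derive_lip (g g1 : R -> R) (M t1 t2 : R) : t1 <= t2 ->
  (forall t, t1 <= t <= t2 -> is_derive t 1 g (g1 t)) ->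
  (forall t, t1 <= t <= t2 -> `|g1 t| <= M) -> `|g t2 - g t1| <= M * (t2 - t1).
Proof.
rewrite le_eqVlt => /predU1P[->|t12] dg gM; first by rewrite !subrr normr0 mulr0.
have dg' t : t \in `]t1, t2[ -> is_derive t 1 g (g1 t).
  by rewrite in_itv /= => /andP[t1t tt2]; apply: dg; rewrite !ltW.
have cg : {within `[t1, t2], continuous g}.
  apply: derivable_within_continuous => t; rewrite in_itv /= => H.
  by have [] := dg t H.
have [t + ->] := MVT t12 dg' cg; rewrite in_itv /= => /andP[t1t tt2].
by rewrite normrM [`|t2 - t1|]gtr0_norm ?subr_gt0// ler_pM2r ?subr_gt0// gM// !ltW.
Qed.

(** The factor [2] comes from treating the two coordinates separately. *)
Lemma rdiff_lip (g g1 : R -> C) (M t1 t2 : R) : t1 <= t2 ->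
  (forall t, t1 <= t <= t2 -> rdiff g t (g1 t)) ->
  (forall t, t1 <= t <= t2 -> nc (g1 t) <= M) -> nc (g t2 - g t1) <= 2 * M * (t2 - t1).
Proof.
move=> t12 dg gM; rewrite (le_trans (nc_le _))// !raddfB /=.
rewrite -mulrA mulr_natl mulr2n; apply: lerD.
- apply: (@derive_lip (fun t => complex.Re (g t : R[i])) (fun t => complex.Re (g1 t : R[i]))) => //.
  + by move=> t /dg /rdiff_is_derive[].
  + by move=> t tI; rewrite (le_trans (nc_Re _))// gM.
- apply: (@derive_lip (fun t => complex.Im (g t : R[i])) (fun t => complex.Im (g1 t : R[i]))) => //.
  + by move=> t /dg /rdiff_is_derive[].
  + by move=> t tI; rewrite (le_trans (nc_Im _))// gM.
Qed.

(** Complex differentiability with a continuous derivative on the disc of radius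
    [rho]; the derivative is carried along explicitly. *)
Definition holo (rho : R) (f f1 : C -> C) := forall x, nc x < rho ->
  cdiff f x (f1 x) /\ {for x, continuous f1}.

Lemma holo_radial_lip rho f f1 r : holo rho f f1 -> 0 <= r -> r < rho ->
  exists K : R, forall x t1 t2, nc x <= r -> 0 <= t1 -> t1 <= t2 -> t2 <= 1 ->
    nc (f (t2%:C * x) - f (t1%:C * x)) <= K * (t2 - t1).
Proof.
move=> hf r0 rr.
have [||z _ H] := @compact_EVT_max _ _ (fun x => nc (f1 x)) [set z : C | nc (z - 0) <= r] _ (@compact_cball _ 0 r).
- by exists 0; rewrite /= [X in X <= _](_ : _ = 0)// subrr; exact: nc0.
- apply: continuous_in_subspaceT => z; rewrite inE /= subr0 => zr.
  exact: (cont_nc (hf z (le_lt_trans zr rr)).2).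
exists (2 * (nc (f1 z) * r)) => x t1 t2 xr t10 t12 t21.
have tx t : t1 <= t <= t2 -> nc (t%:C * x) <= r.
  move=> /andP[h1 h2]; rewrite ncM nc_real ger0_norm ?(le_trans t10)//.
  by rewrite (le_trans _ xr)// ler_piMl ?nc_ge0// (le_trans h2).
apply: (@rdiff_lip (fun t => f (t%:C * x)) (fun t => f1 (t%:C * x) * x)) => // t tI.
- have dx : rdiff (fun t : R => t%:C * x : C) t x.
    by have := rdiffM (rdiff_real t) (rdiffK x t); rewrite mul1r mulr0 addr0.
  exact: (rdiff_comp dx (hf _ (le_lt_trans (tx _ tI) rr)).1).
- rewrite ncM ler_pM ?nc_ge0//; apply: H; rewrite inE /= subr0; exact: tx.
Qed.

End Lipschitz.

(** * Lifting discs *)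

Section Lifting.
Variable R : realType.
Local Notation C := (CC R).
Variables a b : R.
Hypothesis hb : 0 <= b <= 1.
Local Notation f := (dsm a b).
Local Notation L := (Lm a b).
Local Notation L1 := (Lp b).

(** Reflection in the imaginary axis, that is, in the unit circle for [z = cexp s];
    it is what makes the discs around circle points symmetric. *)
Definition sigma (s : C) : C := - (conjc (s : R[i])).

Lemma nc_sigma s : nc (sigma s) = nc s. Proof. by rewrite ncN nc_conj. Qed.
Lemma sigmaB s t : sigma (s - t) = sigma s - sigma t.
Proof. by rewrite /sigma rmorphB opprB addrC opprK. Qed.

Lemma sigma_real (t : R) s : sigma (t%:C * s) = t%:C * sigma s.
Proof.
case: s => x y; rewrite /sigma.
by apply/eqP; rewrite eq_complex /=; apply/andP; split; apply/eqP; ring.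
Qed.

Lemma cexp_conj (s : C) : cexp (conjc (s : R[i])) = conjc (cexp s : R[i]) :> C.
Proof.
case: s => x y; rewrite /cexp /= /cis cosN sinN.
by apply/eqP; rewrite eq_complex /=; apply/andP; split; apply/eqP; ring.
Qed.

Lemma Lm_sigma s : L (sigma s) = sigma (L s).
Proof.
rewrite /Lm /sigma opprK cexp_conj -(rmorphN (@conjc R)) cexp_conj.
case: (cexp s) => x y; case: (cexp (- s)) => u v; case: s => p q.
by apply/eqP; rewrite eq_complex /=; apply/andP; split; apply/eqP; ring.
Qed.

Variables (phi : C -> C) (r rho : R) (w : C).
Hypotheses (r0 : 0 < r) (rrho : r < rho) (phiw : L w = phi 0).

(** A disc avoiding the critical values lifts through [Lm]: the lift is built in
    [N] radial steps, each of which is one application of the local inverse;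
    hence it is continuous without any gluing. *)
Lemma lift_exists (phi1 : C -> C) : holo rho phi phi1 ->
  (forall x z, nc x < rho -> z != 0 -> ell b z = 0 -> f z != cexp (phi x)) ->
  exists psi : C -> C, [/\ psi 0 = w,
    forall x, nc x < r -> L (psi x) = phi x,
    forall x, nc x < r -> {for x, continuous psi} &
    (forall x, nc x < rho -> phi (sigma x) = sigma (phi x)) -> sigma w = w ->
      forall x, nc x < r -> psi (sigma x) = sigma (psi x)].
Proof.
move=> hphi crit.
have cphi x : nc x < rho -> {for x, continuous phi}.
  by move=> /hphi[H _]; exact: (cdiff_cont H).
have lr x : nc x <= r -> nc x < rho by move=> xr; exact: le_lt_trans rrho.
have [||m m0 Hm] := @Lp_lower R a b hb (fun x => cexp (phi x)) r (ltW r0).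
- by move=> x /lr xr; exact: (cont_cexp_comp (cphi x xr)).
- by move=> x z /lr; exact: crit.
have [r1 r10 NL1] := @Lm_near_linear R a b hb m m0.
have [K HK] := holo_radial_lip hphi (ltW r0) rrho.
pose d := r1 / 2; have d0 : 0 < d by rewrite divr_gt0.
have dr1 : d <= r1 by rewrite /d; lra.
have NL s : m <= nc (L1 s) -> near_linear L (L1 s) s d.
  by move=> /NL1 H x y xd yd; apply: H; exact: le_trans dr1.
have [N HN] : exists N : nat, K / N.+1%:R < m * d / 4.
  have e0 : 0 < m * d / 4 by rewrite divr_gt0// mulr_gt0.
  exists (Num.bound `|K / (m * d / 4)|).
  rewrite ltr_pdivrMr// mulrC -ltr_pdivrMr// (le_lt_trans (ler_norm _))//.
  by rewrite (lt_le_trans (archi_boundP _))// ler_nat.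
(* [X j x] is the end of the lift of the segment from [0] to [j / (N + 1) * x]. *)
pose p j (x : C) : C := phi ((j%:R / N.+1%:R : R)%:C * x).
pose Inv (s z : C) : C := xget w [set s' | nc (s' - s) < d /\ L s' = z].
have N0 : 0 < N.+1%:R :> R by rewrite ltr0n.
have frac j : (j <= N.+1)%N -> 0 <= (j%:R / N.+1%:R : R) <= 1.
  by move=> jN; rewrite divr_ge0//= ler_pdivrMr// mul1r ler_nat.
have frac_r j x : (j <= N.+1)%N -> nc x <= r -> nc ((j%:R / N.+1%:R : R)%:C * x) <= r.
  move=> /frac/andP[h0 h1] xr; rewrite ncM nc_real ger0_norm//.
  by rewrite (le_trans _ xr)// ler_piMl ?nc_ge0.
have step j x : (j < N.+1)%N -> nc x <= r -> nc (p j.+1 x - p j x) < m * d / 4.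
  move=> jN xr; apply: le_lt_trans HN.
  have /andP[j0 _] := frac j (ltnW jN); have /andP[_ j1] := frac _ jN.
  rewrite (le_trans (HK x _ _ xr j0 _ j1))//; last first.
    by rewrite -mulrBl -natrB// subSnn mul1r.
  by rewrite ler_pM2r ?invr_gt0// ler_nat.
have InvP s z : m <= nc (L1 s) -> nc (z - L s) < m * d / 4 ->
    nc (Inv s z - s) < d /\ L (Inv s z) = z.
  move=> ms zs; have A0 : L1 s != 0 by rewrite -nc_gt0 (lt_le_trans m0).
  have [||s' s's Ls'] := near_linear_onto (z := z) (NL s ms) A0 d0.
  - by move=> y _; exact: cont_Lm.
  - by rewrite (lt_le_trans zs)// ler_pM2r// ler_pM2r.
  by apply: (@xgetPex _ w [set s' | nc (s' - s) < d /\ L s' = z]); exists s'.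
have InvU s s1 s2 : m <= nc (L1 s) -> nc (s1 - s) < d -> nc (s2 - s) < d ->
    L s1 = L s2 -> s1 = s2.
  move=> ms h1 h2 E; have := near_linear_lower (NL s ms) (ltW h1) (ltW h2).
  have A0 : 0 < nc (L1 s) by exact: lt_le_trans ms.
  rewrite E subrr [X in _ <= X](_ : _ = 0); last exact: nc0.
  rewrite pmulr_rle0 ?divr_gt0// => H.
  by apply/eqP; rewrite -subr_eq0 -nc_eq0 eq_le H nc_ge0.
pose X := fix X j (x : C) : C := if j is i.+1 then Inv (X i x) (p i.+1 x) else w.
have p0 x : p 0%N x = phi 0 by rewrite /p mul0r rmorph0 mul0r.
have low s j x : (j <= N.+1)%N -> nc x <= r -> L s = p j x -> m <= nc (L1 s).
  move=> jN xr E; apply: (Hm ((j%:R / N.+1%:R : R)%:C * x)); last by rewrite E.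
  exact: frac_r.
have XL j x : (j <= N.+1)%N -> nc x <= r -> L (X j x) = p j x.
  elim: j => [|j IH] jN xr; first by rewrite p0.
  have IHj := IH (ltnW jN) xr.
  have ms := low _ _ _ (ltnW jN) xr IHj.
  by have [] := InvP (X j x) (p j.+1 x) ms; rewrite ?IHj ?step.
have Xd j x : (j < N.+1)%N -> nc x <= r -> nc (X j.+1 x - X j x) < d.
  move=> jN xr; have E := XL j x (ltnW jN) xr.
  have ms := low _ _ _ (ltnW jN) xr E.
  by have [] := InvP (X j x) (p j.+1 x) ms; rewrite ?E ?step.
have X0 j : (j <= N.+1)%N -> X j 0 = w.
  have n0 : nc (0 : C) <= r by rewrite nc0 ltW.
  have pj i : p i 0 = phi 0 by rewrite /p mulr0.
  elim: j => // j IH jN; have E := XL j 0 (ltnW jN) n0.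
  have ms := low _ _ _ (ltnW jN) n0 E.
  apply: (InvU (X j 0)) => //; first exact: Xd.
    by rewrite -(IH (ltnW jN)) subrr (_ : nc _ = 0)//; exact: nc0.
  by rewrite XL// pj.
exists (X N.+1); split.
- exact: X0.
- by move=> x xr; rewrite XL ?(ltW xr)// /p divff ?mul1r// gt_eqF.
- suff cX j : (j <= N.+1)%N -> forall x, nc x < r -> {for x, continuous (X j)} by exact: cX.
  elim: j => [|j IH] jN x xr; first exact: contK.
  have IHx := IH (ltnW jN) x xr.
  have cpx : {for x, continuous (p j.+1)}.
    have cx : {for x, continuous (fun x : C => (j.+1%:R / N.+1%:R : R)%:C * x : C)}.
      by apply: contM; [exact: contK|exact: contI].
    apply: (continuous_comp cx); apply: cphi; apply: lr; exact: frac_r (ltW xr).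
  have E := XL j x (ltnW jN) (ltW xr).
  have ms := low _ _ _ (ltnW jN) (ltW xr) E.
  have A0 : 0 < nc (L1 (X j x)) by exact: lt_le_trans ms.
  apply/cont_ncP => e e0.
  have [e1 e10 H1] := (cont_ncP _ _).1 IHx _ d0.
  have e2 : 0 < nc (L1 (X j x)) / 2 * e by rewrite mulr_gt0// divr_gt0.
  have [e3 e30 H3] := (cont_ncP _ _).1 cpx _ e2.
  exists (Num.min (Num.min e1 e3) (r - nc x)); first by rewrite !lt_min e10 e30 subr_gt0.
  move=> y; rewrite !lt_min => /andP[/andP[ye1 ye3] yr].
  have yr' : nc y <= r.
    have := ncD (y - x) x; rewrite subrK => /le_trans; apply; lra.
  have B1 : nc (X j.+1 y - X j x) <= r1.
    have := ncD (X j.+1 y - X j y) (X j y - X j x); rewrite addrA subrK => H.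
    have := Xd j y jN yr'; have := H1 y ye1; rewrite /d in H *; lra.
  have B2 : nc (X j.+1 x - X j x) <= r1.
    by rewrite (le_trans _ dr1)// ltW// Xd// ltW.
  have := near_linear_lower (NL1 _ ms) B1 B2; rewrite !XL// ?(ltW xr)// => H.
  have := le_lt_trans H (H3 y ye3); rewrite ltr_pM2l// divr_gt0//.
- move=> sphi sw x xr; have xr' := ltW xr.
  have sx : nc (sigma x) <= r by rewrite nc_sigma.
  have sp i : (i <= N.+1)%N -> p i (sigma x) = sigma (p i x).
    move=> iN; rewrite /p -sphi; last by apply: lr; exact: frac_r.
    by rewrite sigma_real.
  suff sX j : (j <= N.+1)%N -> X j (sigma x) = sigma (X j x) by exact: sX.
  elim: j => [|j IH] jN; first by rewrite sw.
  have {}IH := IH (ltnW jN).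
  have E := XL j (sigma x) (ltnW jN) sx.
  have ms := low _ _ _ (ltnW jN) sx E.
  apply: (InvU (X j (sigma x))) => //; first exact: Xd.
    by rewrite IH -sigmaB nc_sigma Xd.
  by rewrite XL// Lm_sigma XL// sp.
Qed.

End Lifting.

(** * Bounds for discs that omit a ball or two slits *)

Section Estimates.
Variable R : realType.
Local Notation C := (CC R).
Implicit Types (phi : C -> C) (rho : R).

(** Applying Cauchy's estimate to [eps / (exp phi - q)]. *)
Lemma avoid_disc_bound rho phi (phi1 : C -> C) (q : C) (eps : R) : 1 < rho -> 0 < eps ->
  holo rho phi phi1 -> (forall x, nc x < rho -> eps <= nc (cexp (phi x) - q)) ->
  nc q = 1 -> nc (cexp (phi 0)) = 1 -> nc (phi1 0) <= 4 / eps.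
Proof.
move=> rho1 e0 hphi Hq nq nphi.
have n0 x : nc x < rho -> cexp (phi x) - q != 0.
  by move=> /Hq H; rewrite -nc_gt0 (lt_le_trans e0).
have cphi x : nc x < rho -> {for x, continuous phi}.
  by move=> /hphi[H _]; exact: (cdiff_cont H).
have r0 : nc (0 : C) < rho by rewrite nc0 (lt_trans ltr01).
have H := @cauchy_estimate R (fun x => eps%:C * (cexp (phi x) - q)^-1)
  (fun x => eps%:C * (- (cexp (phi x) * phi1 x) / (cexp (phi x) - q) ^+ 2)) rho rho1.
have {}H : nc (eps%:C * (- (cexp (phi 0) * phi1 0) / (cexp (phi 0) - q) ^+ 2)) <= 1.
  apply: H.
  - move=> x xr; have [dx _] := hphi x xr.
    have d1 := cdiffB (cdiff_comp dx (cdiff_cexp (phi x))) (cdiffK q x).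
    have := cdiffM (cdiffK (eps%:C : C) x) (cdiffV d1 (n0 x xr)).
    by rewrite mul0r add0r subr0.
  - move=> x xr; have [_ cx] := hphi x xr.
    have c1 : {for x, continuous (fun x => cexp (phi x) : C)} by exact: (cont_cexp_comp (cphi x xr)).
    have c2 : {for x, continuous (fun x => cexp (phi x) - q : C)}.
      by apply: contB; [exact: c1|exact: contK].
    have c3 := contM c2 c2.
    apply: contM; first exact: contK.
    apply: contM; first exact: (contN (contM c1 cx)).
    by apply: contV; [exact: c3|exact: (expf_neq0 2 (n0 x xr))].
  - move=> x x1; have xr : nc x < rho by rewrite x1.
    rewrite ncM ncV nc_real gtr0_norm// ler_pdivrMr ?mul1r ?Hq//.
    by rewrite nc_gt0 n0.
move: H; rewrite ncM nc_real gtr0_norm// ncM ncN ncM nphi mul1r ncV ncX => H.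
rewrite ler_pdivlMr//.
have B : nc (cexp (phi 0) - q) <= 2.
  by rewrite (le_trans (ncD _ _))// ncN nphi nq; lra.
have B0 : 0 < nc (cexp (phi 0) - q) by rewrite nc_gt0 n0.
move: H; rewrite mulrA ler_pdivrMr ?exprn_gt0// mul1r mulrC => H.
by rewrite (le_trans H)//; nra.
Qed.

(** The principal square root by a closed formula, which makes its continuity and
    the sign of its real part visible; holomorphy then follows from [cdiff_lift]. *)
Definition slit_sqrt (m : C) : C :=
  (m + (nc m)%:C) * ((Num.sqrt (2 * (nc m + complex.Re (m : R[i]))))^-1)%:C.

(** The plane without the non-positive reals. *)
Definition slit (m : C) := 0 < nc m + complex.Re (m : R[i]).

Lemma slitP (m : C) : (forall t : R, t <= 0 -> m <> t%:C) -> slit m.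
Proof.
move=> H; rewrite /slit lt_neqAle eq_sym.
have := nc_Re m; rewrite ler_norml => /andP[h1 _].
rewrite addrC -lerBlDr sub0r h1 andbT; apply/eqP => E.
have Re0 : complex.Re (m : R[i]) <= 0.
  by have := nc_ge0 m; move: E => /eqP; rewrite addr_eq0 => /eqP ->; rewrite oppr_le0.
apply: (H _ Re0); have := nc_sqr m; move: E => /eqP; rewrite addrC addr_eq0 => /eqP ->.
rewrite sqrrN => /eqP; rewrite -subr_eq0 opprD addNKr oppr_eq0 sqrf_eq0 => /eqP Im0.
by case: m Im0 {H h1 Re0} => x y /= ->.
Qed.

Lemma slit_sqrtK m : slit m -> slit_sqrt m * slit_sqrt m = m.
Proof.
move=> sm; set n := nc m + complex.Re (m : R[i]).
have n0 : 0 < n by [].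
have s2 : Num.sqrt (2 * n) ^+ 2 = 2 * n by rewrite sqr_sqrtr// ltW// mulr_gt0.
have s0 : Num.sqrt (2 * n) != 0 by rewrite gt_eqF// sqrtr_gt0 mulr_gt0.
have E : (m + (nc m)%:C) ^+ 2 = m * (2 * n)%:C :> C.
  have := nc_sqr m; rewrite /n; move: (nc m) => k; case: m {sm n n0 s2 s0} => x y /= E.
  by apply/eqP; rewrite expr2 eq_complex /=; apply/andP; split; apply/eqP; move: E; nra.
rewrite /slit_sqrt -/n mulrACA -expr2 E -rmorphM -invfM -expr2 s2.
by rewrite -mulrA -rmorphM divff ?mulr1// gt_eqF// mulr_gt0.
Qed.

Lemma slit_sqrt_Re m : slit m -> 0 < complex.Re (slit_sqrt m : R[i]).
Proof.
move=> sm; rewrite /slit_sqrt; set n := nc m + complex.Re (m : R[i]).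
have n0 : 0 < n by [].
have s0 : 0 < (Num.sqrt (2 * n))^-1 by rewrite invr_gt0 sqrtr_gt0 mulr_gt0.
rewrite (_ : complex.Re _ = n * (Num.sqrt (2 * n))^-1) ?mulr_gt0//.
rewrite /n; move: (nc m) => k; case: m {sm n n0 s0} => x y /=; ring.
Qed.

Lemma cont_slit_sqrt (g : C -> C) x : {for x, continuous g} -> slit (g x) ->
  {for x, continuous (fun y => slit_sqrt (g y) : C)}.
Proof.
move=> cg sg.
have cr (u : C -> R) : {for x, continuous u} -> {for x, continuous (fun y => (u y)%:C : C)}.
  by move=> cu; exact: (@cont_Complex R C u (fun=> 0) x cu (@cst_continuous C R 0 x)).
have cn : {for x, continuous (fun y => nc (g y))} by exact: (cont_nc cg).
apply: contM; first by apply: contD; [exact: cg|exact: cr].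
apply: cr.
have cs : {for x, continuous (fun y => 2 * (nc (g y) + complex.Re (g y : R[i])) : R)}.
  apply: rcontM; first exact: cst_continuous.
  by apply: rcontD; [exact: cn|exact: (continuous_comp cg (@cont_Re _ _))].
have cq : {for x, continuous (fun y => Num.sqrt (2 * (nc (g y) + complex.Re (g y : R[i]))) : R)}.
  exact: (continuous_comp cs (@sqrt_continuous _ _)).
by apply: (@continuousV R C _ x) => //; rewrite gt_eqF// sqrtr_gt0 mulr_gt0.
Qed.

(** A disc that meets the vertical line through its centre only within distance
    [T]: a Moebius map followed by a square root sends the complement of the two
    slits to the right half-plane, where Cauchy's estimate applies. *)
Lemma slit_bound rho phi (phi1 : C -> C) (T : R) : 1 < rho -> 0 < T -> holo rho phi phi1 ->
  (forall x t, nc x < rho -> T <= `|t| -> phi x <> phi 0 + (0 +i* t)) ->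
  nc (phi1 0) <= 4 * T.
Proof.
move=> rho1 T0 hphi H.
have r0 : nc (0 : C) < rho by rewrite nc0 (lt_trans ltr01).
(* [m] maps the two half-lines beyond [phi 0 +- i T] onto the non-positive reals. *)
pose iT : C := 0 +i* T.
pose num x : C := phi x - phi 0 + iT.
pose den x : C := phi 0 + iT - phi x.
pose m x : C := num x / den x.
have iT0 : iT != 0 by rewrite -nc_gt0 nc_imag normr_gt0 gt_eqF.
have den0 x : nc x < rho -> den x != 0.
  move=> xr; rewrite subr_eq0; apply/eqP => E; apply: (H x T xr); last by rewrite -E.
  exact: ler_norm.
have cphi x : nc x < rho -> {for x, continuous phi}.
  by move=> /hphi[h _]; exact: (cdiff_cont h).
have sl x : nc x < rho -> slit (m x).
  move=> xr; apply: slitP => t t0 E.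
  have E1 : num x = t%:C * den x by rewrite -E /m divfK// den0.
  have t1 : 1 + t != 0.
    apply/eqP => t1; move: E1; have -> : t = -1 by lra.
    rewrite rmorphN rmorph1 mulN1r /num /den => /eqP; rewrite -subr_eq0 => /eqP E2.
    have : iT + iT = 0 by rewrite -[RHS]E2; ring.
    rewrite -mulr2n => /eqP; rewrite mulrn_eq0 /= (negPf iT0) //.
  apply: (H x (T * ((t - 1) / (1 + t))) xr).
    rewrite normrM gtr0_norm// ler_peMr// ?(ltW T0)// normf_div.
    by rewrite ler_pdivlMr ?normr_gt0// mul1r; case: (lerP 0 (1 + t)) => h; rewrite ler_norml; apply/andP; split;
      rewrite ?[`|t - 1|]ltr0_norm; lra.
  have -> : (0 +i* (T * ((t - 1) / (1 + t))) : C) = iT * ((t - 1)%:C / (1 + t)%:C).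
    rewrite -fmorphV -rmorphM.
    by apply/eqP; rewrite eq_complex /=; apply/andP; split; apply/eqP; ring.
  have t1C : 1 + t%:C != 0 :> C by rewrite -(rmorph1 (real_complex R)) -rmorphD -nc_gt0 nc_real normr_gt0.
  move: E1; rewrite /num /den rmorphB rmorphD rmorph1 => E1.
  apply: (mulIf t1C); rewrite mulrDl -mulrA divfK//.
  apply/eqP; rewrite -subr_eq0; apply/eqP.
  by move/eqP: E1; rewrite -subr_eq0 => /eqP E1; rewrite -[RHS]E1; ring.
pose h x : C := slit_sqrt (m x).
have hh x : nc x < rho -> h x * h x = m x by move=> xr; exact: slit_sqrtK (sl x xr).
have hRe x : nc x < rho -> 0 < complex.Re (h x : R[i]) by move=> xr; exact: slit_sqrt_Re (sl x xr).
have h0 x : nc x < rho -> h x + h x != 0.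
  move=> xr; apply/eqP => E; have := hRe x xr.
  have := congr1 (@complex.Re R) E; rewrite raddfD /=; lra.
have h1n x : nc x < rho -> 1 <= nc (1 + h x).
  move=> xr; apply: le_trans (nc_Re _); rewrite raddfD /= ler_normr.
  by apply/orP; left; have := hRe x xr; lra.
have h10 x : nc x < rho -> 1 + h x != 0.
  by move=> xr; rewrite -nc_gt0 (lt_le_trans ltr01)// h1n.
pose m1 x : C := phi1 x / den x + num x * (phi1 x / den x ^+ 2).
have dm x : nc x < rho -> cdiff m x (m1 x).
  move=> xr; have [dx _] := hphi x xr.
  have dn := cdiffD (cdiffB dx (cdiffK (phi 0) x)) (cdiffK iT x).
  have dd := cdiffB (cdiffK (phi 0 + iT) x) dx.
  have := cdiffM dn (cdiffV dd (den0 x xr)); congr cdiff.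
  by rewrite /m1 /num /den sub0r opprK subr0 addr0.
have ch x : nc x < rho -> {for x, continuous h}.
  move=> xr; apply: cont_slit_sqrt (sl x xr); exact: (cdiff_cont (dm x xr)).
have near_rho x : nc x < rho -> \forall y \near x, nc y < rho.
  move=> xr; apply/nbhs_ncP; exists (rho - nc x); first by rewrite subr_gt0.
  by move=> y yx; have := ncD (y - x) x; rewrite subrK => /le_lt_trans; apply; lra.
have dh x : nc x < rho -> cdiff h x (m1 x / (h x + h x)).
  move=> xr; apply: (@cdiff_lift R (fun w : C => w * w : C) h m) => //.
  - exact: ch.
  - by have := cdiffM (cdiffI (h x)) (cdiffI (h x)); rewrite mul1r mulr1.
  - exact: h0.
  - exact: dm.
  - by apply: filterS (near_rho x xr) => y; exact: hh.
have cden x : nc x < rho -> {for x, continuous den}.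
  by move=> xr; apply: contB; [exact: contK|exact: cphi].
have cm1 x : nc x < rho -> {for x, continuous m1}.
  move=> xr; have [_ c1] := hphi x xr.
  have c2 := cden x xr; have c3 := contV c2 (den0 x xr).
  apply: contD; first exact: (contM c1 c3).
  apply: contM.
    by apply: contD; [apply: contB; [exact: cphi|exact: contK]|exact: contK].
  apply: contM; first exact: c1.
  by apply: contV; [exact: (contM c2 c2)|exact: (expf_neq0 2 (den0 x xr))].
have K := @cauchy_estimate R (fun x => (1 + h x)^-1)
  (fun x => - (m1 x / (h x + h x)) / (1 + h x) ^+ 2) rho rho1.
have {}K : nc (- (m1 0 / (h 0 + h 0)) / (1 + h 0) ^+ 2) <= 1.
  apply: K.
  - move=> x xr; have := cdiffV (cdiffD (cdiffK (1 : C) x) (dh x xr)) (h10 x xr).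
    by rewrite add0r.
  - move=> x xr.
    have c1 : {for x, continuous (fun x => 1 + h x : C)}.
      by apply: contD; [exact: contK|exact: ch].
    have c2 := contD (ch x xr) (ch x xr).
    apply: contM.
      apply: contN; apply: contM; first exact: cm1.
      exact: (contV c2 (h0 x xr)).
    by apply: contV; [exact: (contM c1 c1)|exact: (expf_neq0 2 (h10 x xr))].
  - move=> x x1; have xr : nc x < rho by rewrite x1.
    by rewrite ncV invf_le1 ?h1n// (lt_le_trans ltr01)// h1n.
have num0 : num 0 = iT by rewrite /num subrr add0r.
have dn0 : den 0 = iT by rewrite /den addrC addKr.
have m0 : m 0 = 1 by rewrite /m num0 dn0 divff.
have h01 : h 0 = 1.
  rewrite /h m0 /slit_sqrt nc1 (_ : complex.Re (1 : C) = 1)//.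
  have -> : Num.sqrt (2 * (1 + 1)) = 2 :> R.
    by rewrite (_ : 2 * (1 + 1) = 2 ^+ 2); [rewrite sqrtr_sqr ger0_norm|ring].
  by rewrite rmorph1 fmorphV rmorph_nat -[1 + 1]/(2%:R) divff// pnatr_eq0.
move: K; rewrite h01.
have -> : - (m1 0 / (1 + 1)) / (1 + 1) ^+ 2 = - (phi1 0 / (4 * iT)) :> C.
  rewrite /m1 num0 dn0; field.
  exact: iT0.
rewrite ncN ncM ncV ncM nc_nat nc_imag gtr0_norm// ler_pdivrMr ?mulr_gt0// mul1r => K; exact: K.
Qed.

End Estimates.

(** * Polar coordinates *)

Section Polar.
Variable R : realType.
Local Notation C := (CC R).

Lemma cis_surj (z : C) : nc z = 1 -> exists2 t : R, 0 <= t < 2 * pi & z = cis t.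
Proof.
move=> z1; have := nc_sqr z; rewrite z1 expr1n; case: z z1 => x y /= z1 E.
have pi0 := pi_gt0 R.
have xI : -1 <= x <= 1 by rewrite -ler_norml -(ler_sqr (normr_ge0 _)) ?nnegrE// real_normK ?num_real// expr1n E lerDl sqr_ge0.
have [/andP[t0 tp] ct] := acos_def xI.
have s2 : Num.sqrt (1 - x ^+ 2) = `|y| by rewrite E addrC addKr sqrtr_sqr.
case: (lerP 0 y) => y0.
  exists (acos x); first by rewrite t0 (le_lt_trans tp)//; lra.
  by rewrite /cis ct sin_acos// s2 ger0_norm.
exists (2 * pi - acos x).
  rewrite subr_ge0 (le_trans tp) ?ltrBlDr ?ltrDl//; last by lra.
  rewrite lt_neqAle t0 andbT eq_sym; apply/eqP => a0.
  by move: s2; rewrite -sin_acos// a0 sin0 ltr0_norm//; lra.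
rewrite /cis addrC mulr_natl cosD2pi sinD2pi cosN sinN ct sin_acos// s2.
by rewrite ltr0_norm// opprK.
Qed.

Lemma cexp_surj (z : C) : z != 0 -> exists s : C, cexp s = z.
Proof.
move=> z0; have n0 : 0 < nc z by rewrite nc_gt0.
have [|t _ E] := @cis_surj (z / (nc z)%:C).
  by rewrite ncM ncV nc_real gtr0_norm// divff// gt_eqF.
exists (ln (nc z) +i* t); rewrite /cexp /= lnK ?posrE// -E mulrC divfK//.
by rewrite -nc_gt0 nc_real gtr0_norm.
Qed.

End Polar.

(** * Discs, derivatives and the circle map *)

Section Dynamics.
Variable R : realType.
Local Notation C := (CC R).
Variables a b : R.
Hypothesis hb : 0 <= b <= 1.
Local Notation f := (dsm a b).
Local Notation L := (Lm a b).
Local Notation L1 := (Lp b).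
Local Notation crit z := (z != 0 /\ ell b z = 0).

(** The continuous lift of [lift_exists] is holomorphic because [Lm] has non-zero
    derivative along it: a critical point there would give a critical value on
    the disc. *)
Lemma disc_lift (phi phi1 : C -> C) (rho r : R) (w : C) : 0 < r -> r < rho ->
  L w = phi 0 -> holo rho phi phi1 ->
  (forall x z, nc x < rho -> crit z -> f z != cexp (phi x)) ->
  exists psi psi1 : C -> C, [/\ psi 0 = w, holo r psi psi1,
    forall x, nc x < r -> L (psi x) = phi x, psi1 0 * L1 w = phi1 0 &
    (forall x, nc x < rho -> phi (sigma x) = sigma (phi x)) -> sigma w = w ->
      forall x, nc x < r -> psi (sigma x) = sigma (psi x)].
Proof.
move=> r0 rrho Lw hphi H.
have [|psi [psi0 Lpsi cpsi spsi]] := lift_exists hb r0 rrho Lw hphi.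
  by move=> x z xr z0 ez; exact: H.
have lr x : nc x < r -> nc x < rho by move=> xr; exact: lt_trans rrho.
have A0 x : nc x < r -> L1 (psi x) != 0.
  move=> xr; apply/eqP => E.
  have := H x (cexp (psi x)) (lr x xr) (conj (cexp_neq0 _) E).
  by rewrite -cexp_Lm Lpsi// eqxx.
exists psi, (fun x => phi1 x / L1 (psi x)); split => //.
- move=> x xr; have [dx cx] := hphi x (lr x xr); split.
    apply: (cdiff_lift (cpsi x xr) (cdiff_Lm a b (psi x)) (A0 x xr) dx).
    have : \forall y \near x, nc y < r.
      apply/nbhs_ncP; exists (r - nc x); first by rewrite subr_gt0.
      by move=> y yx; have := ncD (y - x) x; rewrite subrK => /le_lt_trans; apply; lra.
    by apply: filterS => y yr; exact: Lpsi.
  apply: contM; first exact: cx.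
  apply: contV; last exact: A0.
  have cs := cont_cexp_comp (cpsi x xr).
  apply: contD; first exact: contK.
  apply: contM; first exact: contK.
  by apply: contD; [exact: cs|exact: (contV cs (cexp_neq0 _))].
- by rewrite psi0 divfK// -psi0 A0// nc0.
Qed.

(** The chain rule for [iter n L], with the first step split off because discs are
    pulled back along the orbit of [s] from its far end. *)
Fixpoint Dn n (s : C) : C := if n is m.+1 then L1 s * Dn m (L s) else 1.

Lemma Dn_add m n s : Dn (m + n) s = Dn m s * Dn n (iter m L s).
Proof.
elim: m s => [|m IH] s; first by rewrite mul1r.
by rewrite addSn /= IH mulrA -iterSr.
Qed.

Lemma Dn_cexp n s t : cexp s = cexp t :> C -> Dn n s = Dn n t.
Proof.
elim: n s t => //= n IH s t E; rewrite /Lp E; congr (_ * _).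
by apply: IH; rewrite !cexp_Lm E.
Qed.

Lemma cdiff_iter n s : cdiff (iter n f) (cexp s) (iter n f (cexp s) / cexp s * Dn n s).
Proof.
elim: n s => [|n IH] s.
  by rewrite /= divff ?cexp_neq0// mulr1; exact: cdiffI.
have d1 := cdiff_dsm a b (cexp_neq0 s).
have := IH (L s); rewrite cexp_Lm => d2.
have := cdiff_comp d1 d2.
have -> : (fun w : C => iter n f (f w)) = iter n.+1 f by apply/funext => w; rewrite iterSr.
have E : iter n f (f (cexp s)) = f (iter n f (cexp s)) by rewrite -iterSr.
rewrite E; congr cdiff; rewrite [RHS]/= -/(Lp b s); set u := f (iter _ _ _).
have f0 : f (cexp s) != 0 by rewrite -cexp_Lm cexp_neq0.
have e0 := cexp_neq0 s.
by field; rewrite e0 f0.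
Qed.

(** The restriction of [L] to the imaginary axis: a monotone lift of degree two of
    the circle map. *)
Definition G (t : R) : R := 2 * pi * a + 2 * t + 2 * b * sin t.

Lemma Lm_imag t : L (0 +i* t : C) = 0 +i* G t.
Proof.
have E : - (0 +i* t : C) = 0 +i* - t by apply/eqP; rewrite eq_complex /= oppr0 !eqxx.
rewrite /Lm E !cexp_imag /G /cis cosN sinN.
by apply/eqP; rewrite eq_complex /=; apply/andP; split; apply/eqP; ring.
Qed.

Lemma iter_imag n t : iter n L (0 +i* t : C) = 0 +i* iter n G t.
Proof. by elim: n => //= n ->; exact: Lm_imag. Qed.

Lemma dsm_cis t : f (cis t) = cis (G t).
Proof. by rewrite -[cis t]cexp_imag -cexp_Lm Lm_imag cexp_imag. Qed.

Lemma dsm_iter_cis n t : iter n f (cis t) = cis (iter n G t).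
Proof. by elim: n => //= n ->; exact: dsm_cis. Qed.

Lemma nc_dsm n z : nc z = 1 -> nc (iter n f z) = 1.
Proof. by move=> /cis_surj[t _ ->]; rewrite dsm_iter_cis nc_cis. Qed.

(** On the circle [iter n f z] and [z] have modulus [1], so the logarithmic
    derivative of the iterate has the modulus of its derivative. *)
Lemma derive1_iter n t : `|derive1 (iter n f) (cis t)| = (nc (Dn n (0 +i* t)))%:C.
Proof.
rewrite normE -cexp_imag (cdiff_derive1 (cdiff_iter n _)) cexp_imag; congr (_%:C).
by rewrite ncM ncM ncV nc_dsm ?nc_cis// divr1 mul1r.
Qed.

(** * Expansion off a trapping set containing the critical values *)

(** The margin [e] is uniform and is measured in the coordinate in which discs are
    lifted, so that a lifted disc off [W] may be enlarged by [e]. *)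
Definition trap (W : set C) := exists2 e : R, 0 < e &
  forall u s, W (cexp u) -> nc (s - u) < e -> W (f (cexp s)).

(** Discs off [W] lift to discs off [W], and, since [W] absorbs a neighbourhood
    of itself, the lift can be enlarged by a definite factor without meeting [W].
    All these discs omit a fixed ball, hence have bounded derivative, so the
    derivatives of the iterates grow exponentially. *)
Lemma trap_expansion (W K : set C) (q : C) (eps : R) : trap W ->
  (forall z, crit z -> W (f z)) ->
  nc q = 1 -> 0 < eps -> (forall z, nc (z - q) < eps -> W z) ->
  (forall z, K z -> nc z = 1) -> (forall z, K z -> K (f z)) -> (forall z, K z -> ~ W z) ->
  exists c lam : R, [/\ 0 < c, 1 < lam &
    forall n s, K (cexp s) -> c * lam ^+ n <= nc (Dn n s)].
Proof.
move=> [e e0 He] Wcrit q1 eps0 Wq K1 Kf KW.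
pose M := 4 / eps; have M0 : 0 < M by rewrite divr_gt0.
pose eta := e / (2 * M); have eta0 : 0 < eta by rewrite divr_gt0// mulr_gt0.
pose r0 := e / 2; have r00 : 0 < r0 by rewrite divr_gt0.
have farK u s : K (cexp s) -> nc (s - u) < e -> ~ W (cexp u).
  by move=> Ks su Wu; apply: (KW _ (Kf _ Ks)); exact: He Wu su.
have bound rho phi phi1 : 1 < rho -> holo rho phi phi1 -> K (cexp (phi 0)) ->
    (forall x, nc x < rho -> ~ W (cexp (phi x))) -> nc (phi1 0) <= M.
  move=> rho1 hphi K0 HW; apply: (avoid_disc_bound rho1 eps0 hphi _ q1) => //; last exact: K1.
  by move=> x /HW h; rewrite leNgt; apply/negP => /Wq.
have main n s : K (cexp s) -> exists rho phi phi1, [/\ 1 < rho <= 2, holo rho phi phi1,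
    phi 0 = s, forall x, nc x < rho -> ~ W (cexp (phi x)) &
    r0 * (1 + eta) ^+ n <= nc (phi1 0) * nc (Dn n s)].
  elim: n s => [|n IH] s Ks.
    exists 2, (fun x => s + r0%:C * x), (fun=> r0%:C); split.
    - by rewrite lexx ltr1n.
    - move=> x _; split; last exact: contK.
      have := cdiffD (cdiffK s x) (cdiffM (cdiffK (r0%:C : C) x) (cdiffI x)).
      by rewrite mul0r !add0r mulr1.
    - by rewrite mulr0 addr0.
    - move=> x x2; apply: (@farK _ s Ks).
      rewrite opprD addNKr ncN ncM nc_real gtr0_norm//.
      by rewrite (@lt_le_trans _ _ (r0 * 2)) ?ltr_pM2l// /r0; lra.
    - by rewrite nc1 mulr1 expr0 mulr1 nc_real ger0_norm// ltW.
  have [rho [phi [phi1 [/andP[rho1 rho2] hphi phi0 HW HD]]]] : exists rho phi phi1,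
     [/\ 1 < rho <= 2, holo rho phi phi1,
    phi 0 = L s, forall x, nc x < rho -> ~ W (cexp (phi x)) &
    r0 * (1 + eta) ^+ n <= nc (phi1 0) * nc (Dn n (L s))].
    by apply: IH; rewrite cexp_Lm; exact: Kf.
  have [r1 rr] : 1 < (1 + rho) / 2 /\ (1 + rho) / 2 < rho by rewrite !midf_lt.
  set r := (1 + rho) / 2 in r1 rr.
  have rp : 0 < r by exact: lt_trans r1.
  have [|psi [psi1 [psi0 hpsi Lpsi psiD _]]] := disc_lift rp rr (esym phi0) hphi.
    by move=> x z /HW h cz; apply/eqP => E; apply: h; rewrite -E; exact: Wcrit.
  have nW x u : nc x < r -> nc (psi x - u) < e -> ~ W (cexp u).
    move=> xr xu Wu; apply: (HW x (lt_trans xr rr)).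
    by rewrite -Lpsi// cexp_Lm; exact: He Wu xu.
  have bpsi : nc (psi1 0) <= M.
    apply: (bound r psi) => //; first by rewrite psi0.
    by move=> x xr; apply: (nW x) => //; rewrite subrr (_ : nc _ = 0)//; exact: nc0.
  (* The lifted disc is enlarged by the linear term, which stays within the margin
     [e] of the trap; this multiplies the derivative by [1 + eta]. *)
  exists r, (fun x => psi x + eta%:C * psi1 0 * x), (fun x => psi1 x + eta%:C * psi1 0); split.
  - by rewrite r1 (le_trans (ltW rr)).
  - move=> x xr; have [dx cx] := hpsi x xr; split.
      have := cdiffD dx (cdiffM (cdiffK (eta%:C * psi1 0 : C) x) (cdiffI x)).
      by rewrite mul0r add0r mulr1.
    by apply: contD; [exact: cx|exact: contK].
  - by rewrite mulr0 addr0.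
  - move=> x xr; apply: (nW x) => //.
    rewrite opprD addNKr ncN ncM ncM nc_real gtr0_norm//.
    have x2 : nc x < 2 by rewrite (lt_le_trans xr)// (le_trans (ltW rr)).
    apply: (@le_lt_trans _ _ (eta * M * nc x)).
      by rewrite ler_wpM2r ?nc_ge0// ler_wpM2l// ltW.
    have -> : eta * M = e / 2 by rewrite /eta; field; rewrite gt_eqF.
    have e20 : 0 < e / 2 by rewrite divr_gt0.
    by rewrite (@lt_le_trans _ _ (e / 2 * 2)) ?ltr_pM2l//; lra.
  - have -> : psi1 0 + eta%:C * psi1 0 = (1 + eta)%:C * psi1 0 :> C.
      by rewrite rmorphD rmorph1 mulrDl mul1r.
    have E : nc (phi1 0) = nc (psi1 0) * nc (L1 s) by rewrite -psiD ncM.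
    have e1 : 0 < 1 + eta by rewrite addr_gt0.
    rewrite (ncM _ (psi1 0)) nc_real gtr0_norm// [Dn n.+1 s]/= (ncM (L1 s)).
    rewrite [leRHS](_ : _ = (1 + eta) * (nc (phi1 0) * nc (Dn n (L s)))); last by rewrite E; ring.
    by rewrite exprS mulrCA ler_pM2l.
exists (r0 / M), (1 + eta); split; [exact: divr_gt0|by rewrite ltrDl|].
move=> n s Ks; have [rho [phi [phi1 [/andP[rho1 rho2] hphi phi0 HW HD]]]] := main n s Ks.
rewrite mulrAC ler_pdivrMr// (le_trans HD)// mulrC ler_wpM2l ?nc_ge0//.
by apply: (bound rho phi) => //; rewrite phi0.
Qed.

End Dynamics.

(** * Adapted neighbourhoods of the attracting cycle *)

Lemma common_small_bound (R : realType) (P : nat -> R -> Prop) n :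
  (forall j, (j < n)%N -> exists2 e : R, 0 < e & forall e', 0 < e' <= e -> P j e') ->
  exists2 e : R, 0 < e & forall j e', (j < n)%N -> 0 < e' <= e -> P j e'.
Proof.
elim: n => [|n IH] H; first by exists 1.
have [|e e0 He] := IH; first by move=> j jn; apply: H; exact: ltnW.
have [d d0 Hd] := H n (ltnSn n).
exists (Num.min e d); first by rewrite lt_min e0.
move=> j e' + /andP[e'0]; rewrite le_min => + /andP[e'e e'd].
rewrite ltnS leq_eqVlt => /predU1P[->|jn]; first by apply: Hd; rewrite e'0.
by apply: He; rewrite ?e'0.
Qed.

Section CycleNbhd.
Variable R : realType.
Local Notation C := (CC R).
Variables a b : R.
Hypothesis hb : 0 <= b <= 1.
Local Notation f := (dsm a b).
Local Notation L := (Lm a b).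
Local Notation L1 := (Lp b).
Variables (t0 : R) (n : nat).
Local Notation p := (cis t0 : C).
Hypotheses (n0 : (0 < n)%N) (pn : iter n f p = p).

Let X k : C := 0 +i* iter k (G a b) t0.

Lemma cexpX k : cexp (X k) = iter k f p.
Proof. by rewrite cexp_imag dsm_iter_cis. Qed.

Lemma cexpXD k : cexp (X (n + k)) = cexp (X k) :> C.
Proof. by rewrite !cexpX addnC iterD pn. Qed.

Lemma LX k : L (X k) = X k.+1. Proof. exact: Lm_imag. Qed.

Lemma orbit_mod k : exists2 j, (j < n)%N & iter k f p = iter j f p.
Proof.
exists (k %% n)%N; first by rewrite ltn_mod.
rewrite {1}(divn_eq k n) addnC iterD; congr iter.
by elim: (k %/ n)%N => // m IH; rewrite mulSn iterD IH.
Qed.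

Let l j := nc (L1 (X j)).

Lemma nc_Dn_prod k s : nc (Dn a b k s) = \prod_(j < k) nc (L1 (iter j L s)).
Proof.
elim: k s => [|k IH] s; first by rewrite big_ord0 nc1.
rewrite /= ncM IH big_ord_recl; congr (_ * _).
by apply: eq_bigr => j _; rewrite -iterSr.
Qed.

Lemma l_le4 j : l j <= 4.
Proof.
have /andP[b0 b1] := hb; have E := nc_cis (iter j (G a b) t0).
rewrite /l /Lp /X cexp_imag /ell (le_trans (ncD _ _))// nc_nat ncM nc_real ger0_norm//.
have : nc (cis (iter j (G a b) t0) + (cis (iter j (G a b) t0))^-1 : C) <= 2.
  by rewrite (le_trans (ncD _ _))// ncV E invr1.
have := nc_ge0 (cis (iter j (G a b) t0) + (cis (iter j (G a b) t0))^-1 : C); nra.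
Qed.

Variable d : R.
Hypotheses (d0 : 0 < d) (dl : \prod_(j < n) (l j + d) < 1).

(** Radii adapted to the cycle: from one point to the next they grow by slightly
    more than the derivative, and once around they still shrink, by [dl]. So
    one step already contracts, not only the [n]-th. *)
Let w j := \prod_(i < j) (l i + d).

Let ld j : 0 < l j + d. Proof. by rewrite ltr_wpDl// nc_ge0. Qed.
Let w0 j : 0 < w j. Proof. by apply: prodr_gt0 => i _. Qed.
Let wS j : w j.+1 = w j * (l j + d). Proof. by rewrite /w big_ord_recr. Qed.

Definition cycle_nbhd (tau : R) : set C :=
  [set z | exists j h, [/\ (j < n)%N, nc h < tau * w j & z = cexp (X j + h)]].
Local Notation E := cycle_nbhd.

Lemma cycle_nbhd_le tau tau' : tau <= tau' -> E tau `<=` E tau'.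
Proof.
move=> h z [j [k [jn kw ->]]]; exists j, k; split => //.
by rewrite (lt_le_trans kw)// ler_pM2r.
Qed.

Let w00 : w 0 = 1. Proof. by rewrite /w big_ord0. Qed.

Lemma cycle_nbhd_center tau k : 0 < tau -> E tau (iter k f p).
Proof.
move=> h; have [j jn ->] := orbit_mod k.
by exists j, 0; rewrite addr0 cexpX nc0 mulr_gt0.
Qed.

Lemma cycle_nbhd_ball tau s h : cexp s = p -> nc h < tau -> E tau (cexp (s + h)).
Proof.
move=> sp hw; exists 0%N, h; rewrite w00 mulr1; split => //.
by rewrite !cexpD sp cexpX.
Qed.

Lemma cycle_nbhd_margin tau tau' : tau < tau' -> exists2 e : R, 0 < e &
  forall u s, E tau (cexp u) -> nc (s - u) < e -> E tau' (cexp s).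
Proof.
move=> tt'.
have [|e e0 He] := @common_small_bound R (fun j e => e <= (tau' - tau) * w j) n.
  move=> j jn; exists ((tau' - tau) * w j); first by rewrite mulr_gt0 ?subr_gt0.
  by move=> e' /andP[].
exists e => // u s [j [h [jn hw Eu]]] su; exists j, (h + (s - u)); split => //.
  rewrite (le_lt_trans (ncD _ _))//.
  have := He j e jn; rewrite e0 lexx => /(_ isT); lra.
by rewrite addrA cexpD -Eu -cexpD; congr cexp; ring.
Qed.

(** By the choice of the weights, a step along the cycle is a first-order estimate
    with room [d / 2] to spare; closing the cycle uses that the last weight is
    less than the first. *)
Lemma cycle_nbhd_contract : exists th t1 : R, [/\ 0 < th < 1, 0 < t1 &
  forall tau z, 0 < tau <= t1 -> E tau z -> E (th * tau) (f z)].
Proof.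
(* Chosen so that [l + d / 2 <= th * (l + d)] for all [l <= 4]. *)
pose th := 1 - d / (2 * (4 + d)).
have d4 : 0 < 4 + d by rewrite addr_gt0.
have thE : th * (2 * (4 + d)) = 8 + d by rewrite /th; field; rewrite gt_eqF.
have th1 : th < 1 by rewrite /th ltrBlDr ltrDl divr_gt0// mulr_gt0.
have th0 : 0 < th by nra.
have thl j : l j + d / 2 <= th * (l j + d) by have := l_le4 j; have := d0; nra.
have [|t1 t10 Ht1] := @common_small_bound R (fun j t => forall h, nc h <= t * w j ->
    nc (L (X j + h) - X j.+1) <= (l j + d / 2) * nc h) n.
  move=> j jn; have [q [cq qX Hq]] := cdiff_Lm a b (X j).
  have d20 : 0 < d / 2 by rewrite divr_gt0.
  have [e1 e10 H1] := (cont_ncP _ _).1 cq _ d20.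
  move/nbhs_ncP : Hq => [e2 e20 H2].
  pose e := Num.min e1 e2; have e0 : 0 < e by rewrite lt_min e10.
  exists (e / (2 * w j)); first by rewrite divr_gt0// mulr_gt0.
  move=> t /andP[tpos te] h ht.
  have he : nc h < e.
    rewrite (le_lt_trans ht)//; move: te; rewrite ler_pdivlMr ?mulr_gt0// => te.
    have := mulr_gt0 tpos (w0 j); lra.
  have hX : X j + h - X j = h by rewrite addrAC subrr add0r.
  move: he; rewrite lt_min => /andP[he1 he2].
  have := H2 (X j + h); rewrite /= hX LX => /(_ he2) ->; rewrite ncM ler_wpM2r ?nc_ge0//.
  have := H1 (X j + h); rewrite hX qX => /(_ he1) => H.
  have := ncD (q (X j + h) - L1 (X j)) (L1 (X j)); rewrite subrK -/(l j); lra.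
exists th, t1; split => //; first by rewrite th0.
move=> tau z tau01 [j [h [jn hw ->]]].
have {}H := Ht1 j tau jn tau01 h (ltW hw); have /andP[tau0 _] := tau01.
set h' := L (X j + h) - X j.+1 in H.
have h'w : nc h' < th * tau * w j.+1.
  rewrite (le_lt_trans H)// wS.
  have ldh : 0 < l j + d / 2 by rewrite ltr_wpDl ?nc_ge0// divr_gt0.
  apply: (@lt_le_trans _ _ ((l j + d / 2) * (tau * w j))); first by rewrite ltr_pM2l.
  have -> : th * tau * (w j * (l j + d)) = th * (l j + d) * (tau * w j) by ring.
  by rewrite ler_pM2r// mulr_gt0.
have fE : f (cexp (X j + h)) = cexp (X j.+1 + h') by rewrite -cexp_Lm /h'; congr cexp; ring.
have [jn'|jn'] := ltnP j.+1 n; first by exists j.+1, h'.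
have jE : j.+1 = n by apply/eqP; rewrite eqn_leq jn jn'.
exists 0%N, h'; split => //; last first.
  by rewrite fE jE -[n]addn0 !cexpD cexpXD.
rewrite (lt_le_trans h'w)// ler_pM2l ?mulr_gt0// w00 jE; exact: ltW.
Qed.

(** The discs live in the logarithmic coordinate; their images contain Euclidean
    discs by the inverse function theorem for [cexp]. *)
Lemma cycle_nbhd_nbhs tau k : 0 < tau -> nbhs (iter k f p) (E tau).
Proof.
move=> tau0; have [j jn ->] := orbit_mod k.
have [r r0 NL] := cexp_near_linear R.
pose rr := Num.min r (tau * w j); have rr0 : 0 < rr by rewrite lt_min r0 mulr_gt0.
have NLj : near_linear (@cexp R) (cexp (X j)) (X j) rr.
  by move=> x y xr yr; apply: NL; [apply: (le_trans xr)|apply: (le_trans yr)];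
    rewrite /rr ge_min lexx.
apply/nbhs_ncP; exists (rr / 4); first by rewrite divr_gt0.
move=> z zp.
have [||s sr <-] := near_linear_onto (z := z) NLj (cexp_neq0 _) rr0.
- by move=> x _; exact: cont_cexp.
- by rewrite cexp_imag nc_cis mul1r -[cis _]cexp_imag cexpX.
exists j, (s - X j); split => //; last by rewrite addrC subrK.
by rewrite (lt_le_trans sr)// /rr ge_min lexx orbT.
Qed.

Lemma cycle_nbhd_small (U : set C) : (forall k, nbhs (iter k f p) U) ->
  exists2 tau : R, 0 < tau & E tau `<=` U.
Proof.
move=> HU; have [|t tpos Ht] := @common_small_bound R (fun j t => forall h, nc h < t * w j -> U (cexp (X j + h))) n.
  move=> j jn; have /nbhs_ncP[e e0 He] := HU j; rewrite -cexpX in He.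
  have [e1 e10 H1] := (cont_ncP _ _).1 (@cont_cexp R (X j)) e e0.
  exists (e1 / w j); first by rewrite divr_gt0.
  move=> e' /andP[_]; rewrite ler_pdivlMr// => e'w h hw; apply: He; apply: H1.
  by rewrite addrAC subrr add0r (lt_le_trans hw).
exists t => // z [j [h [jn hw ->]]]; apply: (Ht j t) => //.
by rewrite tpos lexx.
Qed.

Lemma cycle_nbhd_sigma tau s : E tau (cexp s) -> E tau (cexp (sigma s)).
Proof.
move=> [j [h [jn hw Es]]]; exists j, (sigma h); rewrite nc_sigma; split => //.
have sX : X j = sigma (X j) by apply/eqP; rewrite eq_complex /= oppr0 opprK !eqxx.
have sD : sigma (X j + h) = X j + sigma h by rewrite /sigma rmorphD opprD -/(sigma (X j)) -sX.
by rewrite -sD /sigma !cexpN !cexp_conj Es.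
Qed.

(** Puts the neighbourhood into the immediate basin, once it is known to lie in the
    basin. *)
Lemma cycle_nbhd_path tau z : E tau z -> exists k s h, [/\ cexp s = iter k f p, z = cexp (s + h) &
  forall v : R, 0 <= v <= 1 -> E tau (cexp (s + v%:C * h))].
Proof.
move=> [j [h [jn hw ->]]]; exists j, (X j), h; split => //; first exact: cexpX.
move=> v /andP[v0 v1]; exists j, (v%:C * h); split => //.
by rewrite (le_lt_trans _ hw)// ncM nc_real ger0_norm// ler_piMl ?nc_ge0.
Qed.

(** The margin between the radii [th * t1] and [t1] is absorbed in one step. *)
Lemma cycle_nbhd_trap th t1 : 0 < th < 1 -> 0 < t1 ->
  (forall tau z, 0 < tau <= t1 -> E tau z -> E (th * tau) (f z)) ->
  trap a b (E (th * t1)).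
Proof.
move=> /andP[th0 th1] t10 H.
have [|e e0 He] := @cycle_nbhd_margin (th * t1) t1; first by rewrite gtr_pMl.
exists e => // u s Eu su; apply: H; first by rewrite t10 lexx.
exact: He Eu su.
Qed.

End CycleNbhd.

(** The product is continuous in [d]. *)
Lemma prod_slack (R : realType) n (l : nat -> R) : \prod_(j < n) l j < 1 ->
  exists2 d : R, 0 < d & \prod_(j < n) (l j + d) < 1.
Proof.
move=> H.
have cP m : {for (0 : R), continuous (fun d : R => \prod_(j < m) (l j + d) : R)}.
  elim: m => [|m IH].
    have -> : (fun d : R => \prod_(j < 0) (l j + d)) = (fun=> 1).
      by apply/funext => d; rewrite big_ord0.
    exact: cst_continuous.
  have -> : (fun d : R => \prod_(j < m.+1) (l j + d)) =
      (fun d => \prod_(j < m) (l j + d) * (l m + d)).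
    by apply/funext => d; rewrite big_ord_recr.
  by apply: rcontM; [exact: IH|apply: rcontD; [exact: cst_continuous|exact: cvg_id]].
have E : \prod_(j < n) (l j + 0) = \prod_(j < n) l j by apply: eq_bigr => j _; rewrite addr0.
have e0 : 0 < 1 - \prod_(j < n) l j by rewrite subr_gt0.
have /cvgrPdist_lt/(_ _ e0)/nbhs_ballP[r /= r0 Hr] := cP n.
exists (r / 2); first by rewrite divr_gt0.
have := Hr (r / 2); rewrite /ball /= sub0r normrN gtr0_norm ?divr_gt0// => /(_ _).
have -> : r / 2 < r by lra.
move=> /(_ isT); rewrite E distrC => /(le_lt_trans (ler_norm _)); lra.
Qed.

(** * The critical points are attracted *)

Section Fatou.
Variable R : realType.
Local Notation C := (CC R).
Variables a b : R.
Hypothesis hb : 0 <= b <= 1.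
Local Notation f := (dsm a b).
Local Notation L := (Lm a b).
Local Notation L1 := (Lp b).
Local Notation crit z := (z != 0 /\ ell b z = 0).

Lemma ell_conj (z : C) : ell b (conjc (z : R[i])) = conjc (ell b z : R[i]).
Proof.
rewrite /ell -conjc_inv; case: z => x y; case: (_^-1) => u v.
by apply/eqP; rewrite eq_complex /=; apply/andP; split; apply/eqP; ring.
Qed.

Lemma ell_inj (z w : C) : z != 0 -> w != 0 -> ell b z = 0 -> ell b w = 0 ->
  w = z \/ w = z^-1.
Proof.
move=> z0 w0 ez ew; have B0 : b%:C != 0 :> C.
  apply/eqP => B0; move: ez; rewrite /ell B0 mul0r addr0 => /eqP.
  by rewrite pnatr_eq0.
have E : z + z^-1 = w + w^-1.
  by apply: (mulfI B0); apply: (addrI (2 : C)); rewrite -/(ell b z) -/(ell b w) ez ew.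
have : (w - z) * (w * z - 1) = 0.
  have -> : (w - z) * (w * z - 1) = w * z * ((w + w^-1) - (z + z^-1)) :> C.
    by field; rewrite w0 z0.
  by rewrite E subrr mulr0.
move/eqP; rewrite mulf_eq0 !subr_eq0 => /orP[/eqP ->|/eqP wz]; [by left|right].
by apply: (mulIf z0); rewrite mulVf.
Qed.

(** The critical points are the roots [z], [1 / z] of a real quadratic, hence either
    exchanged by the reflection in the circle or equal to [-1]. By symmetry of the
    dynamics, one of them is attracted if and only if both are. *)
Lemma crit_pair (z w : C) : crit z -> crit w -> w = z \/ w = (conjc (z : R[i]))^-1.
Proof.
move=> [z0 ez] [w0 ew]; have [->|->] := ell_inj z0 w0 ez ew; first by left.
have zc0 : conjc (z : R[i]) != 0 :> C by rewrite -nc_gt0 nc_conj nc_gt0.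
have ec : ell b (conjc (z : R[i])) = 0 by rewrite ell_conj ez conjc0.
have [->|E] := ell_inj z0 zc0 ez ec; first by right.
left; have /andP[b0 b1] := hb.
have n1 : nc z = 1.
  have := congr1 (fun u : C => nc (z * u)) E.
  rewrite mulfV// nc1 ncM nc_conj -expr2 => /eqP.
  by rewrite sqrf_eq1 => /orP[/eqP //|/eqP h]; have := nc_ge0 z; rewrite h; lra.
have ReE : b * complex.Re (z : R[i]) = -1.
  have := congr1 (@complex.Re R) ez; rewrite /ell -E; case: (z) => x y /=; lra.
have ReB : `|complex.Re (z : R[i])| <= 1 by rewrite -n1 nc_Re.
have Re1 : complex.Re (z : R[i]) = -1.
  by move: ReB; rewrite ler_norml => /andP[h1 h2]; nra.
have Im0 : complex.Im (z : R[i]) = 0.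
  have := nc_sqr z; rewrite n1 Re1 => h; apply/eqP; rewrite -sqrf_eq0; apply/eqP; lra.
by rewrite -E; case: (z) Im0 => x y /= ->; rewrite oppr0.
Qed.

Definition period (v : C) := forall s : C, cexp (s + v) = cexp s.

Lemma period_2pi : period (0 +i* (pi *+ 2) : C).
Proof.
move=> s; rewrite cexpD cexp_imag.
have -> : cis (pi *+ 2) = 1 :> C by rewrite /cis cos2pi -[pi *+ 2]add0r sinD2pi sin0.
by rewrite mulr1.
Qed.

Lemma periodN v : period v -> period (- v).
Proof. by move=> H s; have := H (s - v); rewrite subrK => ->. Qed.

(** [L (s + v) = L s + 2 v] for a period [v] of the exponential; the growth of the
    translation is what confines the pulled back discs. *)
Lemma period_iter v k s : period v -> iter k L (s + v) = iter k L s + v *+ 2 ^ k.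
Proof.
move=> pv; elim: k => [|k IH]; first by rewrite mulr1n.
rewrite !iterS IH; set u := iter k L s.
have pm m : period (v *+ m).
  elim: m => [|m IHm] x; first by rewrite addr0.
  by rewrite mulrS addrA IHm.
have pm' : period (- (v *+ 2 ^ k)) by exact: periodN.
rewrite /Lm opprD pm pm' expnS mulnC mulnC mul2n -addnn mulrnDr; ring.
Qed.

Lemma sigma_imag s : sigma s = s :> C -> s = 0 +i* complex.Im (s : R[i]).
Proof.
case: s => x y; rewrite /sigma => /eqP; rewrite eq_complex /= opprK eqxx andbT => /eqP h.
by apply/eqP; rewrite eq_complex /= eqxx andbT; apply/eqP; lra.
Qed.

Variables (t0 : R) (n : nat) (d : R).
Local Notation p := (cis t0 : C).
Hypotheses (n0 : (0 < n)%N) (pn : iter n f p = p).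
Hypotheses (d0 : 0 < d) (dl : \prod_(j < n) (nc (L1 (0 +i* iter j (G a b) t0)) + d) < 1).
Hypothesis attr : nc (Dn a b n (0 +i* t0)) < 1.
Local Notation E := (cycle_nbhd a b t0 n d).

(** Pull a disc around the cycle back along the cycle: if no critical orbit enters
    the neighbourhood, this can be done for ever. *)
Lemma pullback_discs (tau : R) (X : C) : 0 < tau -> cexp X = p ->
  (forall z k, crit z -> ~ E tau (iter k f z)) ->
  forall k s, sigma s = s -> iter k L s = X ->
  exists rho phi phi1, [/\ 1 < rho <= 2, holo rho phi phi1, phi 0 = s /\
    phi1 0 * Dn a b k s = (tau / 2)%:C,
    forall x, nc x < rho -> iter k L (phi x) = X + (tau / 2)%:C * x &
    forall x, nc x < rho -> phi (sigma x) = sigma (phi x)].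
Proof.
move=> tau0 Xp nocrit; elim=> [|k IH] s ss Ls.
  exists 2, (fun x => X + (tau / 2)%:C * x), (fun=> (tau / 2)%:C); split => //.
  - by rewrite lexx ltr1n.
  - move=> x _; split; last exact: contK.
    have := cdiffD (cdiffK X x) (cdiffM (cdiffK ((tau / 2)%:C : C) x) (cdiffI x)).
    by rewrite mul0r !add0r mulr1.
  - by rewrite mulr0 addr0 mulr1; split.
  - move=> x _; rewrite -sigma_real; move: ss; rewrite -[s]/(iter 0 L s) Ls => ss.
    by rewrite [in RHS]/sigma rmorphD opprD -/(sigma X) ss.
have sLs : sigma (L s) = L s by rewrite -Lm_sigma ss.
have [|rho [phi [phi1 [/andP[rho1 rho2] hphi [phi0 phiD] Lphi sphi]]]] := IH (L s) sLs.
  by rewrite -iterSr.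
have [r1 rr] : 1 < (1 + rho) / 2 /\ (1 + rho) / 2 < rho by rewrite !midf_lt.
set r := (1 + rho) / 2 in r1 rr.
have rp : 0 < r by exact: lt_trans r1.
have tau20 : 0 < tau / 2 by rewrite divr_gt0.
have [|psi [psi1 [psi0 hpsi Lpsi psiD spsi]]] := disc_lift hb rp rr (esym phi0) hphi.
  move=> x z xr cz; apply/eqP => h; apply: (nocrit z k.+1 cz).
  rewrite iterSr h dsm_iter Lphi//; apply: cycle_nbhd_ball => //.
  rewrite ncM nc_real gtr0_norm//; apply: (@lt_le_trans _ _ (tau / 2 * 2)); last by lra.
  by rewrite ltr_pM2l// (lt_le_trans xr).
exists r, psi, psi1; split.
- by rewrite r1 (le_trans (ltW rr)).
- exact: hpsi.
- by split=> //=; rewrite mulrA psiD.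
- by move=> x xr; rewrite iterSr Lpsi// Lphi// (lt_trans xr).
- exact: spsi.
Qed.

(** Fatou's theorem for the cycle. Otherwise the pulled back discs are symmetric
    and meet the imaginary axis in less than a period, so the slit estimate bounds
    their derivatives, which grow without bound along the attracting cycle. *)
Lemma some_crit_attracted (tau : R) : 0 < tau ->
  ~ (forall z k, crit z -> ~ E tau (iter k f z)).
Proof.
move=> tau0 H.
wlog tau1 : tau tau0 H / tau <= 1.
  move=> W; have [h|h] := lerP tau 1; first exact: (W tau).
  by apply: (W 1) => // z k cz /(cycle_nbhd_le d0 (ltW h)); exact: H.
pose s0 : C := 0 +i* t0.
have ss0 : sigma s0 = s0 by apply/eqP; rewrite eq_complex /= oppr0 opprK !eqxx.
set mu := nc (Dn a b n s0); have mu1 : mu < 1 by exact: attr.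
have cs0 : cexp s0 = p by rewrite cexp_imag.
have ncyc m : iter (m * n) f p = p.
  by elim: m => // m IH; rewrite mulSn iterD IH.
have DnE m : nc (Dn a b (m * n) s0) = mu ^+ m.
  elim: m => [|m IH]; first by rewrite nc1 expr0.
  rewrite mulSn Dn_add ncM exprS -IH; congr (_ * nc _).
  by apply: Dn_cexp; rewrite -dsm_iter cs0 pn.
(* After [m] turns around the cycle, the derivative of the pulled back disc times
   [mu ^+ m] is [tau / 2], while [slit_bound] keeps it below [4 * (2 pi)]. *)
have bound m : tau / 2 <= 4 * (pi *+ 2) * mu ^+ m.
  pose N := (m * n)%N; pose X := iter N L s0.
  have Xp : cexp X = p by rewrite -dsm_iter cs0 ncyc.
  have [rho [phi [phi1 [/andP[rho1 rho2] hphi [phi0 phiD] Lphi sphi]]]] :=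
    pullback_discs tau0 Xp H (k := N) ss0 erefl.
  have pi2 : 0 < pi *+ 2 :> R by rewrite mulrn_wgt0// pi_gt0.
  have pi24 : 4 <= pi *+ 2 :> R by rewrite mulr2n; have := pi_ge2 R; lra.
  suff B : nc (phi1 0) <= 4 * (pi *+ 2).
    have := congr1 (@nc R) phiD; rewrite ncM DnE nc_real gtr0_norm ?divr_gt0// => <-.
    by rewrite ler_wpM2r// exprn_ge0// nc_ge0.
  apply: (slit_bound rho1 pi2 hphi) => x t xr tT phix.
  have cphi y : nc y < rho -> {for y, continuous phi}.
    by move=> /hphi[h _]; exact: (cdiff_cont h).
  have imL k (y : C) : sigma y = y -> sigma (iter k L y) = iter k L y.
    by move=> h; elim: k => // k IH; rewrite iterS -Lm_sigma IH.
  have simX : sigma X = X by exact: imL.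
  have sphix : sigma (phi x) = phi x.
    rewrite phix phi0 /s0.
    by apply/eqP; rewrite eq_complex /= !addr0 oppr0 !opprK !eqxx.
  have tau20 : (tau / 2)%:C != 0 :> C by rewrite -nc_gt0 nc_real normr_gt0 gt_eqF// divr_gt0.
  have sx : sigma x = x.
    have := imL N _ sphix; rewrite Lphi// => h.
    have : sigma X + (tau / 2)%:C * sigma x = X + (tau / 2)%:C * x.
      by rewrite -h -sigma_real /sigma rmorphD opprD.
    by rewrite simX => /addrI/(mulfI tau20).
  pose g (u : R) : R := complex.Im (phi (u%:C * x) : R[i]).
  have ux (u : R) : 0 <= u <= 1 -> nc (u%:C * x) < rho.
    move=> /andP[u0 u1]; rewrite ncM nc_real ger0_norm// (le_lt_trans _ xr)//.
    by rewrite ler_piMl// nc_ge0.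
  have cg : {within `[0, 1], continuous g}.
    apply: continuous_in_subspaceT => u; rewrite inE /= in_itv /= => uI.
    have cu : {for u, continuous (fun u : R => u%:C * x : C)}.
      apply: contM; last exact: contK.
      exact: (rdiff_cont (rdiff_real u)).
    have c1 := continuous_comp cu (cphi _ (ux u uI)).
    exact: (continuous_comp c1 (@cont_Im _ _)).
  have g0 : g 0 = t0 by rewrite /g rmorph0 mul0r phi0.
  have g1 : g 1 = t0 + t by rewrite /g rmorph1 mul1r phix phi0.
  (* The image of the segment from [0] to [x] stays on the imaginary axis, so it
     would pass through the translate of [s0] by a period [v]; but [N] steps
     later this translate has moved too far away to be in the disc. *)
  have far (v : R) : period (0 +i* v : C) -> `|v| = pi *+ 2 ->
      Num.min (g 0) (g 1) <= t0 + v <= Num.max (g 0) (g 1) -> False.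
    move=> pv vE vI; have [u uI gu] := IVT ler01 cg vI.
    rewrite in_itv /= in uI.
    (* [x] is fixed by the symmetry, hence so is the whole segment. *)
    have sphu : sigma (phi (u%:C * x)) = phi (u%:C * x).
      by rewrite -sphi ?ux// sigma_real sx.
    have phiu : phi (u%:C * x) = s0 + (0 +i* v).
      rewrite (sigma_imag sphu) -/(g u) gu.
      by apply/eqP; rewrite eq_complex /= addr0 !eqxx.
    have := Lphi _ (ux u uI); rewrite phiu period_iter// => /addrI h.
    have := congr1 (@nc R) h; rewrite ncM nc_real gtr0_norm ?divr_gt0// => hn.
    have uB := ux u uI.
    have : pi *+ 2 <= nc ((0 +i* v : C) *+ 2 ^ N).
      rewrite -[X in nc X]mulr_natr ncM nc_nat nc_imag vE ler_peMr ?(ltW pi2)//.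
      by rewrite ler1n expn_gt0.
    rewrite hn; have := nc_ge0 (u%:C * x); nra.
  have [t_ge|t_lt] := lerP 0 t.
    apply: (far (pi *+ 2) (@period_2pi)); first by rewrite gtr0_norm.
    move: tT; rewrite ger0_norm// g0 g1 => tT.
    by rewrite ge_min le_max; apply/andP; split; apply/orP; [left|right]; lra.
  apply: (far (- (pi *+ 2))).
  - have -> : (0 +i* - (pi *+ 2) : C) = - (0 +i* (pi *+ 2)).
      by apply/eqP; rewrite eq_complex /= oppr0 !eqxx.
    exact/periodN/period_2pi.
  - by rewrite normrN gtr0_norm.
  - move: tT; rewrite ltr0_norm// g0 g1 => tT.
    by rewrite ge_min le_max; apply/andP; split; apply/orP; [right|left]; lra.
have mu0 : 0 <= mu := nc_ge0 _.
have : (fun m => 4 * (pi *+ 2) * mu ^+ m : R) @ \oo --> (4 * (pi *+ 2) * 0 : R).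
  by apply: cvgMr; apply: cvg_expr; rewrite ger0_norm.
rewrite mulr0 => /cvgrPdist_lt/(_ (tau / 2)).
rewrite divr_gt0// => /(_ isT)[m _ Hm].
have := Hm m (leqnn m); rewrite /= sub0r normrN ger0_norm; last first.
  by rewrite !mulr_ge0 ?exprn_ge0// mulrn_wge0// pi_ge0.
by rewrite ltNge bound.
Qed.

(** Some critical point is attracted; the other one is its mirror image. *)
Lemma fatou (tau : R) z : 0 < tau -> crit z -> exists k, E tau (iter k f z).
Proof.
move=> tau0 cz; apply: contrapT => /forallNP H.
apply: (some_crit_attracted tau0) => w k cw.
have [s Es] := cexp_surj cz.1.
have [->|->] := crit_pair cz cw; first exact: H.
have -> : (conjc (z : R[i]))^-1 = cexp (sigma s) :> C by rewrite /sigma cexpN cexp_conj Es.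
have Lsig (x : C) j : iter j L (sigma x) = sigma (iter j L x).
  by elim: j => // j IH; rewrite !iterS IH Lm_sigma.
rewrite dsm_iter Lsig => /(cycle_nbhd_sigma).
have -> : sigma (sigma (iter k L s)) = iter k L s.
  by case: (iter k L s) => x y; apply/eqP; rewrite eq_complex /= !opprK !eqxx.
by rewrite -dsm_iter Es; exact: H.
Qed.

End Fatou.

(** * Basins *)

Section BasinOfASet.
Variables (T : topologicalType) (f : T -> T) (O : set T).

Lemma basinP z : basin f O z <-> forall U : set T, (forall x, O x -> nbhs x U) ->
  exists N, forall k, (N <= k)%N -> U (iter k f z).
Proof.
split=> [H U HU|H U HU].
  by have [N _ HN] := H U HU; exists N => k Nk; exact: HN.
by have [N HN] := H U HU; exists N => // k Nk; exact: HN.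
Qed.

Lemma basin_iter k z : basin f O (iter k f z) <-> basin f O z.
Proof.
split=> /basinP H; apply/basinP => U HU; have [N HN] := H U HU.
  exists (N + k)%N => m Nm; have -> : m = (m - k + k)%N.
    by rewrite subnK// (leq_trans _ Nm)// leq_addl.
  by rewrite iterD; apply: HN; rewrite leq_subRL ?(leq_trans _ Nm)// ?leq_addl// addnC.
by exists N => m Nm; rewrite -iterD; apply: HN; rewrite (leq_trans Nm)// leq_addr.
Qed.

End BasinOfASet.

Section Basin.
Variable R : realType.
Local Notation C := (CC R).
Variables a b : R.
Hypothesis hb : 0 <= b <= 1.
Local Notation f := (dsm a b).
Local Notation L := (Lm a b).
Local Notation L1 := (Lp b).
Local Notation crit z := (z != 0 /\ ell b z = 0).

(** * Growing a trapping set along a backward orbit *)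

(** Interior points, measured in the logarithmic coordinate. *)
Definition inner (W : set C) (s : C) := exists2 r : R, 0 < r &
  forall h, nc h < r -> W (cexp (s + h)).

(** One step backwards: the disc added around [s] is mapped well inside the old
    trapping set, and cannot meet the invariant set [K] because its image does
    not. *)
Lemma trap_extend (K : set C) : (forall z, K z -> K (f z)) ->
  forall k (W : set C) s, trap a b W -> (forall z, K z -> ~ W z) -> inner W (iter k L s) ->
  exists W', [/\ trap a b W', forall z, K z -> ~ W' z, W `<=` W' & inner W' s].
Proof.
move=> Kf; elim=> [|k IH] W s tW KW Ws; first by exists W; split.
have [|W1 [[e e0 He] KW1 WW1 [r r0 Hr]]] := IH W (L s) tW KW; first by rewrite -iterSr.
have [d d0 Hd] := (cont_ncP _ _).1 (@cont_Lm R a b s) r r0.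
(* Half of the disc that is mapped into [W1]; the other half is the margin. *)
pose W2 := W1 `|` [set z | exists2 h, nc h < d / 2 & z = cexp (s + h)].
have into h : nc h < d -> W1 (f (cexp (s + h))).
  move=> hd; rewrite -cexp_Lm; have := Hd (s + h).
  rewrite addrAC subrr add0r => /(_ hd)/Hr; congr W1; congr cexp; ring.
have d20 : 0 < d / 2 by rewrite divr_gt0.
exists W2; split.
- exists (Num.min e (d / 2)); first by rewrite lt_min e0.
  move=> u v + ; rewrite lt_min => + /andP[uve uvd].
  move=> [W1u|[h hd Eu]]; first by left; exact: He W1u uve.
  left; have -> : cexp v = cexp (s + (h + (v - u))).
    by rewrite addrA cexpD -Eu -cexpD; congr cexp; ring.
  by apply: into; rewrite (le_lt_trans (ncD _ _))//; lra.
- move=> z Kz [|[h hd Ez]]; first exact: KW1.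
  apply: (KW1 _ (Kf _ Kz)); rewrite Ez; apply: into; lra.
- by move=> z /WW1; left.
- by exists (d / 2) => // h hd; right; exists h.
Qed.

Variables (t0 : R) (n : nat) (d : R).
Local Notation p := (cis t0 : C).
Hypotheses (n0 : (0 < n)%N) (pn : iter n f p = p).
Hypotheses (d0 : 0 < d) (dl : \prod_(j < n) (nc (L1 (0 +i* iter j (G a b) t0)) + d) < 1).
Hypothesis attr : nc (Dn a b n (0 +i* t0)) < 1.
Local Notation E := (cycle_nbhd a b t0 n d).
Let O : set C := [set iter k f p | k in [set: nat]].
Local Notation B := (basin f O).

Lemma basin_enter tau z : 0 < tau -> B z -> exists k, E tau (iter k f z).
Proof.
move=> tau0 /basinP/(_ (E tau))[|N HN]; last by exists N; exact: HN.
by move=> x [k _ <-]; exact: (cycle_nbhd_nbhs n0 pn d0 k tau0).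
Qed.

Section Contract.
Variables th t1 : R.
Hypotheses (th01 : 0 < th < 1) (t10 : 0 < t1).
Hypothesis contract : forall tau z, 0 < tau <= t1 -> E tau z -> E (th * tau) (f z).

Lemma cycle_nbhd_basin : E t1 `<=` B.
Proof.
move=> z Ez; have /andP[th0 th1] := th01; apply/basinP => U HU.
have [|tau tau0 Htau] := @cycle_nbhd_small R a b t0 n d d0 U.
  by move=> k; apply: HU; exists k.
have Ek k : E (th ^+ k * t1) (iter k f z).
  elim: k => [|k IH]; first by rewrite expr0 mul1r.
  rewrite exprS -mulrA; apply: contract => //.
  rewrite mulr_gt0 ?exprn_gt0//= ler_piMl ?(ltW t10)//.
  by rewrite exprn_ile1// ltW.
have : (fun m => th ^+ m * t1 : R) @ \oo --> (0 * t1 : R).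
  by apply: cvgMl; apply: cvg_expr; rewrite gtr0_norm.
rewrite mul0r => /cvgrPdist_lt/(_ _ tau0)[N _ HN].
exists N => k Nk; apply: Htau; apply: (cycle_nbhd_le d0 _ (Ek k)).
have := HN k Nk; rewrite /= sub0r normrN gtr0_norm ?mulr_gt0 ?exprn_gt0//.
exact: ltW.
Qed.

(** An orbit in the basin enters the neighbourhood of the cycle, where it is joined
    to the cycle by an arc inside the basin. *)
Lemma total_basinE : total_basin f O = B `&` @circle R.
Proof.
apply/seteqP; split=> z [Hz cz]; split => //.
  have [j _ [x Ox /connected_component_sub]] := Hz.
  by move/(basin_iter f O j z).
have [k Ek] := basin_enter t10 Hz.
have [j [s [h [sj Ez path]]]] := cycle_nbhd_path Ek.
exists k => //; exists (cexp s); first by exists j.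
pose g (v : R) : C := cexp (s + v%:C * h).
have cg : continuous g.
  move=> v; apply: cont_cexp_comp.
  apply: contD; first exact: contK.
  by apply: contM; [exact: (rdiff_cont (rdiff_real v))|exact: contK].
have conn : connected (g @` `[0, 1]).
  by apply: connected_continuous_connected; [exact: segment_connected|exact: continuous_subspaceT].
have sub : g @` `[0, 1] `<=` B.
  by move=> _ [v /= vI <-]; apply: cycle_nbhd_basin; apply: path; move: vI; rewrite in_itv.
apply: (@connected_component_max _ _ (g @` `[0, 1])) => //.
  by exists 0; rewrite /= ?in_itv /= ?lexx ?ler01// /g rmorph0 mul0r addr0.
by exists 1; rewrite /= ?in_itv /= ?lexx ?ler01// /g rmorph1 mul1r Ez.
Qed.

(** A trapping set containing all critical values: by Fatou's theorem the critical
    points enter the neighbourhood of the cycle, which is then grown backwards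
    along their orbits. *)
Lemma crit_trap (K : set C) : (forall z, K z -> K (f z)) -> (forall z, K z -> ~ B z) ->
  exists W, [/\ trap a b W, forall z, K z -> ~ W z, E (th * t1) `<=` W &
    forall z, crit z -> W (f z)].
Proof.
move=> Kf KB; have /andP[th0 th1] := th01.
have tt0 : 0 < th * t1 by rewrite mulr_gt0.
have W0t : trap a b (E (th * t1)) by exact: (cycle_nbhd_trap d0 th01 t10 contract).
have W0K z : K z -> ~ E (th * t1) z.
  move=> /KB nB Ez; apply: nB; apply: cycle_nbhd_basin; apply: (cycle_nbhd_le d0 _ Ez).
  by rewrite ler_piMl ?ltW.
have grow (W : set C) z : trap a b W -> (forall z, K z -> ~ W z) -> E (th * t1) `<=` W ->
    crit z -> exists W', [/\ trap a b W', forall z, K z -> ~ W' z, W `<=` W' & W' z].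
  move=> tW KW EW cz; have [s Es] := cexp_surj cz.1.
  have [k Ek] := fatou hb n0 pn d0 attr tt0 cz.
  have [|W' [tW' KW' WW' [r r0 Hr]]] := @trap_extend K Kf k W s tW KW.
    have tt2 : th * t1 < t1 by rewrite gtr_pMl.
    move: Ek => [j [h [jn hw Ez]]].
    exists (th * t1 * \prod_(i < j) (nc (L1 (0 +i* iter i (G a b) t0)) + d) - nc h).
      by rewrite subr_gt0.
    move=> h' hh'; apply: EW; exists j, (h + h'); split => //.
      by rewrite (le_lt_trans (ncD _ _))// -ltrBrDl.
    by rewrite addrA cexpD -dsm_iter Es Ez -cexpD.
  exists W'; split => //; rewrite -Es -[s]addr0; apply: Hr; by rewrite nc0.
have [[z cz]|no] := pselect (exists z, crit z); last first.
  exists (E (th * t1)); split => // z cz; case: no; by exists z.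
have [W1 [tW1 KW1 EW1 W1z]] := grow _ z W0t W0K (fun x h => h) cz.
have cz' : crit ((conjc (z : R[i]))^-1 : C).
  move: cz => [z0 ez]; have zc0 : conjc (z : R[i]) != 0 :> C by rewrite -nc_gt0 nc_conj nc_gt0.
  split; first by rewrite invr_eq0.
  have := ell_conj b z; rewrite ez conjc0 => <-.
  by rewrite /ell invrK addrC [X in _ + _ * X]addrC addrC.
have [W2 [tW2 KW2 EW2 W2z]] := grow _ _ tW1 KW1 EW1 cz'.
exists W2; split => //; first by move=> x /EW1/EW2.
have inW x : x != 0 -> W2 x -> W2 (f x).
  move=> x0; have [s <-] := cexp_surj x0; case: tW2 => e e0 He Ws.
  by apply: (He s) => //; rewrite subrr (_ : nc _ = 0)//; exact: nc0.
move=> w cw; apply: inW; first exact: cw.1.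
by have [->|->] := crit_pair hb cz cw; [exact: EW2|exact: W2z].
Qed.

(** [trap_expansion] for the part of the circle outside the basin, with the trapping
    set of [crit_trap]. *)
Lemma basin_expansion : exists c lam : R, [/\ 0 < c, 1 < lam &
  forall k t, ~ B (cis t) -> c * lam ^+ k <= nc (Dn a b k (0 +i* t))].
Proof.
pose K : set C := [set z | nc z = 1 /\ ~ B z].
have Kf z : K z -> K (f z).
  by move=> [z1 nB]; split; [exact: (@nc_dsm _ a b 1)|move/(basin_iter f O 1 z)].
have KB z : K z -> ~ B z by case.
have [W [tW KW EW critW]] := crit_trap Kf KB.
have tt0 : 0 < th * t1 by have /andP[th0 _] := th01; rewrite mulr_gt0.
have /nbhs_ncP[e e0 He] := cycle_nbhd_nbhs n0 pn d0 0 tt0.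
have [c [lam [c0 lam1 H]]] := trap_expansion hb tW critW (nc_cis t0) e0
  (fun z h => EW z (He z h)) (fun z (h : K z) => h.1) Kf KW.
exists c, lam; split => // k t nB; apply: H.
by rewrite cexp_imag; split; [exact: nc_cis|].
Qed.

End Contract.

End Basin.

(** * The circle map in the angular coordinate *)

Section CircleMap.
Variable R : realType.
Local Notation C := (CC R).
Variables a b : R.
Hypothesis hb : 0 <= b <= 1.
Local Notation G := (G a b).

Lemma cis_period (t : R) (m : int) : cis (t + 2 * pi * m%:~R) = cis t.
Proof.
have pos (k : nat) (u : R) : cis (u + 2 * pi * k%:R) = cis u.
  elim: k => [|k IH]; first by rewrite mulr0 addr0.
  have -> : u + 2 * pi * k.+1%:R = (u + 2 * pi * k%:R) + pi *+ 2 by rewrite -natr1; ring.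
  by rewrite -IH /cis cosD2pi sinD2pi.
case: m => k; first exact: pos.
by rewrite NegzE -[in RHS](subrK (2 * pi * k.+1%:R) t) -[LHS](pos k.+1) rmorphN /= mulrN subrK.
Qed.

Lemma floor_2pi (t t0 : R) : exists m : int, t <= t0 + 2 * pi * m%:~R < t + 2 * pi.
Proof.
have pi0 := pi_gt0 R; have p0 : 0 < 2 * pi :> R by rewrite mulr_gt0.
exists (Num.ceil ((t - t0) / (2 * pi))).
set x := (t - t0) / (2 * pi).
have tE : t = t0 + 2 * pi * x by rewrite /x mulrC divfK ?gt_eqF// addrC subrK.
have /andP[h1 h2] := ceil_itv x.
have A : 2 * pi * x <= 2 * pi * (Num.ceil x)%:~R by rewrite ler_pM2l.
have B : 2 * pi * (Num.ceil x)%:~R < 2 * pi * (x + 1).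
  by rewrite ltr_pM2l//; move: h1; rewrite rmorphB /= ltrBlDr.
by apply/andP; split; lra.
Qed.

Definition Gp (t : R) : R := 2 + 2 * b * cos t.
Definition DG k (t : R) : R := \prod_(j < k) Gp (iter j G t).

Lemma Gp_ge0 t : 0 <= Gp t.
Proof.
have /andP[b0 b1] := hb; rewrite /Gp.
have := cos_geN1 t; nra.
Qed.

Lemma Gp_le4 t : Gp t <= 4.
Proof.
have /andP[b0 b1] := hb; rewrite /Gp.
have := cos_le1 t; nra.
Qed.

Lemma nc_Lp_imag t : nc (Lp b (0 +i* t)) = Gp t.
Proof.
rewrite -[RHS]ger0_norm ?Gp_ge0// -nc_real; congr nc.
have V : (cis t)^-1 = conjc (cis t : R[i]) :> C.
  have e0 : cis t != 0 :> C by rewrite -nc_gt0 nc_cis.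
  by apply: (mulfI e0); rewrite mulfV// cisK.
rewrite /Lp cexp_imag /ell V /Gp.
by apply/eqP; rewrite eq_complex /=; apply/andP; split; apply/eqP; ring.
Qed.

Lemma nc_DnE k t : nc (Dn a b k (0 +i* t)) = DG k t.
Proof.
rewrite nc_Dn_prod; apply: eq_bigr => j _.
by rewrite iter_imag nc_Lp_imag.
Qed.

Lemma is_derive_G (t : R) : is_derive t (1 : R) G (Gp t).
Proof.
rewrite /G /Gp; apply: is_derive_eq.
by rewrite /GRing.scale /=; ring.
Qed.

Lemma DG_S k t : DG k.+1 t = DG k t * Gp (iter k G t).
Proof. by rewrite /DG big_ord_recr. Qed.

Lemma DG_ge0 k t : 0 <= DG k t.
Proof. by apply: prodr_ge0 => j _; exact: Gp_ge0. Qed.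

Lemma is_derive_iter k (t : R) : is_derive t (1 : R) (iter k G) (DG k t).
Proof.
elim: k => [|k IH].
  by rewrite /DG big_ord0; exact: is_derive_id.
have -> : iter k.+1 G = G \o iter k G by [].
have dG := is_derive_G (iter k G t).
apply: is_derive_eq (is_derive1_comp dG IH) _.
by rewrite DG_S mulrC.
Qed.

Lemma cont_iter k : continuous (iter k G).
Proof.
move=> t; have [dt _] := is_derive_iter k t.
exact/differentiable_continuous/derivable1_diffP.
Qed.

Lemma iter_homo k : {homo iter k G : u v / u <= v}.
Proof.
move=> u v uv; rewrite -subr_ge0.
move: uv; rewrite le_eqVlt => /predU1P[->|uv]; first by rewrite subrr.
have [||x xI ->] := @MVT R (iter k G) (DG k) u v uv.
- by move=> x _; exact: is_derive_iter.
- exact/continuous_subspaceT/cont_iter.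
by rewrite mulr_ge0 ?DG_ge0// subr_ge0 ltW.
Qed.

Lemma DG_le k t : DG k t <= 4 ^+ k.
Proof.
elim: k => [|k IH]; first by rewrite /DG big_ord0 expr0.
by rewrite DG_S exprSr ler_pM ?DG_ge0 ?Gp_ge0 ?Gp_le4.
Qed.

Lemma iter_lip k u v : `|iter k G u - iter k G v| <= 4 ^+ k * `|u - v|.
Proof.
wlog uv : u v / v <= u.
  by move=> W; case/orP: (le_total u v) => h; [rewrite distrC (distrC u)|]; exact: W.
rewrite [`|u - v|]ger0_norm ?subr_ge0//.
apply: (@derive_lip R (iter k G) (DG k)) => //.
- by move=> t _; exact: is_derive_iter.
by move=> t _; rewrite ger0_norm ?DG_ge0 ?DG_le.
Qed.

Lemma DG_lip k : exists2 Lam : R, 0 < Lam & forall u v, `|DG k u - DG k v| <= Lam * `|u - v|.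
Proof.
have Gp_lip u v : `|Gp u - Gp v| <= 2 * `|u - v|.
  wlog uv : u v / v <= u.
    by move=> W; case/orP: (le_total u v) => h; [rewrite distrC (distrC u)|]; exact: W.
  rewrite [`|u - v|]ger0_norm ?subr_ge0//.
  apply: (@derive_lip R Gp (fun t => - (2 * b * sin t))) => //.
    move=> t _; rewrite /Gp; apply: is_derive_eq.
    by rewrite /GRing.scale /=; ring.
  move=> t _; have /andP[b0 b1] := hb.
  rewrite normrN normrM ger0_norm ?mulr_ge0//.
  have := sin_max t; have := normr_ge0 (sin t); nra.
elim: k => [|k [Lam L0 IH]].
  by exists 1 => // u v; rewrite /DG !big_ord0 subrr normr0 mulr_ge0.
exists (Lam * 4 + 4 ^+ k * (2 * 4 ^+ k)).
  by rewrite addr_gt0 ?mulr_gt0 ?exprn_gt0.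
move=> u v; rewrite !DG_S.
have -> : DG k u * Gp (iter k G u) - DG k v * Gp (iter k G v) =
  (DG k u - DG k v) * Gp (iter k G u) + DG k v * (Gp (iter k G u) - Gp (iter k G v)) by ring.
rewrite (le_trans (ler_normD _ _))// [leRHS]mulrDl; apply: lerD; rewrite normrM.
  rewrite mulrAC ler_pM ?normr_ge0// ger0_norm ?Gp_ge0 ?Gp_le4//.
rewrite -mulrA; apply: ler_pM; rewrite ?normr_ge0//.
  by rewrite ger0_norm ?DG_ge0 ?DG_le.
by rewrite (le_trans (Gp_lip _ _))// -mulrA ler_pM2l// iter_lip.
Qed.

End CircleMap.

(** * Uniformly expanded closed sets of angles are null *)

Section NullSet.
Variable R : realType.
Variables a b : R.
Hypothesis hb : 0 <= b <= 1.
Local Notation G := (G a b).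
Local Notation DG := (DG a b).
Local Notation mu := (@lebesgue_measure R).
Variables (K : set R) (c lam t0 : R).
Hypotheses (Kper : forall t (m : int), K t -> K (t + 2 * pi * m%:~R)).
Hypotheses (Kcl : closed K) (KG : forall t, K t -> K (G t)) (Kt0 : ~ K t0).
Hypotheses (c0 : 0 < c) (lam1 : 1 < lam).
Hypothesis expand : forall k t, K t -> c * lam ^+ k <= DG k t.

Lemma lam_large (M : R) : exists k, M <= c * lam ^+ k.
Proof.
have l0 : 0 < lam by exact: lt_trans lam1.
have : (fun m => lam^-1 ^+ m : R) @ \oo --> (0 : R).
  by apply: cvg_expr; rewrite gtr0_norm ?invr_gt0// invf_lt1.
have e0 : 0 < c / (1 + `|M|) by rewrite divr_gt0// ltr_pwDl.
move=> /cvgrPdist_lt/(_ _ e0)[m _ Hm]; exists m.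
have := Hm m (leqnn m); rewrite /= sub0r normrN gtr0_norm ?exprn_gt0 ?invr_gt0//.
have M1 : 0 < 1 + `|M| by rewrite ltr_pwDl.
have lm : 0 < lam ^+ m by rewrite exprn_gt0.
rewrite exprVn ltr_pdivlMr// mulrC ltr_pdivrMr// => H.
by rewrite (le_trans (ler_norm _))// (le_trans _ (ltW H))// lerDr.
Qed.

(** An interval in [K] would be expanded to a whole period. *)
Lemma no_interval (u v : R) : u < v -> exists2 t, u < t < v & ~ K t.
Proof.
move=> uv; apply: contrapT => H.
have HK t : u < t < v -> K t by move=> tI; apply: contrapT => nK; apply: H; exists t.
(* The mean value theorem needs a closed interval inside [K]. *)
pose u' := (2 * u + v) / 3; pose v' := (u + 2 * v) / 3.
have [uu' u'v' v'v] : [/\ u < u', u' < v' & v' < v] by rewrite /u' /v'; split; lra.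
have [k Hk] := lam_large (2 * pi / (v' - u')).
have d0 : 0 < v' - u' by rewrite subr_gt0.
have len : 2 * pi <= iter k G v' - iter k G u'.
  have [||x xI ->] := @MVT R (iter k G) (DG k) u' v' u'v'.
  - by move=> x _; exact: is_derive_iter.
  - exact/continuous_subspaceT/cont_iter.
  rewrite -ler_pdivrMr// (le_trans Hk)//; apply: expand; apply: HK.
  by move: xI; rewrite in_itv /= => /andP[h1 h2]; apply/andP; split; lra.
have [m /andP[m1 m2]] := floor_2pi (iter k G u') t0.
have [||w wI wE] := @IVT R (iter k G) u' v' (t0 + 2 * pi * m%:~R) (ltW u'v').
- exact/continuous_subspaceT/cont_iter.
- by rewrite ge_min le_max m1 /=; apply/orP; right; lra.
have Kw : K w.
  by apply: HK; move: wI; rewrite in_itv /= => /andP[h1 h2]; apply/andP; split; lra.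
have : K (iter k G w) by elim: (k) => // j IH; exact: KG.
rewrite wE => /(Kper (- m)); rewrite rmorphN mulrN addrK; exact: Kt0.
Qed.

(** Finitely many intervals cover a period; each contains a gap, and the shortest
    one has a length that serves everywhere by periodicity. *)
Lemma uniform_gap (eps : R) : 0 < eps -> exists2 del : R, 0 < del &
  forall y, exists z, [/\ y - eps < z, z + del < y + eps &
    forall t, z < t < z + del -> ~ K t].
Proof.
move=> e0; have pi0 := pi_gt0 R; have p0 : 0 < 2 * pi :> R by rewrite mulr_gt0.
pose M := (Num.bound (2 * pi / eps)).+1.
have M0 : 0 < M%:R :> R by rewrite ltr0n.
pose h : R := 2 * pi / M%:R; have h0 : 0 < h by rewrite divr_gt0.
have he : h < eps.
  have hpe : 0 <= 2 * pi / eps by rewrite divr_ge0// ltW.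
  by rewrite /h ltr_pdivrMr// [X in _ < X]mulrC -ltr_pdivrMr// (lt_le_trans (archi_boundP hpe))// ler_nat.
pose P (i : nat) (e : R) := exists z, [/\ h * i%:R < z, z + e < h * (i%:R + 1) &
  forall t, z < t < z + e -> ~ K t].
have [|del del0 Hdel] := @common_small_bound R P M.
  move=> i _; have [|t /andP[t1 t2] nK] := @no_interval (h * i%:R) (h * (i%:R + 1)).
    by rewrite ltr_pM2l// ltrDl.
  have oK : open (~` K) by exact: closed_openC.
  have /nbhs_ballP[r /= r0 Hr] := open_nbhs_nbhs (conj oK nK).
  have e10 : 0 < h * (i%:R + 1) - t by rewrite subr_gt0.
  exists (Num.min r ((h * (i%:R + 1) - t) / 2)); first by rewrite lt_min r0 divr_gt0.
  move=> e' /andP[e'0]; rewrite le_min => /andP[e'r e't]; exists t; split => //; first lra.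
  move=> s /andP[s1 s2]; apply: Hr; rewrite /ball /= distrC gtr0_norm ?subr_gt0//.
  by rewrite ltrBlDl (lt_le_trans s2)// lerD2l.
(* [y] lies in the [k]-th interval; modulo [2 pi], that is, modulo [M] intervals,
   it is the [i]-th. *)
exists del => // y.
pose k := Num.floor (y / h).
have /andP[k1 k2] := floor_itv (y / h); rewrite -/k in k1 k2.
have yk : h * k%:~R <= y by rewrite mulrC -ler_pdivlMr.
have yk' : y < h * (k%:~R + 1) by rewrite mulrC -ltr_pdivrMr//; move: k2; rewrite rmorphD.
pose q := (k %/ M%:Z)%Z; pose i := `|(k %% M%:Z)%Z|%N.
have M0z : M%:Z != 0 by [].
have iE : (k %% M%:Z)%Z = i%:Z by rewrite /i gez0_abs// modz_ge0.
have iM : (i < M)%N by rewrite -ltz_nat -iE (@ltz_pmod k M%:Z).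
have kE : k%:~R = q%:~R * M%:R + i%:R :> R.
  by rewrite {1}(divz_eq k M%:Z) iE rmorphD rmorphM.
have hM : h * M%:R = 2 * pi by rewrite /h divfK// gt_eqF.
have [z [z1 z2 zK]] := Hdel i del iM (introT andP (conj del0 (lexx del))).
have hk : h * k%:~R = 2 * pi * q%:~R + h * i%:R by rewrite kE -hM; ring.
have Kq t : K t -> K (t - 2 * pi * q%:~R).
  by move=> /(Kper (- q)); rewrite rmorphN mulrN.
rewrite mulrDr mulr1 in yk'; rewrite mulrDr mulr1 in z2.
move: (2 * pi * q%:~R) (h * k%:~R) (h * i%:R) hk yk yk' z1 z2 Kq => Q hk hi hkE yk yk' z1 z2 Kq.
exists (z + Q); split; [lra|lra|].
move=> t /andP[h1 h2] /Kq; apply: zK.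
by apply/andP; split; lra.
Qed.

(* From here on an iterate [F] with derivative at least [4] on [K] is used, so that
   its derivative is at least [2] at distance [eps] from [K]. *)
Variable N : nat.
Hypothesis N4 : forall t, K t -> 4 <= DG N t.
Let F := iter N G.
Variable Lam : R.
Hypotheses (Lam0 : 0 < Lam) (DLip : forall u v, `|DG N u - DG N v| <= Lam * `|u - v|).
Let eps := Lam^-1.
Let eps0 : 0 < eps. Proof. by rewrite invr_gt0. Qed.

Let KF t : K t -> K (F t).
Proof. by move=> Kt; rewrite /F; elim: (N) => // j IH; exact: KG. Qed.

Let KFn n t : K t -> K (iter n F t).
Proof. by move=> Kt; elim: n => // j IH; exact: KF. Qed.

Let FhomoI n : {homo iter n F : u v / u <= v}.
Proof. by move=> u v uv; elim: n => //= n IH; exact: (@iter_homo _ a b hb N). Qed.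

Let FMVT u v : u <= v -> exists2 x, u <= x <= v & F v - F u = DG N x * (v - u).
Proof.
rewrite le_eqVlt => /predU1P[->|uv].
  by exists v; rewrite ?lexx// !subrr mulr0.
have [||x xI ->] := @MVT R F (DG N) u v uv.
- by move=> x _; exact: is_derive_iter.
- exact/continuous_subspaceT/cont_iter.
by exists x => //; move: xI; rewrite in_itv /= => /andP[h1 h2]; rewrite !ltW.
Qed.

(** The scale [eps] is chosen so that, at distance [eps * q] from [K], the relative
    error of the derivative is at most [q / 4]. *)
Let slope x u q : K x -> q <= 1 -> `|u - x| <= eps * q ->
  (1 - q / 4) * DG N x <= DG N u <= (1 + q / 4) * DG N x.
Proof.
move=> /N4 x4 q1 ux.
have : `|DG N u - DG N x| <= q.
  rewrite (le_trans (DLip _ _))// (le_trans (ler_wpM2l (ltW Lam0) ux))//.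
  by rewrite mulrA divff ?mul1r// gt_eqF.
rewrite ler_norml => /andP[h1 h2].
have q0 : 0 <= q by lra.
by apply/andP; split; nra.
Qed.

Let q n : R := 2^-1 ^+ n.
Let q0 n : 0 < q n. Proof. by rewrite exprn_gt0// invr_gt0. Qed.
Let q1 n : q n <= 1. Proof. by rewrite exprn_ile1// ?invr_ge0// invf_le1// ler1n. Qed.
Let qS n : q n = 2 * q n.+1. Proof. by rewrite /q exprS mulrA divff ?mul1r// pnatr_eq0. Qed.

Definition DFn n x := \prod_(j < n) DG N (iter j F x).

Lemma DFn_S n x : DFn n.+1 x = DG N x * DFn n (F x).
Proof.
rewrite /DFn big_ord_recl; congr (_ * _).
by apply: eq_bigr => j _; rewrite -iterSr.
Qed.

Lemma DFn_ge4 n x : K x -> 4 ^+ n <= DFn n x.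
Proof.
elim: n x => [|n IH] x Kx; first by rewrite /DFn big_ord0 expr0.
by rewrite DFn_S exprS ler_pM// ?exprn_ge0// ?N4// IH//; exact: KF.
Qed.

(** Going backwards, each step of [F] near [K] at least halves the distance, so the
    intermediate value theorem gives preimages whose distances to the orbit of
    [x] are dominated by a geometric sequence. *)
Lemma pullback n x v : K x -> `|v - iter n F x| <= eps -> exists2 u, iter n F u = v &
  forall j, (j <= n)%N -> `|iter j F u - iter j F x| <= eps * q (n - j).
Proof.
elim: n x v => [|n IH] x v Kx vx.
  exists v => // j; rewrite leqn0 => /eqP ->; by rewrite /q subnn expr0 mulr1.
have [|u' u'v Hu'] := IH (F x) v (KF Kx); first by rewrite -iterSr.
have d : `|u' - F x| <= eps * q n by have := Hu' 0%N isT; rewrite subn0.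
set e := eps * q n.+1.
have e0 : 0 < e by rewrite mulr_gt0.
have dE : `|u' - F x| <= 2 * e by rewrite (le_trans d)// qS /e; lra.
have step s : K x -> (s = e \/ s = - e) -> 2 * e <= `|F (x + s) - F x|.
  move=> _ se.
  have sl y : `|y - x| <= e -> 2 <= DG N y.
    move=> yx; have /andP[h _] := slope Kx (q1 n.+1) yx.
    have := N4 Kx; have := q1 n.+1; nra.
  case: se => ->.
    have [|y /andP[y1 y2] ->] := @FMVT x (x + e); first lra.
    rewrite addrAC subrr add0r normrM (gtr0_norm e0) ler_pM2r//.
    rewrite (le_trans _ (ler_norm _))// sl// ger0_norm; lra.
  have [|y /andP[y1 y2]] := @FMVT (x - e) x; first lra.
  rewrite distrC => ->; rewrite opprB addrC subrK normrM (gtr0_norm e0) ler_pM2r//.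
  rewrite (le_trans _ (ler_norm _))// sl// ler0_norm; lra.
have [u uI Fu] : exists2 u, u \in `[x - e, x + e] & F u = u'.
  have xe : x - e <= x + e by lra.
  apply: (IVT xe); first exact/continuous_subspaceT/cont_iter.
  have h1 := step e Kx (or_introl erefl); have h2 := step (- e) Kx (or_intror erefl).
  have m1 : F x <= F (x + e) by apply: (@FhomoI 1); lra.
  have m2 : F (x - e) <= F x by apply: (@FhomoI 1); lra.
  rewrite ger0_norm ?subr_ge0// in h1; rewrite ler0_norm ?subr_le0// in h2.
  move: dE; rewrite ler_norml => /andP[d1 d2].
  by rewrite ge_min le_max; apply/andP; split; apply/orP; [left|right]; lra.
exists u; first by rewrite iterSr Fu.
case=> [|j] jn; last by rewrite !iterSr Fu subSS Hu'.
rewrite subn0 /= ler_norml; move: uI; rewrite in_itv /= /e => /andP[h1 h2].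
by apply/andP; split; lra.
Qed.

(** Along the orbits of [pullback] the relative errors [q / 4] of the slopes are
    summable. The factors [(3 + q) / 4] and [(3 - q) / 2] are chosen so that the
    induction closes: they lie in [[3 / 4, 1]] and [[1, 3 / 2]], and halving [q]
    leaves room for a factor [1 - q / 4], respectively [1 + q / 4]. *)
Lemma distortion n x u v : K x -> u <= v ->
  (forall j, (j <= n)%N -> `|iter j F u - iter j F x| <= eps * q (n - j)) ->
  (forall j, (j <= n)%N -> `|iter j F v - iter j F x| <= eps * q (n - j)) ->
  (3 + q n) / 4 * (DFn n x * (v - u)) <= iter n F v - iter n F u <=
  (3 - q n) / 2 * (DFn n x * (v - u)).
Proof.
elim: n x u v => [|n IH] x u v Kx uv Hu Hv.
  by rewrite /DFn big_ord0 mul1r /q expr0 /=; apply/andP; split; lra.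
have Fuv : F u <= F v by exact: (@FhomoI 1).
have /andP[l1 l2] : (3 + q n) / 4 * (DFn n (F x) * (F v - F u)) <=
    iter n F (F v) - iter n F (F u) <= (3 - q n) / 2 * (DFn n (F x) * (F v - F u)).
  apply: IH => //; first exact: KF.
  - by move=> j jn; rewrite -!iterSr; have := Hu j.+1 jn; rewrite subSS.
  - by move=> j jn; rewrite -!iterSr; have := Hv j.+1 jn; rewrite subSS.
have [y /andP[y1 y2] Fy] := FMVT uv.
have yx : `|y - x| <= eps * q n.+1.
  have := Hu 0%N isT; have := Hv 0%N isT; rewrite /= subn0 !ler_norml.
  by move=> /andP[a1 a2] /andP[a3 a4]; apply/andP; split; lra.
have /andP[s1 s2] := slope Kx (q1 n.+1) yx.
have Pn0 : 0 <= DFn n (F x) by rewrite (le_trans _ (DFn_ge4 n (KF Kx)))// exprn_ge0.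
have D0 : 0 <= DG N x by rewrite (le_trans _ (N4 Kx)).
have vu0 : 0 <= v - u by rewrite subr_ge0.
rewrite !iterSr DFn_S; rewrite Fy in l1 l2.
have Q0 := q0 n.+1; have Q := qS n.
have Q2 : q n.+1 <= 2^-1 by have := q1 n; lra.
have Q1 : 0 <= q n.+1 * (2^-1 - q n.+1) by rewrite mulr_ge0 ?subr_ge0// ltW.
set A := DFn n (F x) * (v - u); have A0 : 0 <= A by rewrite mulr_ge0.
have E D : DFn n (F x) * (D * (v - u)) = D * A by rewrite /A; ring.
rewrite E in l1 l2; have -> : DG N x * DFn n (F x) * (v - u) = DG N x * A by rewrite /A; ring.
have B1 := ler_wpM2r A0 s1; have B2 := ler_wpM2r A0 s2.
set DA := DG N x * A; have DA0 : 0 <= DA by rewrite mulr_ge0.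
rewrite -!mulrA -/DA in B1 B2.
apply/andP; split.
  apply: le_trans l1; apply: (@le_trans _ _ ((3 + q n) / 4 * ((1 - q n.+1 / 4) * DA))).
    by rewrite [leRHS]mulrA; apply: ler_wpM2r => //; rewrite Q; lra.
  by rewrite ler_wpM2l// divr_ge0//; lra.
apply: le_trans l2 _; apply: (@le_trans _ _ ((3 - q n) / 2 * ((1 + q n.+1 / 4) * DA))).
  by rewrite ler_wpM2l// divr_ge0//; lra.
rewrite [leLHS]mulrA; apply: ler_wpM2r => //; rewrite Q.
have := mulr_ge0 (ltW Q0) (ltW Q0); lra.
Qed.

(** At a density point [x] of [K], the gap near the [n]-th iterate of [x] pulls back
    to an interval off [K] of definite relative size in a ball shrinking to [x]. *)
Lemma no_density_point (del : R) : 0 < del -> (forall y, exists z,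
    [/\ y - eps < z, z + del < y + eps & forall t, z <= t <= z + del -> ~ K t]) ->
  forall x, K x -> ~ (mu (K `&` ball x r) * (mu (ball x r))^-1 @[r --> 0^'+] --> (1 : \bar R))%E.
Proof.
move=> del0 gap x Kx cvg.
(* The proportion of the ball that is occupied by the pulled back gap. *)
pose k0 := del / (6 * eps).
have k00 : 0 < k0 by rewrite divr_gt0// mulr_gt0.
have mK : measurable K by exact: measurable_realfun.closed_measurable.
have scale n : exists r : R, [/\ 0 < r, r * 4 ^+ n <= 2 * eps &
   (mu (K `&` ball x r) <= (2 * r * (1 - k0))%:E)%E].
  have [z [z1 z2 zK]] := gap (iter n F x).
  have near v : iter n F x - eps <= v <= iter n F x + eps -> `|v - iter n F x| <= eps.
    by move=> /andP[h1 h2]; rewrite ler_norml; apply/andP; split; lra.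
  have [|u uz Hu] := pullback (n := n) (v := z) Kx; first by apply: near; apply/andP; split; lra.
  have [|v vz Hv] := pullback (n := n) (v := z + del) Kx; first by apply: near; apply/andP; split; lra.
  have uv : u <= v.
    rewrite leNgt; apply/negP => vu; have := @FhomoI n v u (ltW vu); rewrite uz vz; lra.
  have Hx j : (j <= n)%N -> `|iter j F x - iter j F x| <= eps * q (n - j).
    by move=> _; rewrite subrr normr0 mulr_ge0 ?ltW.
  have P4 := DFn_ge4 n Kx.
  have P0 : 0 < DFn n x by rewrite (lt_le_trans _ P4)// exprn_gt0.
  have qn := q0 n; have qn1 := q1 n.
  have dist w : `|iter n F w - iter n F x| <= eps ->
      (forall j, (j <= n)%N -> `|iter j F w - iter j F x| <= eps * q (n - j)) ->
      `|w - x| * DFn n x < 3 / 2 * eps.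
    rewrite ler_norml => /andP[w1 w2] Hw; rewrite mulrC; have [h|h] := lerP x w.
      have /andP[A _] := distortion Kx h Hx Hw.
      have B : 0 <= DFn n x * (w - x) by rewrite mulr_ge0 ?subr_ge0// ltW.
      nra.
    have /andP[A _] := distortion Kx (ltW h) Hw Hx.
    have B : 0 <= DFn n x * (x - w) by rewrite mulr_ge0 ?subr_ge0// ltW.
    nra.
  have ux : `|u - x| * DFn n x < 3 / 2 * eps.
    by apply: (dist _ _ Hu); rewrite uz; apply: near; apply/andP; split; lra.
  have vx : `|v - x| * DFn n x < 3 / 2 * eps.
    by apply: (dist _ _ Hv); rewrite vz; apply: near; apply/andP; split; lra.
  have len : 2 / 3 * del <= DFn n x * (v - u).
    have /andP[_ A] := distortion Kx uv Hu Hv.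
    have B : 0 <= DFn n x * (v - u) by rewrite mulr_ge0 ?subr_ge0// ltW.
    move: A; rewrite uz vz; nra.
  pose r := 2 * eps / DFn n x.
  have r0 : 0 < r by rewrite divr_gt0// mulr_gt0.
  have rP : r * DFn n x = 2 * eps by rewrite /r divfK// gt_eqF.
  exists r; split => //.
    by rewrite -rP ler_pM2l.
  have ur : `|u - x| < r by rewrite -(ltr_pM2r P0) rP; lra.
  have vr : `|v - x| < r by rewrite -(ltr_pM2r P0) rP; lra.
  have uvr : 2 * r * k0 <= v - u.
    have -> : 2 * r * k0 = 2 / 3 * del / DFn n x by rewrite /r /k0; field; rewrite !gt_eqF.
    by rewrite ler_pdivrMr// [leRHS]mulrC.
  have subK : K `&` ball x r `<=` ball x r `\` `]u, v[.
    move=> t [Kt tr]; split => //; rewrite /= in_itv /= => /andP[h1 h2].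
    have h1' := @FhomoI n u t (ltW h1); have h2' := @FhomoI n t v (ltW h2).
    by apply: (zK (iter n F t)); [rewrite -{1}uz -vz h1' h2'|exact: KFn].
  have mb : measurable (ball x r) by exact: measurable_realfun.measurable_ball.
  have mKb : measurable (K `&` ball x r) by exact: measurableI.
  have sub_b : `]u, v[ `<=` ball x r.
    move=> t; rewrite /= in_itv /= => /andP[h1 h2]; rewrite /ball /= ltr_norml.
    move: ur vr; rewrite !ltr_norml => /andP[a1 a2] /andP[a3 a4].
    by apply/andP; split; lra.
  apply: (@le_trans _ _ (mu (ball x r `\` `]u, v[))).
    by apply: le_measure => //; rewrite inE//; exact: measurableD.
  have mub : mu (ball x r) = (r *+ 2)%:E by rewrite lebesgue_measure_ball// ltW.
  have uv' : u < v by rewrite -subr_gt0; nra.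
  rewrite measureD//=; last by rewrite mub ltry.
  have muv : mu `]u, v[ = (v - u)%:E.
    by rewrite lebesgue_measure_itv /= lte_fin uv' EFinB.
  rewrite (setIidr sub_b); apply: (@le_trans _ _ ((r *+ 2)%:E - (v - u)%:E)%E).
    by rewrite -mub -muv.
  by rewrite -EFinB lee_fin mulr2n; lra.
have [_ /cvgrPdist_lt/(_ _ k00)[e /= e0 He]] := (iffLR (fine_cvgP _ _)) cvg.
pose n := Num.bound (2 * eps / e).
have [r [r0 r4 Hr]] := scale n.
have n4 : n%:R <= 4 ^+ n :> R.
  by rewrite -natrX ler_nat ltnW// ltn_expl.
have re : r < e.
  have e2 : 0 <= 2 * eps / e by rewrite divr_ge0// ?mulr_ge0// ltW.
  have := archi_boundP e2; rewrite ltr_pdivrMr// -/n => h.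
  have h4 : r * n%:R < e * n%:R.
    by rewrite (le_lt_trans (ler_wpM2l (ltW r0) n4))// (le_lt_trans r4)// [ltRHS]mulrC.
  have n0 : 0 < n%:R :> R by rewrite -(ltr_pM2r e0) mul0r (lt_trans _ h)// mulr_gt0.
  by move: h4; rewrite ltr_pM2r.
have := He r; rewrite /ball /= sub0r normrN gtr0_norm// => /(_ re r0).
have mub : mu (ball x r) = (r *+ 2)%:E by rewrite lebesgue_measure_ball// ltW.
have r20 : 0 < r *+ 2 by rewrite mulrn_wgt0.
rewrite mub inver gt_eqF//.
have m0 : (0 <= mu (K `&` ball x r))%E by exact: measure_ge0.
have mf : mu (K `&` ball x r) \is a fin_num.
  by rewrite ge0_fin_numE// (le_lt_trans Hr)// ltry.
rewrite -(fineK mf) in Hr *; rewrite lee_fin in Hr; rewrite -EFinM /=.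
move=> /(le_lt_trans (ler_norm _)); rewrite ltrBlDr -ltrBlDl.
apply/negP; rewrite -leNgt ler_pdivrMr// (le_trans Hr)// mulr2n; lra.
Qed.

End NullSet.

(** By Lebesgue's density theorem almost every point of [K] would be a density
    point, which [no_density_point] excludes. *)
Lemma expanding_null (R : realType) (a b : R) (K : set R) (c lam t0 : R) : 0 <= b <= 1 ->
  (forall t (m : int), K t -> K (t + 2 * pi * m%:~R)) -> closed K ->
  (forall t, K t -> K (G a b t)) -> ~ K t0 -> 0 < c -> 1 < lam ->
  (forall k t, K t -> c * lam ^+ k <= DG a b k t) -> lebesgue_measure K = 0%E.
Proof.
move=> hb Kper Kcl KG Kt0 c0 lam1 expand.
have [N HN] := lam_large c0 lam1 4.
have N4 t : K t -> 4 <= DG a b N t by move=> Kt; rewrite (le_trans HN)// expand.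
have [Lam Lam0 DLip] := @DG_lip R a b hb N.
have eps0 : 0 < Lam^-1 by rewrite invr_gt0.
have [del del0 gap] := uniform_gap Kper Kcl KG Kt0 c0 lam1 expand eps0.
have del30 : 0 < del / 3 by rewrite divr_gt0.
have mK : measurable K by exact: measurable_realfun.closed_measurable.
apply: measure_negligible => //.
have [A [mA A0 HA]] := lebesgue_density mK.
exists A; split => // x Kx; apply: HA => /=.
rewrite indicE mem_set//= => cvg.
apply: (no_density_point hb Kcl KG N4 Lam0 DLip del30 _ Kx cvg).
move=> y; have [z [z1 z2 zK]] := gap y; exists (z + del / 3); split; [lra|lra|].
by move=> t /andP[h1 h2]; apply: zK; apply/andP; split; lra.
Qed.

(** * Angles and arc length *)

Section Angles.
Variable R : realType.
Local Notation C := (CC R).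

Lemma cis_inj (t u : R) : 0 <= t < 2 * pi -> 0 <= u < 2 * pi -> cis t = cis u -> t = u.
Proof.
wlog ut : t u / u <= t.
  move=> W tI uI E; case/orP: (le_total u t) => h; first exact: W.
  by apply/esym/W.
move=> /andP[t0 tp] /andP[u0 up] [ct st]; have pi0 := pi_gt0 R.
have c1 : cos (t - u) = 1 by rewrite cosB ct st -!expr2 cos2Dsin2.
have [h|h] := lerP (t - u) pi.
  suff : t - u = 0 by lra.
  apply: cos_inj; rewrite ?in_itv /= ?lexx ?pi_ge0 ?subr_ge0 ?ut ?h//.
  by rewrite c1 cos0.
suff : 2 * pi - (t - u) = 0 by lra.
apply: cos_inj; rewrite ?in_itv /= ?lexx ?pi_ge0//.
  by apply/andP; split; lra.
by rewrite addrC mulr_natl cosD2pi cosN c1 cos0.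
Qed.

Lemma cont_cis : continuous (@cis R : R -> C).
Proof. by move=> t; exact: (rdiff_cont (rdiff_cis t)). Qed.

Lemma circleE (z : C) : circle R z <-> nc z = 1.
Proof.
rewrite /circle /=; split=> [h|h]; last by rewrite normE h.
by move: h; rewrite normE => -[].
Qed.

Lemma closed_angles (A : set C) : closed A -> closed [set t : R | A (cis t)].
Proof. by move=> cA; apply: closed_comp => // t _; exact: cont_cis. Qed.

Lemma finite_circle_measure0 (A : set C) : finite_set A -> A `<=` @circle R ->
  circle_measure A = 0%E.
Proof.
move=> fA cA; apply: countable_lebesgue_measure0.
pose ang (z : C) : R := xget 0 [set t : R | 0 <= t < 2 * pi /\ z = cis t].
apply: (sub_countable _ (finite_set_countable (finite_image ang fA))).
apply: subset_card_le => t [tI At]; exists (cis t) => //.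
have [|h1 h2] := @xgetPex _ (0 : R) [set u : R | 0 <= u < 2 * pi /\ cis t = cis u].
  by exists t.
by apply: cis_inj.
Qed.

End Angles.

(** * Chaotic sets that meet a basin *)

Lemma val_iter_restriction (T : Type) (f : T -> T) (X : set T) (fX : forward_invariant f X) k x :
  \val (iter k (restriction fX) x) = iter k f (\val x).
Proof. by elim: k => //= k ->. Qed.

(** A periodic orbit that converges to a finite set lies in it, so periodic points
    in the basin lie on the cycle. By density the cycle is relatively open in [X],
    and transitivity leaves room for nothing else. *)
Lemma devaney_in_basin (T : topologicalType) (f : T -> T) (O U X : set T)
    (fX : forward_invariant f X) : hausdorff_space T -> finite_set O ->
  (forall q, O q -> O = [set iter k f q | k in [set: nat]]) ->
  open U -> (forall x, X x -> U x -> basin f O x) -> (O `<=` U) ->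
  devaney_chaotic (restriction fX) -> X `&` U !=set0 -> X = O.
Proof.
move=> haus fO Ocyc oU UB OU [_ trans perd] [x0 [Xx0 Ux0]].
have cO : closed O.
  exact: (iffLR accessible_finite_set_closed (hausdorff_accessible haus)).
have fO' : forward_invariant f O.
  move=> q Oq; rewrite (Ocyc _ Oq); by exists 1%N.
(* Open sets of the subspace [X] are traces of open sets. *)
have openX (V : set T) : open V -> open ((\val : set_type X -> T) @^-1` V).
  by move=> oV; exists V; rewrite ?set_valE.
have perO (y : set_type X) : periodic_points (restriction fX) y -> U (\val y) -> O (\val y).
  move=> [m m0 my] Uy; apply: contrapT => nOy.
  have Xy := set_mem (valP y).
  have := UB _ Xy Uy (~` [set \val y]); case.
    move=> q Oq; apply: open_nbhs_nbhs; split; last by move=> E; apply: nOy; move: Oq; rewrite [q]E.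
    by apply: closed_openC; exact: (accessible_closed_set1 (hausdorff_accessible haus)).
  move=> N _ HN; apply: (HN (N * m)%N); first by rewrite /= leq_pmulr.
  have -> : iter (N * m) f (\val y) = \val (iter (N * m) (restriction fX) y).
    by rewrite val_iter_restriction.
  congr val; elim: (N) => // j IH; by rewrite mulSn iterD IH.
have meetO (V : set T) : open V -> V `<=` U -> X `&` V !=set0 -> exists2 y, O y & X y /\ V y.
  move=> oV VU [x [Xx Vx]].
  have [|y [Vy py]] := perd _ _ (openX V oV); first by exists (SigSub (mem_set Xx)).
  exists (\val y); first by apply: perO => //; exact: VU.
  by split => //; exact: set_mem (valP y).
have OX : O `<=` X.
  have [y Oy [Xy _]] := meetO U oU (fun=> id) (ex_intro _ x0 (conj Xx0 Ux0)).
  rewrite (Ocyc y Oy) => _ [k _ <-].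
  by elim: k => // k IH; exact: (fX _ IH).
have XU : X `&` U `<=` O.
  move=> x [Xx Ux]; apply: contrapT => nOx.
  have oV : open (U `&` ~` O) by apply: openI => //; exact: closed_openC.
  have [|y Oy [_ [_ nOy]]] := meetO _ oV (@subIsetl _ _ _); first by exists x; split.
  exact: nOy.
apply/seteqP; split => // x Xx; apply: contrapT => nOx.
have [||n [y [[z Uz zy] nOy]]] := trans _ _ (openX U oU) (openX (~` O) (closed_openC cO)).
- by exists (SigSub (mem_set Xx0)).
- by exists (SigSub (mem_set Xx)).
apply: nOy; rewrite -zy val_iter_restriction.
have Oz : O (\val z) by apply: XU; split => //; exact: set_mem (valP z).
by elim: (n) => // k IH; exact: fO'.
Qed.

(** * The attracting cycle and the theorem *)

Section CycleStructure.
Variable R : realType.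
Local Notation C := (CC R).
Variables a b : R.
Hypothesis hb : 0 <= b <= 1.
Local Notation f := (dsm a b).

(** Collects what the theorem uses, free of the auxiliary neighbourhoods. The set of
    angles in the basin is open because, at the time an orbit enters a small
    neighbourhood of the cycle, nearby orbits are in a larger one. *)
Lemma attracting_cycle_structure (O : set C) : attracting_cycle f O -> O `<=` @circle R ->
  [/\ finite_set O, forall q, O q -> O = [set iter k f q | k in [set: nat]],
    O `<=` basin f O /\ total_basin f O = basin f O `&` @circle R,
    open [set t : R | basin f O (cis t)] &
    exists c lam : R, [/\ 0 < c, 1 < lam &
      forall k t, ~ basin f O (cis t) -> c * lam ^+ k <= DG a b k t]].
Proof.
move=> [p [n [n0 pn _ OE mult]]] Oc.
have p1 : nc p = 1 by apply/circleE/Oc; rewrite OE; exists 0%N.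
have [t0 _ pE] := cis_surj p1; rewrite {p p1}pE in pn OE mult.
have attr : nc (Dn a b n (0 +i* t0)) < 1.
  by move: mult; rewrite derive1_iter -(rmorph1 (real_complex R)) ltcR.
have lt1 : \prod_(j < n) nc (Lp b (0 +i* iter j (G a b) t0)) < 1.
  move: attr; rewrite nc_Dn_prod; congr (_ < _).
  by apply: eq_bigr => j _; rewrite iter_imag.
have [d d0 dl] := @prod_slack R n (fun j => nc (Lp b (0 +i* iter j (G a b) t0))) lt1.
have [th [t1 [th01 t10 contract]]] := cycle_nbhd_contract hb n0 pn d0 dl.
have ncyc m : iter (m * n) f (cis t0) = cis t0.
  by elim: m => // m IH; rewrite mulSn iterD IH.
split.
- rewrite OE; apply: (sub_finite_set _ (finite_image (fun k => iter k f (cis t0)) (finite_II n))).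
  move=> _ [k _ <-]; have [j jn ->] := orbit_mod n0 pn k; by exists j.
- move=> q; rewrite OE => -[i _ <-]; apply/seteqP; split=> [_ [k _ <-]|_ [k _ <-]]; last first.
    by exists (k + i)%N; rewrite // iterD.
  exists (k + (i * n - i))%N => //; rewrite -iterD -addnA subnK ?leq_pmulr//.
  by rewrite iterD ncyc.
- split.
    rewrite {1}OE => _ [k _ <-]; rewrite OE.
    apply: (cycle_nbhd_basin d0 th01 t10 contract).
    exact: cycle_nbhd_center.
  by rewrite OE; exact: (total_basinE n0 pn d0 th01 t10 contract).
- rewrite OE openE => t /= Bt.
  have tt0 : 0 < th * t1 by have /andP[th0 _] := th01; rewrite mulr_gt0.
  have [k Ek] := basin_enter n0 pn d0 tt0 Bt.
  have [|e e0 He] := @cycle_nbhd_margin R a b t0 n d d0 (th * t1) t1.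
    by have /andP[_ th1] := th01; rewrite gtr_pMl.
  have /cvgrPdist_lt/(_ _ e0) Hc := @cont_iter R a b k t.
  rewrite /interior /=; apply: filterS Hc => u ue /=.
  apply/(basin_iter f _ k); apply: (cycle_nbhd_basin d0 th01 t10 contract).
  rewrite dsm_iter_cis -cexp_imag; apply: (He (0 +i* iter k (G a b) t)).
    by rewrite cexp_imag -dsm_iter_cis.
  have -> : (0 +i* iter k (G a b) u : C) - (0 +i* iter k (G a b) t) =
      0 +i* (iter k (G a b) u - iter k (G a b) t).
    by apply/eqP; rewrite eq_complex /= subrr !eqxx.
  by rewrite nc_imag distrC.
- have [c [lam [c0 lam1 H]]] := basin_expansion hb n0 pn d0 attr th01 t10 contract.
  exists c, lam; split => // k t nB; rewrite -(@nc_DnE R a b hb); apply: H.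
  by rewrite -OE.
Qed.

End CycleStructure.

Theorem lemma4p4 (R : realType) (a b : R) (hb : 0 <= b <= 1)
    (O : set (CC R)) (hO : attracting_cycle (dsm a b) O)
    (hOS : O `<=` circle R) :
  [/\ hyperbolic_set (dsm a b) (basin_complement (dsm a b) O),
      circle_measure (basin_complement (dsm a b) O) = 0%E
    & nowhere_dense ((\val : set_type (circle R) -> CC R)
                       @^-1` basin_complement (dsm a b) O)]
  /\
  (forall (X : set (CC R)) (gX : forward_invariant (dsm a b) X),
      closed X -> X `<=` circle R -> devaney_chaotic (restriction gX) ->
      (X <> O -> X `<=` basin_complement (dsm a b) O)
      /\ circle_measure X = 0%E).
Proof.
have [fO Ocyc [OB tbE] oB [c [lam [c0 lam1 expand]]]] := attracting_cycle_structure hb hO hOS.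
set f := dsm a b in hO fO Ocyc OB tbE oB expand *; set B := basin f O in OB tbE oB expand.
pose Kt : set R := [set t | ~ B (cis t)].
have KE z : basin_complement f O z <-> circle R z /\ ~ B z.
  rewrite /basin_complement tbE; split=> [[cz nB]|[cz nB]]; split => // Bz; first exact: nB.
  by apply: nB; case: Bz.
have Binv z : B (f z) <-> B z by exact: (basin_iter f O 1).
(* From the plane to angles. *)
have Kper t (m : int) : Kt t -> Kt (t + 2 * pi * m%:~R) by rewrite /Kt /= cis_period.
have Kcl : closed Kt by exact: (open_closedC oB).
have KG t : Kt t -> Kt (G a b t) by rewrite /Kt /= -dsm_cis => nB /Binv.
have Kcirc : basin_complement f O `<=` circle R by move=> z /KE[].
have Kinv : forward_invariant f (basin_complement f O).
  move=> z /KE[/circleE z1 nB]; apply/KE; split; last by move/Binv.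
  exact/circleE/(@nc_dsm _ a b 1).
have [t0 Bt0] : exists t0, B (cis t0).
  case: hO => p [n [_ _ _ OE _]]; have Op : O p by rewrite OE; exists 0%N.
  have [t _ pE] := cis_surj (iffLR (circleE p) (hOS _ Op)).
  by exists t; rewrite -pE; exact: OB.
have nKt0 : ~ Kt t0 by move=> /(_ Bt0).
have K0 : lebesgue_measure Kt = 0%E.
  exact: (expanding_null hb Kper Kcl KG nKt0 c0 lam1 expand).
have null (A : set (CC R)) : closed A -> A `<=` basin_complement f O -> circle_measure A = 0%E.
  move=> cA AK; apply: (subset_measure0 _ _ _ K0).
  - rewrite (_ : mkset _ = `[0, 2 * pi[ `&` [set t : R | A (cis t)]).
      apply: measurableI => //.
      by apply: measurable_realfun.closed_measurable; exact: closed_angles.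
    by apply/seteqP; split=> t /=; rewrite in_itv.
  - exact: measurable_realfun.closed_measurable.
  - by move=> t [_ /AK/KE[]].
have Kcomp : compact (basin_complement f O).
  have -> : basin_complement f O = (@cis R : R -> CC R) @` (Kt `&` `[0, 2 * pi]).
    apply/seteqP; split=> [z /KE[/circleE/cis_surj[t /andP[t1 t2] ->] nB]|_ [t [Kt' _] <-]].
      by exists t => //; split => //; rewrite /= in_itv /= t1 ltW.
    by apply/KE; split => //; apply/circleE; exact: nc_cis.
  apply: continuous_compact; first exact/continuous_subspaceT/cont_cis.
  apply: (subclosed_compact _ (@segment_compact R 0 (2 * pi))); last by move=> t [].
  by apply: closedI => //; exact: itv_closed.
have Kclosed : closed (basin_complement f O).
  by apply: compact_closed => //; exact: norm_hausdorff.
split.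
  split.
  - split => //; exists c, lam; split => // z n /KE[/circleE/cis_surj[t _ ->] nB].
    by rewrite derive1_iter lecR (@nc_DnE R a b hb) expand.
  - exact: null.
  - rewrite /nowhere_dense -subset0 => x.
    have cpre : closed ((\val : set_type (circle R) -> CC R) @^-1` basin_complement f O).
      rewrite -[X in closed X]setCK; apply: open_closedC.
      by exists (~` basin_complement f O); [exact: closed_openC|rewrite set_valE].
    rewrite /interior -(closure_id _).1// => -[_ [/= [V oV <-]]].
    rewrite set_valE /= => Vx VK.
    have [t _ xt] := cis_surj (iffLR (circleE (\val x)) (set_mem (valP x))).
    have : nbhs t ((@cis R : R -> CC R) @^-1` V).
      by apply: cont_cis; rewrite -xt; exact: open_nbhs_nbhs.
    move=> /nbhs_ballP[r /= r0 Hr].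
    have tr : t < t + r by rewrite ltrDl.
    have [s /andP[ts sr] nKs] := no_interval Kper KG nKt0 c0 lam1 expand tr.
    apply: nKs; have cs : circle R (cis s) by apply/circleE; exact: nc_cis.
    have Vs : V (cis s).
      apply: Hr.
      by rewrite /ball /= distrC gtr0_norm ?subr_gt0// ltrBlDl.
    by have [] := iffLR (KE _) (VK (SigSub (mem_set cs)) Vs).
move=> X gX cX Xc dX.
have XO : X <> O -> X `<=` basin_complement f O.
  move=> XnO x Xx; apply: contrapT => nKx; apply: XnO.
  apply: (devaney_in_basin _ fO Ocyc (closed_openC Kclosed) _ _ dX).
  - exact: norm_hausdorff.
  - move=> y Xy nKy; apply: contrapT => nB; apply: nKy; apply/KE; split => //; exact: Xc.
  - by move=> y Oy /KE[_]; apply; exact: OB.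
  - by exists x.
split => //; have [->|XnO] := pselect (X = O); first exact: finite_circle_measure0.
by apply: null => //; exact: XO.
Qed.
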